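(* Let $(B,g_B)$ and $(F,g_F)$ be pseudo-Riemannian manifolds of positive dimension with $\dim B+\dim F=4$, let $f:B\to\mathbb{R}^+$ be a smooth positive function on $B$, and let $B\times_f F$ be the warped product, i.e. the manifold $B\times F$ endowed with the pseudo-Riemannian metric $g=g_B\oplus f^2 g_F$ (of arbitrary signature). Then $B\times_f F$ is conformally Osserman if and only if it is locally conformally flat.
   Context: Let $(M,g)$ be a pseudo-Riemannian manifold of dimension $n\ge 3$ with Levi-Civita connection $\nabla$. The curvature tensor is taken with the sign convention $R(X,Y)=\nabla_{[X,Y]}-[\nabla_X,\nabla_Y]$, and $R(X,Y,Z,V)=g(R(X,Y)Z,V)$. The Ricci tensor is $\rho(X,Y)=\sum_i \epsilon_i R(X,E_i,Y,E_i)$ and the scalar curvature is $\tau=\sum_i\epsilon_i\rho(E_i,E_i)$, for an orthonormal basis $\{E_i\}$ with $\epsilon_i=g(E_i,E_i)=\pm1$. The Weyl tensor $W$ is defined by $R=C\bullet g+W$, where $C=\frac{1}{n-2}\left(\rho-\frac{\tau}{2(n-1)}g\right)$ is the Schouten tensor and $(C\bullet g)(X,Y,Z,V)=C(X,Z)g(Y,V)+C(Y,V)g(X,Z)-C(X,V)g(Y,Z)-C(Y,Z)g(X,V)$. The conformal Jacobi operator is $\mathcal{J}_W(X)Y=W(X,Y)X$. $(M,g)$ is conformally Osserman if for every $p\in M$ the (complex) eigenvalues, counted with multiplicities, of $\mathcal{J}_W(x)$ on $T_pM$ are constant for $x$ in each of the pseudo-spheres $S_p^{\pm}=\{x\in T_pM: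 g_p(x,x)=\pm1\}$ (they may depend on $p$). $(M,g)$ is locally conformally flat if every point has a neighbourhood on which $g$ is conformal to a flat metric. *)

(* Defs.v *)
From HB Require Import structures.
From mathcomp Require Import all_boot all_order all_algebra.
From mathcomp Require Import all_classical all_reals all_analysis.
From mathcomp Require Import complex ring lra.

Set Implicit Arguments.
Unset Strict Implicit.
Unset Printing Implicit Defensive.

Import Order.TTheory GRing.Theory Num.Theory.
Import numFieldNormedType.Exports.

Local Open Scope classical_set_scope.
Local Open Scope ring_scope.

(* Conventions.  Vectors are row vectors, so a linear map acts by right       *)
(* multiplication and a bilinear form with Gram matrix G is v *m G *m w^T.    *)

Section Smooth.
Variables (R : realType) (n : nat).

(* C^k on U (meant for open U): h is continuous on U and, for k > 0,          *)
(* differentiable on U with all its directional derivatives C^(k-1) on U.     *)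
Fixpoint Ck (V : normedModType R) (k : nat) (U : set 'rV[R]_n)
    (h : 'rV[R]_n -> V) : Prop :=
  match k with
  | 0 => forall x, U x -> {for x, continuous h}
  | k'.+1 => (forall x, U x -> differentiable h x) /\
             forall v, Ck k' U (fun x => 'D_v h x)
  end.

Definition smooth (V : normedModType R) (U : set 'rV[R]_n)
    (h : 'rV[R]_n -> V) : Prop := forall k, Ck k U h.

End Smooth.

Section LinearAlgebra.
Variables (R : realType) (n : nat).
Implicit Types (G E : 'M[R]_n) (v w : 'rV[R]_n).

Definition inner G v w : R := (v *m G *m w^T) 0 0.

Definition basis_vec (i : 'I_n) : 'rV[R]_n := delta_mx 0 i.

(* The vector u with inner G u v = alpha v for all v (alpha linear).          *)
Definition sharp G (alpha : 'rV[R]_n -> R) : 'rV[R]_n :=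
  (\row_j alpha (basis_vec j)) *m invmx G.

(* The trace of the bilinear form T with respect to G; see trace_orthonormal  *)
(* below for its expression in an orthonormal basis.                          *)
Definition metric_trace G (T : 'rV[R]_n -> 'rV[R]_n -> R) : R :=
  \sum_i \sum_j invmx G i j * T (basis_vec i) (basis_vec j).

(* The algebraic multiplicity of l as a complex eigenvalue of A.              *)
Definition eigen_mult (A : 'M[R]_n) (l : R[i]) : nat :=
  mup l (char_poly (map_mx (real_complex R) A)).

End LinearAlgebra.

Section LinearAlgebraTheory.
Variables (R : realType) (n : nat).
Implicit Types (G E : 'M[R]_n) (v w : 'rV[R]_n).

Lemma inner_sym G v w : G^T = G -> inner G v w = inner G w v.
Proof.
move=> Gs; rewrite /inner; have <- : (w *m G *m v^T)^T = v *m G *m w^T.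
  by rewrite !trmx_mul trmxK Gs mulmxA.
by rewrite mxE.
Qed.

Lemma linear_row (alpha : 'rV[R]_n -> R) v : linear alpha ->
  alpha v = \sum_j v 0 j * alpha (basis_vec R j).
Proof.
move=> lin; pose A : {linear _ -> _} :=
  HB.pack alpha (GRing.isLinear.Build _ _ _ _ alpha lin).
rewrite -[alpha v]/(A v) [in LHS](row_sum_delta v) linear_sum.
by apply: eq_bigr => j _; rewrite linearZ.
Qed.

Lemma sharpP G (alpha : 'rV[R]_n -> R) v :
  G \in unitmx -> linear alpha -> inner G (sharp G alpha) v = alpha v.
Proof.
move=> Gu lin; rewrite /inner /sharp mulmxKV // mxE (linear_row v lin).
by apply: eq_bigr => j _; rewrite !mxE mulrC.
Qed.

Lemma trace_orthonormal G E (e : 'rV[R]_n) (T : 'rV[R]_n -> 'rV[R]_n -> R) :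
  (forall v, linear (T v)) -> (forall w, linear (T^~ w)) ->
  (forall i j, inner G (row i E) (row j E) = e 0 i *+ (i == j)) ->
  (forall i, e 0 i = 1 \/ e 0 i = -1) ->
  metric_trace G T = \sum_i e 0 i * T (row i E) (row i E).
Proof.
move=> linr linl orth e1.
have EGE : E *m G *m E^T = diag_mx e.
  apply/matrixP => i j; rewrite [RHS]mxE -orth /inner.
  by rewrite tr_row -!row_mul !mxE; apply: eq_bigr => k _; rewrite !mxE.
have DD : diag_mx e *m diag_mx e = 1%:M.
  rewrite mulmx_diag; apply/matrixP => i j; rewrite !mxE.
  by case: (e1 i) => ->; rewrite ?mulrNN mulr1.
have inv : invmx G = E^T *m diag_mx e *m E.
  have K : E^T *m (diag_mx e *m E *m G) = 1%:M.
    by apply: mulmx1C; rewrite -!mulmxA [E *m _]mulmxA EGE.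
  rewrite !mulmxA in K; have /mulmx1_unit[_ Gu] := K.
  by rewrite -[RHS](mulmxK Gu) K mul1mx.
pose S := \matrix_(i, j) T (basis_vec R i) (basis_vec R j).
have TS v w : T v w = \sum_i \sum_j v 0 i * S i j * w 0 j.
  rewrite (linear_row v (linl w)); apply: eq_bigr => i _.
  rewrite (linear_row w (linr _)) mulr_sumr; apply: eq_bigr => j _.
  by rewrite !mxE; ring.
rewrite /metric_trace inv.
transitivity (\sum_k \sum_i \sum_j e 0 k * (E k i * S i j * E k j)).
  rewrite [RHS]exchange_big /=; apply: eq_bigr => i _.
  rewrite [RHS]exchange_big /=; apply: eq_bigr => j _.
  rewrite mul_mx_diag mxE mulr_suml; apply: eq_bigr => k _; rewrite !mxE.
  by ring.
apply: eq_bigr => k _; rewrite TS mulr_sumr; apply: eq_bigr => i _.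
by rewrite mulr_sumr; apply: eq_bigr => j _; rewrite !mxE.
Qed.

End LinearAlgebraTheory.


(* Pseudo-Riemannian geometry in one coordinate system.  Here g x is the Gram *)
(* matrix, at the point of coordinates x, of the coordinate frame.            *)
Section LocalGeometry.
Variables (R : realType) (n : nat) (g : 'rV[R]_n -> 'M[R]_n).
Implicit Types (x u v w z : 'rV[R]_n) (X Y Z : 'rV[R]_n -> 'rV[R]_n).

(* The Koszul formula for constant (hence commuting) fields: half of this is  *)
(* g (nabla_v w, z).  That nabla is the Levi-Civita connection is the content *)
(* of nabla_torsion_free and christoffel_metric below.                        *)
Definition koszul x v w z : R :=
  'D_v (fun y => inner (g y) w z) x + 'D_w (fun y => inner (g y) v z) x
  - 'D_z (fun y => inner (g y) v w) x.

Definition christoffel x v w : 'rV[R]_n :=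
  sharp (g x) (fun z => 2^-1 * koszul x v w z).

Definition nabla X Y : 'rV[R]_n -> 'rV[R]_n :=
  fun x => 'D_(X x) Y x + christoffel x (X x) (Y x).

Definition lie_bracket X Y : 'rV[R]_n -> 'rV[R]_n :=
  fun x => 'D_(X x) Y x - 'D_(Y x) X x.

Definition curvature_op X Y Z : 'rV[R]_n -> 'rV[R]_n :=
  fun x => nabla (lie_bracket X Y) Z x
           - (nabla X (nabla Y Z) x - nabla Y (nabla X Z) x).

(* The curvature is tensorial, so that tangent vectors at x may be extended   *)
(* to constant fields.                                                        *)
Definition riem x v w z u : R :=
  inner (g x) (curvature_op (cst v) (cst w) (cst z) x) u.

Definition ricci x v w : R :=
  metric_trace (g x) (fun a b => riem x v a w b).

Definition scal x : R := metric_trace (g x) (ricci x).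

Definition schouten x v w : R :=
  (n%:R - 2)^-1 * (ricci x v w - scal x / (2 * (n%:R - 1)) * inner (g x) v w).

Definition schouten_bullet x v w z u : R :=
  let C := schouten x in let G := inner (g x) in
  C v z * G w u + C w u * G v z - C v u * G w z - C w z * G v u.

Definition weyl x v w z u : R := riem x v w z u - schouten_bullet x v w z u.

Definition weyl_op x v w z : 'rV[R]_n := sharp (g x) (weyl x v w z).

(* Matrix of the conformal Jacobi operator y |-> W(v, y) v.                   *)
Definition jacobi_weyl x v : 'M[R]_n := lin1_mx (fun y => weyl_op x v y v).

End LocalGeometry.

(* The data of a topological space with an atlas.  The chart i is the map     *)
(* chart_map i : chart_dom i -> 'rV_n with inverse chart_inv i; both are      *)
(* total functions whose values outside chart_dom i and its image are         *)
(* irrelevant.                                                                *)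
Structure charted_space (R : realType) (n : nat) := ChartedSpace {
  carrier :> topologicalType;
  chart : Type;
  chart_dom : chart -> set carrier;
  chart_map : chart -> carrier -> 'rV[R]_n;
  chart_inv : chart -> 'rV[R]_n -> carrier }.

Section Manifold.
Variables (R : realType) (n : nat).

Definition transition (M : charted_space R n) (i j : chart M) :
  'rV[R]_n -> 'rV[R]_n := fun x => chart_map j (chart_inv i x).

Record is_manifold (M : charted_space R n) : Prop := IsManifold {
  manifold_hausdorff : hausdorff_space M;
  manifold_second_countable : @second_countable M;
  chart_dom_open : forall i : chart M, open (chart_dom i);
  chart_dom_cover : forall p : M, exists i : chart M, chart_dom i p;
  chart_mapK : forall (i : chart M) p,
    chart_dom i p -> chart_inv i (chart_map i p) = p;
  chart_open : forall i : chart M, open (chart_map i @` chart_dom i);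
  chart_continuous : forall (i : chart M) p,
    chart_dom i p -> {for p, continuous (chart_map i)};
  chart_inv_continuous : forall (i : chart M) x,
    (chart_map i @` chart_dom i) x -> {for x, continuous (chart_inv i)};
  transition_smooth : forall i j : chart M,
    smooth (chart_map i @` (chart_dom i `&` chart_dom j)) (transition i j) }.

Variable M : charted_space R n.

Definition smooth_on (U : set M) (f : M -> R) : Prop :=
  forall i : chart M,
    smooth (chart_map i @` (U `&` chart_dom i)) (f \o chart_inv i).

(* A field of bilinear forms, given by its Gram matrix at p in the frame of   *)
(* the chart i, for p in chart_dom i; its other values are irrelevant.        *)
Definition gram_field := chart M -> M -> 'M[R]_n.

Definition local_metric (g : gram_field) (i : chart M) : 'rV[R]_n -> 'M[R]_n :=
  g i \o chart_inv i.

(* Tangent vectors at p with components v in the chart i have components      *)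
(* v *m 'J (transition i j) (chart_map i p) in the chart j.                   *)
Record pseudo_metric_on (U : set M) (g : gram_field) : Prop := PseudoMetricOn {
  gram_sym : forall i p, U p -> chart_dom i p -> (g i p)^T = g i p;
  gram_nondegenerate : forall i p, U p -> chart_dom i p -> g i p \in unitmx;
  gram_smooth : forall i,
    smooth (chart_map i @` (U `&` chart_dom i)) (local_metric g i);
  gram_transition : forall i j p, U p -> chart_dom i p -> chart_dom j p ->
    let J := 'J (transition i j) (chart_map i p) in
    g i p = J *m g j p *m J^T }.

Definition pseudo_metric (g : gram_field) : Prop := pseudo_metric_on setT g.

(* Components, in the chart i, of the vectors of square norm e at p.          *)
Definition pseudosphere (g : gram_field) (e : R) (i : chart M) (p : M) :
  set 'rV[R]_n := [set v | inner (g i p) v v = e].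

Definition conformal_jacobi (g : gram_field) (i : chart M) (p : M) :
  'rV[R]_n -> 'M[R]_n := jacobi_weyl (local_metric g i) (chart_map i p).

(* A change of chart around p maps pseudospheres to pseudospheres and          *)
(* conjugates the conformal Jacobi operators.                                 *)
Definition conformally_osserman (g : gram_field) : Prop :=
  forall (i : chart M) (p : M), chart_dom i p ->
  forall e : R, e = 1 \/ e = -1 ->
  forall v w, pseudosphere g e i p v -> pseudosphere g e i p w ->
  forall l : R[i], eigen_mult (conformal_jacobi g i p v) l =
                   eigen_mult (conformal_jacobi g i p w) l.

Definition flat_on (U : set M) (g : gram_field) : Prop :=
  forall i p, U p -> chart_dom i p ->
  forall v w z u, riem (local_metric g i) (chart_map i p) v w z u = 0.

Definition conformal_on (U : set M) (g h : gram_field) : Prop :=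
  exists phi : M -> R,
    [/\ smooth_on U phi, forall p, U p -> 0 < phi p &
        forall i p, U p -> chart_dom i p -> h i p = phi p *: g i p].

Definition locally_conformally_flat (g : gram_field) : Prop :=
  forall p : M, exists U : set M, [/\ open U, U p &
    exists h, [/\ pseudo_metric_on U h, flat_on U h & conformal_on U g h]].

End Manifold.

Section WarpedProduct.
Variables (R : realType) (m n : nat).
Variables (B : charted_space R m) (F : charted_space R n).

Definition prod_space : charted_space R (m + n) :=
  @ChartedSpace R (m + n) (B * F)%type (chart B * chart F)%type
    (fun i => chart_dom i.1 `*` chart_dom i.2)
    (fun i p => row_mx (chart_map i.1 p.1) (chart_map i.2 p.2))
    (fun i x => (chart_inv i.1 (lsubmx x), chart_inv i.2 (rsubmx x))).

Definition warped_product (gB : gram_field B) (gF : gram_field F)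
    (f : B -> R) : gram_field prod_space :=
  fun i p => block_mx (gB i.1 p.1) 0 0 (f p.1 ^+ 2 *: gF i.2 p.2).

End WarpedProduct.

Section SmoothTheory.
Variable R : realType.

Lemma near_eq_differentiable (V W : normedModType R) (f g : V -> W) (x : V) :
  (\near x, f x = g x) -> differentiable f x -> differentiable g x.
Proof.
move=> fg df; have fgx : f x = g x := nbhs_singleton fg.
have e : g \o shift x = cst (g x) + 'd f x +o_ 0 id.
  apply/eqaddoP => _/posnumP[eps].
  have /eqaddoP/(_ _ (gt0 eps)) := diff_locally df.
  have : \forall y \near (0 : V), f (y + x) = g (y + x).
    by have := fg; rewrite (near_shift 0) subr0.
  apply: filterS2 => y fgy; rewrite -fgx.
  by rewrite !fctE /= fgy.
have h : 'd g x = 'd f x :> (V -> W) 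
  by exact: (diff_unique (diff_continuous df) e).
apply/diff_locallyP; rewrite h; split; last exact: e.
exact: (diff_continuous df).
Qed.

Lemma open_near (T : topologicalType) (U : set T) (P : T -> Prop) x :
  open U -> U x -> (forall y, U y -> P y) -> \near x, P x.
Proof.
by move=> oU Ux UP; apply: filterS UP _; apply: open_nbhs_nbhs.
Qed.

Lemma Ck_ext n (V : normedModType R) k (U : set 'rV[R]_n) (h h' : _ -> V) :
  open U -> (forall x, U x -> h x = h' x) -> Ck k U h -> Ck k U h'.
Proof.
move=> oU; elim: k h h' => [|k IH] h h' hh' /=.
  move=> ch x Ux; have e := open_near oU Ux hh'.
  rewrite /prop_for /continuous_at -(hh' _ Ux); apply: cvg_trans (ch _ Ux).
  exact: (@near_eq_cvg _ _ (nbhs x) _ h h' e).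
move=> [dh Dh]; split=> [x Ux|v].
  exact: near_eq_differentiable (open_near oU Ux hh') (dh _ Ux).
apply: IH (Dh v) => x Ux; apply: near_eq_derive; exact: open_near oU Ux hh'.
Qed.

Lemma Ck_sub n (V : normedModType R) k (U U' : set 'rV[R]_n) (h : _ -> V) :
  U' `<=` U -> Ck k U h -> Ck k U' h.
Proof.
move=> UU'; elim: k h => [|k IH] h /=; first by move=> ch x /UU'/ch.
by move=> [dh Dh]; split=> [x /UU'/dh //|v]; apply: IH.
Qed.

Lemma CkS n (V : normedModType R) k (U : set 'rV[R]_n) (h : _ -> V) :
  Ck k.+1 U h -> Ck k U h.
Proof.
elim: k h => [|k IH] h [dh Dh].
  by move=> x Ux; exact/differentiable_continuous/dh.
by split=> // v; apply: IH.
Qed.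

Lemma CkD n (V : normedModType R) k (U : set 'rV[R]_n) (h h' : _ -> V) :
  open U -> Ck k U h -> Ck k U h' -> Ck k U (h + h').
Proof.
move=> oU; elim: k h h' => [|k IH] h h' /=.
  by move=> ch ch' x Ux; apply: continuousD; [exact: ch|exact: ch'].
move=> [dh Dh] [dh' Dh']; split=> [x Ux|v].
  by apply: differentiableD; [exact: dh|exact: dh'].
apply: Ck_ext (IH _ _ (Dh v) (Dh' v)) => // x Ux; rewrite deriveD //.
  by apply: diff_derivable; exact: dh.
by apply: diff_derivable; exact: dh'.
Qed.

Lemma linear_mx_continuous m n (V : normedModType R)
  (L : {linear 'M[R]_(m, n) -> V}) : continuous L.
Proof.
move=> A; apply: differentiable_continuous.
suff -> : (L : _ -> V) = \sum_i \sum_j 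
    (fun B : 'M[R]_(m, n) => B i j *: L (delta_mx i j)).
  apply: differentiable_sum => i; apply: differentiable_sum => j.
  exact/differentiableZl/differentiable_coord.
apply/funext => B; rewrite {1}(matrix_sum_delta B) linear_sum fct_sumE.
apply: eq_bigr => i _; rewrite linear_sum fct_sumE.
by apply: eq_bigr => j _; rewrite linearZ.
Qed.

Lemma derive_lin (d : nat) (V W : normedModType R) (L : {linear V -> W})
    (h : 'rV[R]_d -> V) x v :
  continuous L -> differentiable h x -> 'D_v (L \o h) x = L ('D_v h x).
Proof.
move=> cL d1; have d2 := linear_differentiable (h x) cL.
rewrite (deriveE _ (differentiable_comp d1 d2)) /= (deriveE _ d1).
rewrite (diff_comp d1 d2).
exact: (congr1 (@^~ ('d h x v)) (diff_lin (h x) cL)).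
Qed.

Lemma derive_comp_lin (d e : nat) (V : normedModType R)
    (P : {linear 'rV[R]_d -> 'rV[R]_e}) (h : 'rV[R]_e -> V) x v :
  differentiable h (P x) -> 'D_v (h \o P) x = 'D_(P v) h (P x).
Proof.
have cP := @linear_mx_continuous _ _ _ P.
move=> d2; have d1 := linear_differentiable x cP.
rewrite (deriveE _ (differentiable_comp d1 d2)) /= (deriveE _ d2).
rewrite (diff_comp d1 d2).
exact: (congr1 ('d h (P x)) (congr1 (@^~ v) (diff_lin x cP))).
Qed.

Lemma Ck_lin n (W V : normedModType R) k (U : set 'rV[R]_n)
    (L : {linear W -> V}) (h : _ -> W) :
  continuous L -> open U -> Ck k U h -> Ck k U (L \o h).
Proof.
move=> cL oU; elim: k h => [|k IH] h /=.
  by move=> ch x Ux; apply: continuous_comp; [exact: ch|exact: cL].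
move=> [dh Dh]; split=> [x Ux|v].
  by apply: differentiable_comp; [exact: dh|exact: linear_differentiable].
apply: Ck_ext (IH _ (Dh v)) => // x Ux.
by rewrite (derive_lin _ cL (dh _ Ux)).
Qed.

Lemma Ck_comp_lin n q (V : normedModType R) k (U : set 'rV[R]_q)
    (P : {linear 'rV[R]_n -> 'rV[R]_q}) (h : _ -> V) :
  open U -> Ck k U h -> Ck k (P @^-1` U) (h \o P).
Proof.
have cP := @linear_mx_continuous _ _ _ P.
move=> oU; elim: k h => [|k IH] h /=.
  by move=> ch x Ux; apply: continuous_comp; [exact: cP|exact: ch].
have oPU : open (P @^-1` U) by apply: open_comp => // x _; exact: cP.
move=> [dh Dh]; split=> [x Ux|v].
  by apply: differentiable_comp; [exact: linear_differentiable|exact: dh].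
apply: Ck_ext (IH _ (Dh (P v))) => // x Ux.
by rewrite (derive_comp_lin _ (dh _ Ux)).
Qed.

Lemma CkM n k (U : set 'rV[R]_n) (f h : _ -> R) :
  open U -> Ck k U f -> Ck k U h -> Ck k U (f * h).
Proof.
move=> oU; elim: k f h => [|k IH] f h.
  by move=> cf ch x Ux; apply: continuousM; [exact: cf|exact: ch].
move=> cf ch; have [df Df] := cf; have [dh Dh] := ch.
split=> [x Ux|v]; first by apply: differentiableM; [exact: df|exact: dh].
apply: Ck_ext (CkD oU (IH _ _ (CkS cf) (Dh v)) (IH _ _ (CkS ch) (Df v))) => //.
by move=> x Ux; rewrite deriveM //; apply: diff_derivable; auto.
Qed.

Lemma Ck_cst n (V : normedModType R) k (U : set 'rV[R]_n) (a : V) :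
  Ck k U (cst a).
Proof.
elim: k a => [|k IH] a /=; first by move=> x _; exact: cst_continuous.
split=> // v; rewrite (_ : (fun _ => _) = cst 0) //.
by apply/funext => x; rewrite derive_cst.
Qed.

Lemma Ck_sum n (V : normedModType R) k (U : set 'rV[R]_n) I (r : seq I)
    (f : I -> _ -> V) :
  open U -> (forall i, Ck k U (f i)) -> Ck k U (\sum_(i <- r) f i).
Proof.
move=> oU Cf; elim: r => [|i r IH]; first by rewrite big_nil; exact: Ck_cst.
by rewrite big_cons; exact: CkD.
Qed.

Lemma Ck_coord n p q k (U : set 'rV[R]_n) (h : _ -> 'M[R]_(p, q)) i j :
  open U -> Ck k U h -> Ck k U (fun x => h x i j).
Proof.
move=> oU; have lin : linear (fun A : 'M[R]_(p, q) => A i j : R).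
  by move=> a A A'; rewrite !mxE.
pose L : {linear _ -> _} :=
  HB.pack (fun A : 'M[R]_(p, q) => A i j) (GRing.isLinear.Build _ _ _ _ _ lin).
by apply: (@Ck_lin _ _ _ _ _ L) => //; exact: coord_continuous.
Qed.

Lemma Ck_scalel n (V : normedModType R) k (U : set 'rV[R]_n) (f : _ -> R)
    (w : V) : open U -> Ck k U f -> Ck k U (fun x => f x *: w).
Proof.
move=> oU; have lin : linear ( *:%R^~ w : R -> V).
  by move=> a b c; rewrite scalerDl -scalerA.
pose L : {linear _ -> _} :=
  HB.pack ( *:%R^~ w : R -> V) (GRing.isLinear.Build _ _ _ _ _ lin).
by apply: (@Ck_lin _ _ _ _ _ L) => //; exact: scalel_continuous.
Qed.

Lemma Ck_mx n p q k (U : set 'rV[R]_n) (h : _ -> 'M[R]_(p, q)) :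
  open U -> (forall i j, Ck k U (fun x => h x i j)) -> Ck k U h.
Proof.
move=> oU Ch.
suff -> : h = \sum_i \sum_j (fun x : 'rV[R]_n => h x i j *: delta_mx i j).
  by do 2!(apply: Ck_sum => // ?); exact: Ck_scalel.
apply/funext => x; rewrite fct_sumE [LHS]matrix_sum_delta.
by apply: eq_bigr => i _; rewrite fct_sumE.
Qed.

End SmoothTheory.

Section LeviCivita.
Variables (R : realType) (n : nat) (g : 'rV[R]_n -> 'M[R]_n) (x : 'rV[R]_n).
Hypothesis g_diff : differentiable g x.
Hypothesis g_sym : \near x, (g x)^T = g x.
Hypothesis g_unit : g x \in unitmx.

Lemma inner_linear G v : linear (inner G v : 'rV[R]_n -> R).
Proof.
by move=> a w z; rewrite /inner linearD linearZ /= mulmxDr -scalemxAr !mxE.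
Qed.

Lemma inner_differentiable v w : differentiable (fun y => inner (g y) v w) x.
Proof.
have lin : linear (fun A : 'M[R]_n => inner A v w : R).
  move=> a A A'; rewrite /inner mulmxDr mulmxDl -scalemxAr -scalemxAl.
  by rewrite !mxE.
pose L : {linear _ -> _} := HB.pack (fun A : 'M[R]_n => inner A v w : R)
  (GRing.isLinear.Build _ _ _ _ _ lin).
apply: (@differentiable_comp _ _ _ _ g L) => //.
apply: linear_differentiable; exact: linear_mx_continuous.
Qed.

Lemma koszul_linear v w : linear (koszul g x v w).
Proof.
have D u u' : linear (fun z => 'D_u (fun y => inner (g y) u' z) x : R).
  move=> a z z'; rewrite (_ : (fun _ => _) =
      a *: (fun y => inner (g y) u' z) + (fun y => inner (g y) u' z'));
    last first.
    by apply/funext => y; rewrite (inner_linear (g y) u').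
  have dz : derivable _ _ u := diff_derivable (inner_differentiable u' z).
  have dz' : derivable _ _ u := diff_derivable (inner_differentiable u' z').
  by rewrite deriveD ?deriveZ //; exact: derivableZ.
move=> a z z'; rewrite /koszul (D v w) (D w v).
have dvw := inner_differentiable v w; rewrite !(deriveE _ dvw) linearP.
by rewrite /= scalerBr scalerDr; ring.
Qed.

Lemma christoffel_metric v w z :
  inner (g x) (christoffel g x v w) z + inner (g x) w (christoffel g x v z) =
  'D_v (fun y => inner (g y) w z) x.
Proof.
have hl u u' : linear (fun z => 2^-1 * koszul g x u u' z).
  by move=> a t t'; rewrite koszul_linear; rewrite /= mulrDr mulrCA.
rewrite [inner _ w _]inner_sym; last exact: nbhs_singleton g_sym.
rewrite !(sharpP _ g_unit (hl _ _)) /koszul.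
have S u t t' : 'D_u (fun y => inner (g y) t t') x =
                'D_u (fun y => inner (g y) t' t) x.
  by apply: near_eq_derive; apply: filterS g_sym => y; exact: inner_sym.
rewrite (S v z w).
lra.
Qed.

Lemma nabla_torsion_free X Y :
  nabla g X Y x - nabla g Y X x = lie_bracket X Y x.
Proof.
rewrite /nabla /lie_bracket.
suff -> : christoffel g x (X x) (Y x) = christoffel g x (Y x) (X x).
  by rewrite opprD addrACA subrr addr0.
rewrite /christoffel; congr (sharp _ _); apply/funext => z; congr (_ * _).
rewrite /koszul [X in X - _]addrC; congr (_ - _).
by apply: near_eq_derive; apply: filterS g_sym => y; exact: inner_sym.
Qed.

End LeviCivita.

Lemma openX (S T : topologicalType) (U : set S) (V : set T) :
  open U -> open V -> open (U `*` V).
Proof.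
rewrite !openE => oU oV [x y] [/= Ux Vy].
by exists (U, V) => //; split; [exact: oU|exact: oV].
Qed.

Section Product.
Variables (R : realType) (m n : nat).

Lemma lsubmx_continuous : continuous (lsubmx : 'rV[R]_(m + n) -> 'rV[R]_m).
Proof. exact: linear_mx_continuous. Qed.

Lemma rsubmx_continuous : continuous (rsubmx : 'rV[R]_(m + n) -> 'rV[R]_n).
Proof. exact: linear_mx_continuous. Qed.

Definition rV_setX (U : set 'rV[R]_m) (V : set 'rV[R]_n) :
  set 'rV[R]_(m + n) := lsubmx @^-1` U `&` rsubmx @^-1` V.

Lemma rV_setX_open U V : open U -> open V -> open (rV_setX U V).
Proof.
move=> oU oV; apply: openI; apply: open_comp => // x _.
  exact: lsubmx_continuous.
exact: rsubmx_continuous.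
Qed.

Lemma Ck_prodl (W : normedModType R) k U V (h : 'rV[R]_m -> W) :
  open U -> Ck k U h -> Ck k (rV_setX U V) (h \o lsubmx).
Proof.
move=> oU /(Ck_comp_lin (lsubmx : {linear 'rV[R]_(m + n) -> _}) oU).
by apply: Ck_sub => x [].
Qed.

Lemma Ck_prodr (W : normedModType R) k U V (h : 'rV[R]_n -> W) :
  open V -> Ck k V h -> Ck k (rV_setX U V) (h \o rsubmx).
Proof.
move=> oV /(Ck_comp_lin (rsubmx : {linear 'rV[R]_(m + n) -> _}) oV).
by apply: Ck_sub => x [].
Qed.

Lemma Ck_row_mx k U V p q
    (h : 'rV[R]_m -> 'rV[R]_p) (h' : 'rV[R]_n -> 'rV[R]_q) :
  open U -> open V -> Ck k U h -> Ck k V h' ->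
  Ck k (rV_setX U V) (fun x => row_mx (h (lsubmx x)) (h' (rsubmx x))).
Proof.
move=> oU oV Ch Ch'; apply: Ck_mx => [|i j]; first exact: rV_setX_open.
rewrite (ord1 i); case: (split_ordP j) => l ->.
  under eq_fun do rewrite row_mxEl.
  exact: Ck_prodl (Ck_coord _ _ oU Ch).
under eq_fun do rewrite row_mxEr.
exact: Ck_prodr (Ck_coord _ _ oV Ch').
Qed.

Variables (B : charted_space R m) (F : charted_space R n).

Lemma prod_coord_image (i : chart (prod_space B F)) (U : set B) (V : set F) :
  chart_map i @` (U `*` V) = rV_setX (chart_map i.1 @` U) (chart_map i.2 @` V).
Proof.
apply/seteqP; split=> [_ [p [Up Vp] <-]|x [[p Up px] [q Vq qx]]] /=.
  by split; rewrite /= ?row_mxKl ?row_mxKr; [exists p.1|exists p.2].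
by exists (p, q) => //=; rewrite px qx hsubmxK.
Qed.

Lemma image_dom_open (d : nat) (M : charted_space R d) (i : chart M)
    (U : set M) :
  is_manifold M -> open U -> open (chart_map i @` (U `&` chart_dom i)).
Proof.
move=> HM oU.
suff -> : chart_map i @` (U `&` chart_dom i) =
    chart_map i @` chart_dom i `&` chart_inv i @^-1` U.
  rewrite openE => x [Ix Ux]; apply: filterI.
    by apply: open_nbhs_nbhs; split=> //; exact: chart_open.
  by apply: (chart_inv_continuous HM Ix); exact: open_nbhs_nbhs.
apply/seteqP; split=> [_ [p [Up dp] <-]|_ [[p dp <-] /=]].
  by split; [exists p|rewrite /= (chart_mapK HM)].
by rewrite (chart_mapK HM) // => Up; exists p.
Qed.

Lemma is_manifold_prod :
  is_manifold B -> is_manifold F -> is_manifold (prod_space B F).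
Proof.
move=> HB HF; split.
- move=> p q clpq; have h1 : p.1 = q.1.
    apply: (manifold_hausdorff HB) => U V nU nV.
    have nU' : nbhs p (U `*` setT).
      by exists (U, setT) => //; split=> //=; exact: filterT.
    have nV' : nbhs q (V `*` setT).
      by exists (V, setT) => //; split=> //=; exact: filterT.
    by have [r [[Ur _] [Vr _]]] := clpq _ _ nU' nV'; exists r.1.
  have h2 : p.2 = q.2.
    apply: (manifold_hausdorff HF) => U V nU nV.
    have nU' : nbhs p (setT `*` U).
      by exists (setT, U) => //; split=> //=; exact: filterT.
    have nV' : nbhs q (setT `*` V).
      by exists (setT, V) => //; split=> //=; exact: filterT.
    by have [r [[_ Ur] [_ Vr]]] := clpq _ _ nU' nV'; exists r.2.
  by case: p q h1 h2 {clpq} => [? ?] [? ?] /= -> ->.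
- have [S cS [Sop Sb]] := manifold_second_countable HB.
  have [T cT [Top Tb]] := manifold_second_countable HF.
  exists ((fun UV => UV.1 `*` UV.2) @` (S `*` T)).
    apply: sub_countable (countableX cS cT); exact: card_image_le.
  split=> [_ [[U V] [/Sop oU /Top oV] <-]|[p q] A [[P Q] /= [nP nQ] PQA]].
    exact: openX.
  have [U [SU Up] UP] := Sb _ _ nP; have [V [TV Vq] VQ] := Tb _ _ nQ.
  exists (U `*` V); first by split=> //; exists (U, V).
  by move=> [x y] [/UP Px /VQ Qy]; apply: PQA.
- by move=> i; apply: openX; exact: chart_dom_open.
- move=> [p q]; have [i di] := chart_dom_cover HB p.
  by have [j dj] := chart_dom_cover HF q; exists (i, j).
- move=> i [p q] [/= dp dq].
  by rewrite row_mxKl row_mxKr (chart_mapK HB) // (chart_mapK HF).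
- move=> i; rewrite prod_coord_image; apply: rV_setX_open; exact: chart_open.
- move=> i p [dp dq].
  have E (a : 'rV[R]_m) (b : 'rV[R]_n) :
      row_mx a b = a *m row_mx 1%:M 0 + b *m row_mx 0 1%:M.
    by rewrite !mul_mx_row !mulmx1 !mulmx0 add_row_mx addr0 add0r.
  have -> : chart_map i = (fun p => chart_map i.1 p.1 *m row_mx 1%:M 0) \+
                          (fun p => chart_map i.2 p.2 *m row_mx 0 1%:M).
    by apply/funext => x; exact: E.
  apply: cvgD.
    apply: (@continuous_comp _ _ _ (chart_map i.1 \o fst) (mulmxr _) p).
      by apply: continuous_comp; [exact: cvg_fst|exact: chart_continuous].
    exact: linear_mx_continuous.
  apply: (@continuous_comp _ _ _ (chart_map i.2 \o snd) (mulmxr _) p).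
    by apply: continuous_comp; [exact: cvg_snd|exact: chart_continuous].
  exact: linear_mx_continuous.
- move=> i x; rewrite prod_coord_image => -[Ix Jx].
  have c1 : {for x, continuous (chart_inv i.1 \o lsubmx)}.
    apply: continuous_comp; first exact: lsubmx_continuous.
    exact: chart_inv_continuous.
  have c2 : {for x, continuous (chart_inv i.2 \o rsubmx)}.
    apply: continuous_comp; first exact: rsubmx_continuous.
    exact: chart_inv_continuous.
  exact: (cvg_pair c1 c2).
- move=> i j k.
  have -> : chart_dom i `&` chart_dom j =
      (chart_dom i.1 `&` chart_dom j.1) `*` (chart_dom i.2 `&` chart_dom j.2).
    by apply/seteqP; split=> x [] [] ? ? [] ? ?.
  rewrite prod_coord_image.
  have oB : open (chart_map i.1 @` (chart_dom i.1 `&` chart_dom j.1)).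
    by rewrite setIC; apply: image_dom_open => //; exact: chart_dom_open.
  have oF : open (chart_map i.2 @` (chart_dom i.2 `&` chart_dom j.2)).
    by rewrite setIC; apply: image_dom_open => //; exact: chart_dom_open.
  apply: (Ck_row_mx (h := transition i.1 j.1) (h' := transition i.2 j.2)) => //.
    exact: transition_smooth.
  exact: transition_smooth.
Qed.

Lemma jacobian_row_mx (h : 'rV[R]_m -> 'rV[R]_m) (h' : 'rV[R]_n -> 'rV[R]_n)
    (x : 'rV[R]_(m + n)) :
  differentiable h (lsubmx x) -> differentiable h' (rsubmx x) ->
  'J (fun x => row_mx (h (lsubmx x)) (h' (rsubmx x))) x =
  block_mx ('J h (lsubmx x)) 0 0 ('J h' (rsubmx x)).
Proof.
move=> dh dh'; set T := (fun x => _).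
pose L1 : {linear 'rV[R]_m -> 'rV[R]_(m + n)} :=
  mulmxr (row_mx 1%:M 0 : 'M[R]_(m, m + n)).
pose L2 : {linear 'rV[R]_n -> 'rV[R]_(m + n)} :=
  mulmxr (row_mx 0 1%:M : 'M[R]_(n, m + n)).
pose P1 : {linear _ -> _} := (lsubmx : 'rV[R]_(m + n) -> _).
pose P2 : {linear _ -> _} := (rsubmx : 'rV[R]_(m + n) -> _).
have E : T = (L1 \o (h \o P1)) + (L2 \o (h' \o P2)).
  apply/funext => y; rewrite fctE /= !mul_mx_row !mulmx1 !mulmx0.
  by rewrite add_row_mx addr0 add0r.
have cL1 : continuous L1 by exact: linear_mx_continuous.
have cL2 : continuous L2 by exact: linear_mx_continuous.
have cP1 : continuous P1 by exact: linear_mx_continuous.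
have cP2 : continuous P2 by exact: linear_mx_continuous.
have d1 : differentiable (h \o P1) x.
  by apply: differentiable_comp; [exact: linear_differentiable|].
have d2 : differentiable (h' \o P2) x.
  by apply: differentiable_comp; [exact: linear_differentiable|].
have d3 : differentiable (L1 \o (h \o P1)) x.
  by apply: differentiable_comp => //; exact: linear_differentiable.
have d4 : differentiable (L2 \o (h' \o P2)) x.
  by apply: differentiable_comp => //; exact: linear_differentiable.
have dT : differentiable T x by rewrite E; exact: differentiableD.
apply/row_matrixP => i; rewrite !rowE -(deriveEjacobian _ dT) E.
rewrite deriveD; [|exact: diff_derivable|exact: diff_derivable].
rewrite (derive_lin _ cL1 d1) (derive_lin _ cL2 d2).
rewrite (derive_comp_lin _ dh) (derive_comp_lin _ dh').
rewrite (deriveEjacobian _ dh) (deriveEjacobian _ dh') /=.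
set v := delta_mx 0 i.
rewrite -[v in RHS]hsubmxK mul_row_block !mulmx0 addr0 add0r.
by rewrite !mul_mx_row !mulmx1 !mulmx0 add_row_mx addr0 add0r.
Qed.

Lemma pseudo_metric_warped (gB : gram_field B) (gF : gram_field F)
    (f : B -> R) :
  is_manifold B -> is_manifold F -> pseudo_metric gB -> pseudo_metric gF ->
  smooth_on setT f -> (forall p, 0 < f p) ->
  pseudo_metric (warped_product gB gF f).
Proof.
move=> HB HF HgB HgF sf fp; split.
- move=> i p _ [dp dq]; rewrite tr_block_mx !trmx0 linearZ /=.
  by rewrite (gram_sym HgB) // (gram_sym HgF).
- move=> i p _ [dp dq]; rewrite unitmxE det_ublock unitrM -!unitmxE.
  rewrite (gram_nondegenerate HgB) //= unitmxZ ?(gram_nondegenerate HgF) //.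
  by rewrite unitfE expf_neq0 // gt_eqF.
- move=> i k; rewrite setTI prod_coord_image.
  have oB := @chart_open _ _ _ HB i.1; have oF := @chart_open _ _ _ HF i.2.
  apply: Ck_mx => [|a b]; first exact: rV_setX_open.
  have CB := @gram_smooth _ _ _ _ _ HgB i.1 k; rewrite setTI in CB.
  have CF := @gram_smooth _ _ _ _ _ HgF i.2 k; rewrite setTI in CF.
  have Cf := sf i.1 k; rewrite setTI in Cf.
  have oP := rV_setX_open oB oF.
  rewrite /local_metric /warped_product /=.
  case: (split_ordP a) => a' ->; case: (split_ordP b) => b' ->.
  + under eq_fun do rewrite block_mxEul.
    exact: Ck_prodl (Ck_coord _ _ oB CB).
  + under eq_fun do rewrite block_mxEur mxE.
    exact: Ck_cst.
  + under eq_fun do rewrite block_mxEdl mxE.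
    exact: Ck_cst.
  + under eq_fun do rewrite block_mxEdr mxE expr2.
    have C1 := Ck_prodl (chart_map i.2 @` chart_dom i.2) oB (CkM oB Cf Cf).
    have C2 := Ck_prodr (chart_map i.1 @` chart_dom i.1) oF
      (Ck_coord a' b' oF CF).
    exact: CkM oP C1 C2.
- move=> i j p _ [dp dq] [dp' dq'] /=.
  have d1 : differentiable (transition i.1 j.1) (chart_map i.1 p.1).
    by have [+ _] := @transition_smooth _ _ _ HB i.1 j.1 1%N; apply; exists p.1.
  have d2 : differentiable (transition i.2 j.2) (chart_map i.2 p.2).
    by have [+ _] := @transition_smooth _ _ _ HF i.2 j.2 1%N; apply; exists p.2.
  have -> : 'J (transition i j) (row_mx (chart_map i.1 p.1) (chart_map i.2 p.2))
    = block_mx ('J (transition i.1 j.1) (chart_map i.1 p.1)) 0 0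
               ('J (transition i.2 j.2) (chart_map i.2 p.2)).
    rewrite (@jacobian_row_mx (transition i.1 j.1) (transition i.2 j.2))
      ?row_mxKl ?row_mxKr //.
  rewrite tr_block_mx !trmx0 !mulmx_block !mulmx0 !mul0mx !addr0 !add0r.
  rewrite mul0mx -scalemxAr -scalemxAl /warped_product.
  have e1 := gram_transition HgB I dp dp'.
  have e2 := gram_transition HgF I dq dq'.
  rewrite [LHS](congr2 (fun a b => block_mx a 0 0 (f p.1 ^+ 2 *: b)) e1 e2).
  by rewrite mul0mx.
Qed.

End Product.

(* Main.v *)
(** If the warped product is locally conformally flat, its Weyl tensor vanishes,
hence so do all conformal Jacobi operators.

Conversely, B x_f F is conformal to the direct product of (B, f^-2 g_B) and
(F, g_F).  One factor has dimension at most 2; if e_k is an orthonormal basis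
vector tangent to it, the curvature of the product satisfies
R(e_k, e_i, e_j, e_l) = 0 whenever i, j, l <> k, and then so does the Weyl
tensor W.  The Osserman condition makes tr J_W(v)^2 constant on each
pseudosphere; evaluated at e_k and at combinations c e_k + d e_i, this forces
first the electric part W(e_k, ., e_k, .) and then all of W to vanish, because
among the three remaining signs two agree.

It remains to prove the Weyl-Schouten theorem in dimension n >= 4.  If W = 0,
the second Bianchi identity and n > 3 make the covariant derivative of the
Schouten tensor C totally symmetric, which is the flatness of the tractor
connection D w = om, D om = - w C + mu g, D mu = - C(om, .) on triples
(w, om, mu).  A parallel triple starting at (1, 0, 0) satisfies
2 w mu = |om|^2, and w^-2 g is flat.  Parallel sections of a flat connection
are obtained by integrating along rays; the solutions of the linear equations
are compared by a Gronwall estimate to see that they are differentiable in all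
directions. *)

(* Vectors are rows, so endomorphisms compose from left to right. Analysis is kept apart from
   algebra: derivatives are computed and named once, and what remains is an identity between words
   in noncommuting matrices. Connections are identified by uniqueness: a candidate that is metric
   and torsion-free is the Levi-Civita connection, which settles conformal changes, changes of chart
   and products alike.

   The eigenvalues enter only through [\tr (J *m J)]: equal complex multiplicities give equal
   characteristic polynomials, hence equal traces of squares. Along c e_k + d e_i with d nonzero,
   the resulting condition reads u + c^2 w = 0, where u and w are quadratic in the electric part.
   Two values of c^2 therefore suffice, and Pythagorean triples supply them for either sign of the
   plane.

   The relation 2 w mu = |om|^2 matters because it makes the conformal Hessian of - log w equal to
   the Schouten tensor, so that the change of metric cancels the curvature exactly. It holds at the
   base point by the choice of initial value and propagates because 2 w mu - |om|^2 has zero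
   derivative. *)
Require Import Defs.
From HB Require Import structures.
From mathcomp Require Import all_boot all_order all_algebra.
From mathcomp Require Import all_classical all_reals all_analysis.
From mathcomp Require Import perm complex ring lra zify.

Set Implicit Arguments.
Unset Strict Implicit.
Unset Printing Implicit Defensive.

Import Order.TTheory GRing.Theory Num.Theory.
Import numFieldNormedType.Exports.

Local Open Scope classical_set_scope.
Local Open Scope ring_scope.

(** * Derivatives and smoothness of matrix-valued maps *)
Section MatrixCalculus.
Variables (R : realType) (V : normedModType R).

Lemma differentiable_entry p q (M : V -> 'M[R]_(p, q)) x i j :
  differentiable M x -> differentiable (fun y => M y i j) x.
Proof.
move=> dM; apply: (@differentiable_comp _ _ _ _ M (fun A => A i j)) => //.
exact: differentiable_coord.
Qed.

Lemma derive_entry p q (M : V -> 'M[R]_(p, q)) x v i j :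
  derivable M x v -> 'D_v (fun y => M y i j) x = ('D_v M x) i j.
Proof. by move=> dM; rewrite derive_mx // mxE. Qed.

Lemma is_derive_mx p q (F : V -> 'M[R]_(p, q)) x v (dF : 'M[R]_(p, q)) :
  (forall i j, is_derive x v (fun y => F y i j) (dF i j)) <->
  is_derive x v F dF.
Proof.
split=> [dFij|[dF1 <-] i j].
  have dFt : derivable F x v.
    by apply/derivable_mxP => i j; have [] := dFij i j.
  split=> //; rewrite derive_mx //; apply/matrixP => i j; rewrite mxE.
  by have [_ ->] := dFij i j.
split; last exact: derive_entry.
by move/derivable_mxP : dF1.
Qed.

Lemma is_derive_mulmx p q r (A : V -> 'M[R]_(p, q))
    (B : V -> 'M[R]_(q, r)) x v dA dB :
  is_derive x v A dA -> is_derive x v B dB ->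
  is_derive x v (fun y => A y *m B y) (dA *m B x + A x *m dB).
Proof.
move=> /is_derive_mx hA /is_derive_mx hB; apply/is_derive_mx => i j.
rewrite (_ : (fun _ => _) =
  \sum_k ((fun y => A y i k) * (fun y => B y k j))); last first.
  by apply/funext => y; rewrite mxE fct_sumE.
apply: is_derive_eq (is_derive_sum (fun k => is_deriveM (hA i k) (hB k j))) _.
rewrite !mxE -big_split /=; apply: eq_bigr => k _.
by rewrite addrC; congr (_ + _); exact: mulrC.
Qed.

Lemma is_derive_trmx p q (A : V -> 'M[R]_(p, q)) x v dA :
  is_derive x v A dA -> is_derive x v (fun y => (A y)^T) dA^T.
Proof.
move=> /is_derive_mx hA; apply/is_derive_mx => i j.
by rewrite mxE; under eq_fun do rewrite mxE; exact: hA.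
Qed.

Lemma is_derive_scalemx p q (c : V -> R) (F : V -> 'M[R]_(p, q)) x v dc dF :
  is_derive x v c dc -> is_derive x v F dF ->
  is_derive x v (fun y => c y *: F y) (dc *: F x + c x *: dF).
Proof.
move=> hc /is_derive_mx hF; apply/is_derive_mx => i j.
rewrite (_ : (fun _ => _) = c * (fun y => F y i j)); last first.
  by apply/funext => y; rewrite mxE.
apply: is_derive_eq (is_deriveM hc (hF i j)) _.
by rewrite !mxE addrC; congr (_ + _); exact: mulrC.
Qed.

End MatrixCalculus.

Section SmoothCalculus.
Variables (R : realType) (n : nat).
Implicit Types U : set 'rV[R]_n.

Lemma CkN (V : normedModType R) k U (h : _ -> V) :
  open U -> Ck k U h -> Ck k U (fun x => - h x).
Proof.
move=> oU; elim: k h => [|k IH] h /=.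
  by move=> ch x Ux; apply: continuousN; exact: ch.
move=> [dh Dh]; split=> [x Ux|v]; first by apply: differentiableN; exact: dh.
apply: Ck_ext (IH _ (Dh v)) => // x Ux; rewrite deriveN //.
by apply: diff_derivable; exact: dh.
Qed.

Lemma CkB (V : normedModType R) k U (h h' : _ -> V) :
  open U -> Ck k U h -> Ck k U h' -> Ck k U (fun x => h x - h' x).
Proof. by move=> oU Ch Ch'; apply: CkD => //; exact: CkN. Qed.

Lemma CkZ (V : normedModType R) k U (a : R) (h : _ -> V) :
  open U -> Ck k U h -> Ck k U (fun x => a *: h x).
Proof.
move=> oU Ch; apply: (Ck_lin (L := *:%R a)) => //; exact: scaler_continuous.
Qed.

Lemma Ck_mulmx p q r k U (A : _ -> 'M[R]_(p, q)) (B : _ -> 'M[R]_(q, r)) :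
  open U -> Ck k U A -> Ck k U B -> Ck k U (fun x => A x *m B x).
Proof.
move=> oU cA cB; apply: Ck_mx => // i j.
rewrite (_ : (fun _ => _) =
  \sum_k ((fun y => A y i k) * (fun y => B y k j))); last first.
  by apply/funext => y; rewrite mxE fct_sumE.
by apply: Ck_sum => // l; apply: CkM => //; exact: Ck_coord.
Qed.

Lemma Ck_trmx p q k U (A : _ -> 'M[R]_(p, q)) :
  open U -> Ck k U A -> Ck k U (fun x => (A x)^T).
Proof.
move=> oU cA; apply: Ck_mx => // i j.
by under eq_fun do rewrite mxE; exact: Ck_coord.
Qed.

Lemma Ck_scalemx p q k U (f : _ -> R) (h : _ -> 'M[R]_(p, q)) :
  open U -> Ck k U f -> Ck k U h -> Ck k U (fun x => f x *: h x).
Proof.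
move=> oU cf ch; apply: Ck_mx => // i j.
by under eq_fun do rewrite mxE; apply: CkM => //; exact: Ck_coord.
Qed.

(** The derivative - f^-2 D f contains f^-1 only at the order already treated, so the induction
    closes. *)
Lemma Ck_inv k U (f : _ -> R) :
  open U -> (forall x, U x -> f x != 0) -> Ck k U f ->
  Ck k U (fun x => (f x)^-1).
Proof.
move=> oU f0; elim: k => [|k IH] cf.
  by move=> x Ux; apply: continuousV; [exact: f0|exact: cf].
have [df Df] := cf; split=> [x Ux|v].
  by apply: differentiableV; [exact: df|exact: f0].
have C := IH (CkS cf).
apply: Ck_ext (CkN oU (CkM oU (CkM oU C C) (Df v))) => // x Ux.
rewrite deriveV; [|exact: f0|by apply: diff_derivable; exact: df].
by rewrite -mulNr expr2 invfM.
Qed.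

Lemma Ck_prod k U I (r : seq I) (f : I -> _ -> R) :
  open U -> (forall i, Ck k U (f i)) -> Ck k U (fun x => \prod_(i <- r) f i x).
Proof.
move=> oU Cf; elim: r => [|i r IH].
  by under eq_fun do rewrite big_nil; exact: Ck_cst.
by under eq_fun do rewrite big_cons; exact: CkM.
Qed.

Lemma Ck_det p k U (A : _ -> 'M[R]_p) :
  open U -> Ck k U A -> Ck k U (fun x => \det (A x)).
Proof.
move=> oU cA; rewrite (_ : (fun _ => _) = \sum_(s : 'S_p)
  ((cst ((-1) ^+ s) : _ -> R) * (fun x => \prod_i A x i (s i)))); last first.
  by apply/funext => x; rewrite fct_sumE.
apply: Ck_sum => // s; apply: CkM => //; first exact: Ck_cst.
by apply: Ck_prod => // i; exact: Ck_coord.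
Qed.

Lemma Ck_invmx p k U (A : _ -> 'M[R]_p) :
  open U -> (forall x, U x -> A x \in unitmx) -> Ck k U A ->
  Ck k U (fun x => invmx (A x)).
Proof.
move=> oU uA cA; apply: Ck_mx => // i j.
have d0 x : U x -> \det (A x) != 0 by move/uA; rewrite unitmxE unitfE.
apply: (@Ck_ext _ _ _ _ _ (fun x => (\det (A x))^-1 * cofactor (A x) j i)) => //.
  by move=> x Ux; rewrite /invmx uA // !mxE.
apply: CkM => //; first by apply: Ck_inv => //; exact: Ck_det.
apply: CkM => //; first exact: Ck_cst.
apply: Ck_det => //; apply: Ck_mx => // a b.
by under eq_fun do rewrite !mxE; exact: Ck_coord.
Qed.

End SmoothCalculus.

(** * Restriction to lines, symmetry of second derivatives, chain rule *)

Section LineDerivatives.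
Variables (R : realType).

Lemma is_derive_line (W V : normedModType R) (h : W -> V) (x u : W) (a : R) :
  derivable h (x + a *: u) u ->
  is_derive a 1 (fun t => h (x + t *: u)) ('D_u h (x + a *: u)).
Proof.
have E : (fun s : R => s^-1 *: (h (x + (s *: 1 + a) *: u) - h (x + a *: u))) =
         (fun s : R => s^-1 *: (h (s *: u + (x + a *: u)) - h (x + a *: u))).
  apply/funext => s; congr (_ *: (h _ - _)).
  by rewrite [s *: 1]mulr1 scalerDl addrCA.
move=> dh; split.
  exact: (eq_ind_r (fun f : R -> V => cvg (f @ 0^')) dh E).
exact: (congr1 (fun f : R -> V => lim (f @ 0^')) E).
Qed.

Lemma derive_translate (W V : normedModType R) (h : W -> V) (c x u : W) :
  'D_u (fun y => h (c + y)) x = 'D_u h (c + x).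
Proof.
apply: (congr1 (fun f : R -> V => lim (f @ 0^'))).
by apply/funext => s /=; rewrite addrCA.
Qed.

Lemma differentiable_translate (W V : normedModType R) (h : W -> V) (c x : W) :
  differentiable h (c + x) -> differentiable (fun y => h (c + y)) x.
Proof.
by move=> dh; apply: (@differentiable_comp _ _ _ _ (fun y => c + y) h).
Qed.

Lemma derive_comp_diff (V W V' : normedModType R) (T : V -> W) (h : W -> V')
    x v :
  differentiable T x -> differentiable h (T x) ->
  'D_v (h \o T) x = 'D_('D_v T x) h (T x).
Proof.
move=> dT dh; rewrite (deriveE _ (differentiable_comp dT dh)) diff_comp //.
by rewrite (deriveE _ dh) (deriveE _ dT).
Qed.

Lemma derive_linear (V V' : normedModType R) (h : V -> V') x :
  differentiable h x -> linear (fun v => 'D_v h x).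
Proof. by move=> dh a u v; rewrite !(deriveE _ dh) linearP. Qed.

Lemma derive_row (n : nat) (V : normedModType R) (h : 'rV[R]_n -> V) x v :
  differentiable h x -> 'D_v h x = \sum_j v 0 j *: 'D_(delta_mx 0 j) h x.
Proof.
move=> dh; rewrite (deriveE _ dh) {1}(row_sum_delta v) linear_sum.
by apply: eq_bigr => j _; rewrite linearZ (deriveE _ dh).
Qed.

Lemma mean_value_line (n : nat) (h : 'rV[R]_n -> R) (x u : 'rV[R]_n) (t : R) :
  0 <= t ->
  (forall a : R, 0 <= a <= t -> differentiable h (x + a *: u)) ->
  exists2 a : R, 0 <= a <= t & h (x + t *: u) - h x = t * 'D_u h (x + a *: u).
Proof.
move=> t0 dh.
have D a : 0 <= a <= t ->
    is_derive a 1 (fun t => h (x + t *: u)) ('D_u h (x + a *: u)).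
  by move=> /dh dha; apply: is_derive_line; exact: diff_derivable.
have [a|a|a] := @MVT_segment R (fun t => h (x + t *: u))
  (fun a => 'D_u h (x + a *: u)) 0 t t0.
- by rewrite in_itv /= => /andP[a0 at_]; apply: D; rewrite !ltW.
- apply: continuous_in_subspaceT => b; rewrite inE /= in_itv /= => /D [db _].
  exact/differentiable_continuous/derivable1_diffP.
- rewrite in_itv /= => at0 E; exists a => //.
  by rewrite scale0r addr0 subr0 mulrC in E.
Qed.

(** Two mean value steps: along [u] for the increment of [h] in direction [v], then along [v] for
    the derivative so obtained. The second difference is symmetric in [u] and [v], which is what
    Schwarz's theorem exploits. *)
Lemma second_difference (n : nat) (U : set 'rV[R]_n) (h : 'rV[R]_n -> R)
    (x u v : 'rV[R]_n) (t : R) :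
  Ck 2 U h -> 0 <= t ->
  (forall a b : R, 0 <= a <= t -> 0 <= b <= t -> U (x + a *: u + b *: v)) ->
  exists a b : R, [/\ 0 <= a <= t, 0 <= b <= t &
    h (x + t *: u + t *: v) - h (x + t *: u) - h (x + t *: v) + h x =
    t ^+ 2 * 'D_v (fun y => 'D_u h y) (x + a *: u + b *: v)].
Proof.
move=> [dh Dh] t0 xU; have [dDh _] := Dh u.
pose k y := h (t *: v + y) - h y.
have dk a : 0 <= a <= t -> differentiable k (x + a *: u).
  move=> at0; have U0 : U (x + a *: u).
    by have := xU a 0 at0; rewrite scale0r addr0; apply; rewrite lexx.
  have U1 : U (t *: v + (x + a *: u)).
    by rewrite addrC; apply: xU; rewrite // t0 lexx.
  apply: differentiableB; last exact: dh.
  by apply: differentiable_translate; exact: dh.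
have [a at0 Ea] := mean_value_line t0 dk.
have U0 b : 0 <= b <= t -> U (x + a *: u + b *: v) by exact: xU.
have [b bt0 Eb] := mean_value_line t0 (fun b bt => dDh _ (U0 b bt)).
exists a, b; split => //; rewrite expr2 -mulrA -Eb.
transitivity (k (x + t *: u) - k x).
  by rewrite /k [t *: v + _]addrC [t *: v + x]addrC opprB addrA addrAC.
rewrite Ea; congr (_ * _).
have da : differentiable h (x + a *: u).
  by apply: dh; have := U0 0; rewrite scale0r addr0; apply; rewrite lexx.
have da' : differentiable h (t *: v + (x + a *: u)).
  by apply: dh; rewrite addrC; apply: U0; rewrite t0 lexx.
have ds := differentiable_translate da'.
rewrite /k deriveB; [|exact: diff_derivable..].
by rewrite derive_translate [t *: v + _]addrC.
Qed.

Lemma ler_dist_half (c d p e : R) :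
  `|c - p| <= e / 2 -> `|d - p| <= e / 2 -> `|c - d| <= e.
Proof.
move=> cp; rewrite distrC => pd; rewrite -(subrKA p) (splitr e).
exact: le_trans (ler_normD _ _) (lerD cp pd).
Qed.

Lemma derive_comm (n : nat) (U : set 'rV[R]_n) (h : 'rV[R]_n -> R)
    (x u v : 'rV[R]_n) :
  open U -> U x -> Ck 2 U h ->
  'D_u (fun y => 'D_v h y) x = 'D_v (fun y => 'D_u h y) x.
Proof.
move=> oU Ux Ch; have [_ Dh] := Ch.
have [_ /(_ u)/(_ _ Ux) cvu] := Dh v.
have [_ /(_ v)/(_ _ Ux) cuv] := Dh u.
pose f (y : 'rV[R]_n) : R := 'D_u ('D_v h) y.
pose g (y : 'rV[R]_n) : R := 'D_v ('D_u h) y.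
suff small (e : R) : 0 < e -> `|f x - g x| <= e.
  change (f x = g x); apply/eqP; rewrite -subr_eq0 -normr_le0.
  by apply/ler_addgt0Pl => e e0; rewrite addr0; exact: small.
move=> e0; have e2 : 0 < e / 2 by rewrite divr_gt0.
have nU : \forall y \near x, U y by apply: open_nbhs_nbhs.
have nf : \forall y \near x, `|f x - f y| <= e / 2.
  exact: (proj1 (cvgrPdist_le _ _) cvu).
have ng : \forall y \near x, `|g x - g y| <= e / 2.
  exact: (proj1 (cvgrPdist_le _ _) cuv).
have : nbhs x [set y | [/\ U y,
   `|f x - f y| <= e / 2 & `|g x - g y| <= e / 2]].
  by apply: filterS3 nU nf ng => y *; split.
rewrite -nbhs_ballE => -[r /= r0 B].
(* With this side the whole parallelogram stays in the ball where both mixed derivatives are within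
   [e / 2] of their values at [x]. The [+ 1] covers the case where [u] and [v] both vanish. *)
pose t := r / (`|u| + `|v| + 1).
have d0 : 0 < `|u| + `|v| + 1 by rewrite ltr_wpDl // addr_ge0.
have t0 : 0 < t by exact: divr_gt0.
have Bab (a b : R) : 0 <= a <= t -> 0 <= b <= t -> ball x r (x + a *: u + b *: v).
  move=> /andP[a0 at_] /andP[b0 bt].
  rewrite -ball_normE /= -addrA opprD addNKr normrN.
  rewrite (le_lt_trans (ler_normD _ _)) // !normrZ !ger0_norm //.
  rewrite (@le_lt_trans _ _ (t * `|u| + t * `|v|)) //.
    by rewrite lerD // ler_wpM2r.
  rewrite -mulrDr /t mulrAC ltr_pdivrMr // ltr_pM2l //.
  by rewrite ltrDl.
have [a [b [ha hb E1]]] := second_difference Ch (ltW t0)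
  (fun a b ha hb => let: And3 Uy _ _ := B _ (Bab a b ha hb) in Uy).
have Bab' (c d : R) : 0 <= c <= t -> 0 <= d <= t -> ball x r (x + c *: v + d *: u).
  by move=> hc hd; rewrite addrAC; exact: Bab.
have [a' [b' [ha' hb' E2]]] := second_difference Ch (ltW t0)
  (fun a b ha hb => let: And3 Uy _ _ := B _ (Bab' a b ha hb) in Uy).
have {E1 E2} E : g (x + a *: u + b *: v) = f (x + a' *: v + b' *: u).
  have : t ^+ 2 != 0 by rewrite expf_neq0 // gt_eqF.
  move/mulfI; apply; rewrite -[LHS]E1 -[RHS]E2 [x + t *: v + _]addrAC.
  by rewrite [X in X + _ = _]addrAC.
have [_ _ B1] := B _ (Bab _ _ ha hb); have [_ B2 _] := B _ (Bab' _ _ ha' hb').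
by rewrite E in B1; exact (ler_dist_half B2 B1).
Qed.

Lemma derive_comm_mx (n p q : nat) (U : set 'rV[R]_n)
    (h : 'rV[R]_n -> 'M[R]_(p, q)) (x u v : 'rV[R]_n) :
  open U -> U x -> Ck 2 U h ->
  'D_u (fun y => 'D_v h y) x = 'D_v (fun y => 'D_u h y) x.
Proof.
move=> oU Ux Ch; have [dh Dh] := Ch; apply/matrixP => i j.
have dD w : differentiable (fun y => 'D_w h y) x by have [+ _] := Dh w; apply.
have E w : \near x, 'D_w h x i j = 'D_w (fun y => h y i j) x.
  apply: open_near oU Ux _ => y Uy; rewrite derive_entry //.
  by apply: diff_derivable; exact: dh.
have EE w z : ('D_w (fun y => 'D_z h y) x) i j =
              'D_w (fun y => 'D_z (fun y => h y i j) y) x.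
  rewrite -(near_eq_derive w (E z)); apply: esym; apply: derive_entry.
  by apply: diff_derivable; exact: dD.
have C := derive_comm u v oU Ux (Ck_coord i j oU Ch).
exact (etrans (EE u v) (etrans C (esym (EE v u)))).
Qed.

(** By the chain rule a directional derivative of the composite is a sum of products of derivatives
    of [T] with partial derivatives of [h] composed with [T]; the induction hypothesis applies to
    the latter because [h] is generalized. *)
Lemma Ck_comp (n m : nat) k (U : set 'rV[R]_n) (W : set 'rV[R]_m)
    (T : 'rV[R]_n -> 'rV[R]_m) (h : 'rV[R]_m -> R) :
  open U -> open W -> (forall x, U x -> W (T x)) -> Ck k U T -> Ck k W h ->
  Ck k U (h \o T).
Proof.
move=> oU oW UW; elim: k h => [|k IH] h.
  move=> cT ch x Ux; apply: continuous_comp; first exact: cT.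
  by apply: ch; exact: UW.
move=> cT [dh Dh]; have [dT DT] := cT; split=> [x Ux|v].
  by apply: differentiable_comp; [exact: dT|apply: dh; exact: UW].
apply: (@Ck_ext _ _ _ _ _ (\sum_j ((fun x => 'D_v T x 0 j) *
    ((fun y => 'D_(delta_mx 0 j) h y) \o T)))) => //.
  move=> x Ux; rewrite derive_comp_diff; [|exact: dT|by apply: dh; exact: UW].
  by rewrite derive_row ?fct_sumE //; apply: dh; exact: UW.
apply: Ck_sum => // j; apply: CkM => //; first exact (Ck_coord 0 j oU (DT v)).
exact (IH _ (CkS cT) (Dh _)).
Qed.

End LineDerivatives.

(** * Linear differential equations and flat connections *)

Section MatrixNorm.
Variables (R : realType).

Lemma mx_norm_entry p q (M : 'M[R]_(p, q)) i j : `|M i j| <= `|M|.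
Proof.
rewrite [leRHS]/Num.Def.normr /= mx_normrE.
exact: (le_bigmax _ (fun ij : 'I_p * 'I_q => `|M ij.1 ij.2|) (i, j)).
Qed.

Lemma mx_norm_le p q (M : 'M[R]_(p, q)) (c : R) :
  0 <= c -> (forall i j, `|M i j| <= c) -> `|M| <= c.
Proof.
move=> c0 Mc; rewrite /Num.Def.normr /= mx_normrE.
by apply: bigmax_le => // -[i j] _; exact: Mc.
Qed.

(** The norm is the largest absolute entry and not an operator norm, hence the factor [q]. It
    reappears as [N%:R] in the smallness conditions below. *)
Lemma mx_norm_mulmx p q r (A : 'M[R]_(p, q)) (B : 'M[R]_(q, r)) :
  `|A *m B| <= q%:R * (`|A| * `|B|).
Proof.
apply: mx_norm_le => [|i j]; first by rewrite !mulr_ge0.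
rewrite mxE (le_trans (ler_norm_sum _ _ _)) //.
rewrite (@le_trans _ _ (\sum_(k < q) (`|A| * `|B|))) //.
  apply: ler_sum => k _; rewrite normrM ler_pM //; exact: mx_norm_entry.
by rewrite sumr_const card_ord mulr_natl.
Qed.

End MatrixNorm.

(** * Linear equations on the unit interval: estimates and Picard iteration *)

Section UnitIntervalODE.
Variables (R : realType) (N : nat).
Implicit Types (E F : R -> 'rV[R]_N) (M : R -> 'M[R]_N).

Lemma antiderivative (f : R -> R) : continuous f ->
  exists F : R -> R, F 0 = 0 /\
    forall t : R, 0 <= t <= 1 -> is_derive t 1 F (f t).
Proof.
(* Integrating over the larger interval from -1 to 2 makes 0 and 1 interior points, so the
   derivatives there are two-sided. *)
move=> cf; pose G x : R := \int[@lebesgue_measure R]_(t in `[-1, x]) f t.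
have intf : (@lebesgue_measure R).-integrable `[-1, 2] (EFin \o f).
  apply: continuous_compact_integrable; first exact: segment_compact.
  exact: continuous_subspaceT.
exists (fun x => G x - G 0); split => [|t /andP[t0 t1]]; first by rewrite subrr.
have t2 : t < 2 by lra.
have t3 : -1 < t by lra.
have [dG EG] := continuous_FTC1_closed t2 intf t3 (cf t).
have D : is_derive t 1 G (f t).
  by split; [exact: dG|rewrite -EG derive1E].
rewrite -[f t]subr0.
exact: (is_deriveB D (is_derive_cst (G 0) t 1)).
Qed.

Lemma antiderivative_rV (f : R -> 'rV[R]_N) : continuous f ->
  exists F, F 0 = 0 /\ forall t : R, 0 <= t <= 1 -> is_derive t 1 F (f t).
Proof.
move=> cf.
have ex j : {Fj : R -> R | Fj 0 = 0 /\
    forall t : R, 0 <= t <= 1 -> is_derive t 1 Fj (f t 0 j)}.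
  apply: cid; apply: antiderivative => t.
  apply: (@continuous_comp _ _ _ f (fun A => A 0 j)); first exact: cf.
  exact: coord_continuous.
exists (fun t => \row_j sval (ex j) t); split=> [|t t01].
  by apply/rowP => j; rewrite !mxE; have [] := svalP (ex j).
apply/is_derive_mx => i j; rewrite (ord1 i).
under eq_fun do rewrite mxE.
by have [_] := svalP (ex j); apply.
Qed.

(** The mean value theorem is used entry by entry; no constant is lost because the norm is the
    largest entry. *)
Lemma mean_value_bound E E' (K : R) :
  E 0 = 0 -> (forall t : R, 0 <= t <= 1 -> is_derive t 1 E (E' t)) ->
  (forall t : R, 0 <= t <= 1 -> `|E' t| <= K) ->
  forall t : R, 0 <= t <= 1 -> `|E t| <= K.
Proof.
move=> E0 dE E'K t /andP[t0 t1].
have K0 : 0 <= K by rewrite (le_trans _ (E'K 0 _)) // lexx ler01.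
apply: mx_norm_le => // i j.
have D (s : R) : 0 <= s <= 1 -> is_derive s 1 (fun s : R => E s i j) (E' s i j).
  by move=> s01; have /is_derive_mx := dE s s01.
have [s|s|s] := @MVT_segment R (fun s => E s i j) (fun s => E' s i j) 0 t t0.
- rewrite in_itv /= => /andP[s0 st]; apply: D; rewrite ltW //=.
  exact: le_trans (ltW st) t1.
- apply: continuous_in_subspaceT => b; rewrite inE /= in_itv /=.
  move=> /andP[b0 bt]; have /D[db _] : 0 <= b <= 1.
    by rewrite b0 (le_trans bt).
  exact/differentiable_continuous/derivable1_diffP.
- rewrite in_itv /= => /andP[s0 st]; rewrite E0 mxE !subr0 => ->.
  rewrite normrM (ger0_norm t0) -[leRHS]mulr1 ler_pM //.
  apply: le_trans (mx_norm_entry _ _ _) _; apply: E'K.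
  by rewrite s0 (le_trans st).
Qed.

(** No exponential is involved: at a point [c] where [|E|] is maximal on the unit interval, the mean
    value bound gives |E c| <= |E c| / 2 + K, and the half is absorbed on the left. *)
Lemma gronwall_unit E E' (K : R) :
  E 0 = 0 -> (forall t : R, 0 <= t <= 1 -> is_derive t 1 E (E' t)) ->
  (forall t : R, 0 <= t <= 1 -> `|E' t| <= `|E t| / 2 + K) ->
  forall t : R, 0 <= t <= 1 -> `|E t| <= 2 * K.
Proof.
move=> E0 dE E'K.
have cE : {within `[0, 1], continuous (fun t => `|E t|)}.
  apply: continuous_in_subspaceT => b; rewrite inE /= in_itv /= => /dE[db _].
  apply: (@continuous_comp _ _ _ E Num.norm); last exact: norm_continuous.
  exact/differentiable_continuous/derivable1_diffP.
have [c] := EVT_max ler01 cE.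
rewrite in_itv /= => c01 Ec.
have B : `|E c| <= `|E c| / 2 + K.
  apply: (mean_value_bound E0 dE) c01 => t t01.
  apply: le_trans (E'K t t01) _; rewrite lerD2r ler_pM2r ?invr_gt0 //.
  by apply: Ec; rewrite in_itv.
move=> t t01; have Et : `|E t| <= `|E c| by apply: Ec; rewrite in_itv.
have : `|E c| <= 2 * K by lra.
exact: le_trans.
Qed.

End UnitIntervalODE.

Lemma continuous_mulmx (R : realType) (T : topologicalType) p q r
    (A : T -> 'M[R]_(p, q)) (B : T -> 'M[R]_(q, r)) :
  continuous A -> continuous B -> continuous (fun t => A t *m B t).
Proof.
move=> cA cB.
rewrite (_ : (fun _ => _) = fun t => \sum_i \sum_j
  (\sum_k A t i k * B t k j) *: delta_mx i j); last first.
  apply/funext => s; rewrite [LHS]matrix_sum_delta; apply: eq_bigr => i _.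
  by apply: eq_bigr => j _; rewrite mxE.
do 2!(apply: continuous_big => [|? _]; first exact: add_continuous).
move=> t; apply: cvgZr_tmp; move: t.
apply: continuous_big => [|k _]; first exact: add_continuous.
move=> t; apply: cvgM.
  apply: (@continuous_comp _ _ _ A (fun A => A _ k)); first exact: cA.
  exact: coord_continuous.
apply: (@continuous_comp _ _ _ B (fun A => A k _)); first exact: cB.
exact: coord_continuous.
Qed.

Section LinearODE.
Variables (R : realType) (N : nat).

(** Freezing the parameter outside the unit interval keeps coefficients and Picard iterates
    continuous on the whole line, the form in which [antiderivative] takes its integrand. *)
Definition clamp (t : R) : R := Num.max 0 (Num.min 1 t).

Lemma clamp_itv t : 0 <= clamp t <= 1.
Proof. by rewrite /clamp le_max lexx /= ge_max ler01 ge_min lexx. Qed.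

Lemma clamp_id t : 0 <= t <= 1 -> clamp t = t.
Proof. by move=> /andP[t0 t1]; rewrite /clamp (min_idPr _) // (max_idPr _). Qed.

Lemma clamp_continuous : continuous clamp.
Proof.
move=> t; apply: continuous_max; first exact: cst_continuous.
by apply: continuous_min; [exact: cst_continuous|exact: cvg_id].
Qed.

Lemma le0_geometric (x C : R) : (forall k, x <= C * 2^-1 ^+ k) -> x <= 0.
Proof.
move=> H; have h2 : `|2^-1 : R| < 1 by rewrite ger0_norm //; lra.
have cv : C * 2^-1 ^+ k @[k --> \oo] --> C * 0 by apply: cvgMr; exact: cvg_expr.
rewrite -(mulr0 C) -(cvg_lim (@Rhausdorff R) cv).
apply: limr_ge; first by apply/cvg_ex; exists (C * 0).
by apply: nearW.
Qed.

Lemma geometric_limit (z : nat -> R -> 'rV[R]_N) (D : R) :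
  (forall k, continuous (z k)) ->
  (forall k t, `|z k.+1 t - z k t| <= D * 2^-1 ^+ k) ->
  exists2 y : R -> 'rV[R]_N, continuous y &
    forall k t, `|y t - z k t| <= 2 * D * 2^-1 ^+ k.
Proof.
move=> cz zD; have D0 : 0 <= D.
  by have := zD 0%N 0; rewrite expr0 mulr1; exact: le_trans.
have e0 k : 0 <= (2^-1 : R) ^+ k by apply: exprn_ge0; lra.
(* The last factor is the exact geometric partial sum; with it the induction on [m] closes with
   equality. *)
have zC k m t : `|z (k + m)%N t - z k t| <= 2 * D * 2^-1 ^+ k * (1 - 2^-1 ^+ m).
  elim: m => [|m IH]; first by rewrite addn0 subrr normr0 expr0 subrr mulr0.
  rewrite addnS -(subrKA (z (k + m)%N t)).
  apply: le_trans (ler_normD _ _) _; apply: le_trans (lerD (zD _ t) IH) _.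
  by rewrite exprD exprS le_eqVlt; apply/orP; left; apply/eqP; field.
have zC' k m t : `|z (k + m)%N t - z k t| <= 2 * D * 2^-1 ^+ k.
  apply: le_trans (zC k m t) _; rewrite -[leRHS]mulr1 ler_wpM2l //.
  by rewrite !mulr_ge0.
have small (e : R) : 0 < e -> exists k, 2 * D * 2^-1 ^+ k <= e.
  move=> e_gt0; apply: contrapT => /forallNP H.
  have : e <= 0.
    apply: (@le0_geometric _ (2 * D)) => k.
    by have /negP := H k; rewrite -ltNge => /ltW.
  by rewrite leNgt e_gt0.
have cvz t : cvg (z k t @[k --> \oo]).
  apply/cauchy_cvgP/cauchy_exP => e e_gt0.
  have e2 : 0 < e / 2 by lra.
  have [k Hk] := small _ e2.
  exists (z k t); exists k => // m /= km.
  rewrite -ball_normE /= distrC -(subnKC km).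
  by apply: le_lt_trans (le_trans (zC' _ _ _) Hk) _; lra.
pose y t := lim (z k t @[k --> \oo]).
have yz k t : `|y t - z k t| <= 2 * D * 2^-1 ^+ k.
  apply/ler_addgt0Pl => e e_gt0.
  have /cvgrPdist_le/(_ _ e_gt0)[m _ Hm] : z k t @[k --> \oo] --> y t := cvz t.
  rewrite -(subrKA (z (k + m)%N t)); apply: le_trans (ler_normD _ _) _.
  by apply: lerD (zC' _ _ _); apply: Hm; rewrite /= leq_addl.
exists y => // t; apply/cvgrPdist_le => e e_gt0.
have e3 : 0 < e / 3 by lra.
have [k Hk] := small _ e3.
have /cvgrPdist_le/(_ _ e3) := cz k t; apply: filterS => s Hs.
have -> : y t - y s = (y t - z k t) + ((z k t - z k s) - (y s - z k s)).
  by rewrite opprB !subrKA.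
apply: le_trans (ler_normD _ _) _.
have H1 := le_trans (yz k t) Hk.
have H2 := le_trans (ler_normB _ _) (lerD Hs (le_trans (yz k s) Hk)).
by apply: le_trans (lerD H1 H2) _; lra.
Qed.

(** Picard iteration. The smallness of [M] makes integration against it a contraction of ratio 1/2
    on the whole unit interval, so successive iterates differ geometrically and their uniform limit
    solves the integral equation. *)
Lemma linear_ode (M : R -> 'M[R]_N) (y0 : 'rV[R]_N) :
  continuous M -> (forall t, N%:R * `|M t| <= 2^-1) ->
  exists y : R -> 'rV[R]_N, y 0 = y0 /\
    forall t : R, 0 <= t <= 1 -> is_derive t 1 y (y t *m M t).
Proof.
move=> cM M2.
have MB (w : 'rV[R]_N) t : `|w *m M t| <= `|w| / 2.
  apply: le_trans (mx_norm_mulmx _ _) _.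
  by rewrite mulrCA ler_wpM2l.
have czM (z : R -> 'rV[R]_N) : continuous z -> continuous (fun t => z t *m M t).
  by move=> cz; exact: continuous_mulmx.
pose Z := {z : R -> 'rV[R]_N | continuous z}.
have ex (z : Z) : {F : R -> 'rV[R]_N | F 0 = 0 /\
    forall t : R, 0 <= t <= 1 -> is_derive t 1 F (sval z t *m M t)}.
  by apply: cid; apply: antiderivative_rV; apply: czM; exact: svalP z.
have cstep z : continuous (fun t => y0 + sval (ex z) (clamp t)).
  move=> t; apply: cvgD; first exact: cst_continuous.
  apply: (@continuous_comp _ _ _ clamp (sval (ex z))).
    exact: clamp_continuous.
  have [_ /(_ _ (clamp_itv t)) [d _]] := svalP (ex z).
  exact/differentiable_continuous/derivable1_diffP.
pose step z : Z := exist _ _ (cstep z).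
have c0 : continuous (cst y0 : R -> 'rV[R]_N) by move=> t; exact: cst_continuous.
pose zs k : Z := iter k step (exist _ _ c0).
pose z k := sval (zs k).
have diffF (a b : Z) (K : R) : (forall t, `|sval a t - sval b t| <= K) ->
    forall t : R, 0 <= t <= 1 -> `|sval (ex a) t - sval (ex b) t| <= K / 2.
  move=> abK; have [a0 da] := svalP (ex a); have [b0 db] := svalP (ex b).
  apply: (@mean_value_bound _ _ (fun t => sval (ex a) t - sval (ex b) t)
    (fun t => sval a t *m M t - sval b t *m M t)).
  - by rewrite a0 b0 subrr.
  - by move=> t t01; exact: is_deriveB (da t t01) (db t t01).
  - move=> t _; rewrite -mulmxBl; apply: le_trans (MB _ _) _.
    by rewrite ler_pM2r.
have [y cy yz] : exists2 y : R -> 'rV[R]_N, continuous y &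
    forall k t, `|y t - z k t| <= 2 * `|y0| * 2^-1 ^+ k.
  apply: geometric_limit => [k|k]; first exact: svalP (zs k).
  elim: k => [|k IH] t.
    rewrite expr0 mulr1 /z /= addrAC subrr add0r.
    have [F0 dF] := svalP (ex (exist _ _ c0)).
    apply: (mean_value_bound F0 dF) (clamp_itv t) => s _ /=.
    by apply: le_trans (MB _ _) _; have := normr_ge0 y0; lra.
  rewrite /z /= opprD addrACA subrr add0r exprSr mulrA.
  exact: diffF IH _ (clamp_itv t).
pose ys : Z := exist _ _ cy.
have [F0 dF] := svalP (ex ys).
have yE t : 0 <= t <= 1 -> y t = y0 + sval (ex ys) t.
  move=> t01; apply/eqP; rewrite -subr_eq0 -normr_le0.
  apply: (@le0_geometric _ (2 * `|y0|)) => k.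
  rewrite -(subrKA (z k.+1 t)); apply: le_trans (ler_normD _ _) _.
  have H1 := yz k.+1 t.
  have H2 : `|z k.+1 t - (y0 + sval (ex ys) t)| <= 2 * `|y0| * 2^-1 ^+ k / 2.
    rewrite /z /= (clamp_id t01) opprD addrACA subrr add0r.
    by apply: diffF t01 => s; rewrite distrC; exact: yz.
  apply: le_trans (lerD H1 H2) _; rewrite exprSr; lra.
(* The witness is the right side of the integral equation rather than the limit [y]: they agree on
   the unit interval, but the iterates are clamped, so only the former is sure to have two-sided
   derivatives at 0 and 1. *)
exists (fun t => y0 + sval (ex ys) t); split; first by rewrite F0 addr0.
move=> t t01; rewrite -(yE t t01) -[_ *m _]add0r.
exact: (is_deriveD (is_derive_cst y0 t 1) (dF t t01)).
Qed.

End LinearODE.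

Ltac generalize_mulmx :=
  repeat match goal with
  | |- context [@mulmx ?R ?m ?n ?p ?A ?B] =>
      move: (@mulmx R m n p A B) => ?
  end.

Ltac expand_mx :=
  rewrite ?(mulmxDl, mulmxDr, mulmxBl, mulmxBr, mulNmx, mulmxN, mul0mx, mulmx0);
  rewrite -?scalemxAl -?scalemxAr ?mulmxA.

Ltac mx_ring :=
  repeat progress expand_mx;
  generalize_mulmx; apply/matrixP => ? ?; rewrite !mxE; ring.

Ltac mx_field :=
  repeat progress expand_mx;
  generalize_mulmx; apply/matrixP => ? ?; rewrite !mxE; field; by rewrite ?pnatr_eq0.

(** * Parallel sections of a flat connection, by integration along rays *)

Section ParallelSections.
Variables (R : realType) (d N : nat).
Variables (U : set 'rV[R]_d) (A : 'rV[R]_d -> 'rV[R]_d -> 'M[R]_N).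
Hypothesis U_open : open U.
Hypothesis A_linear : forall x, U x -> linear (A^~ x).
Hypothesis A_C2 : forall v, Ck 2 U (A v).
Hypothesis A_flat : forall x u v, U x ->
  'D_u (A v) x - 'D_v (A u) x + A u x *m A v x - A v x *m A u x = 0.

Let e_ (j : 'I_d) : 'rV[R]_d := delta_mx 0 j.

Lemma linear_row_scale (V : lmodType R) (f : 'rV[R]_d -> V) v :
  linear f -> f v = \sum_j v 0 j *: f (e_ j).
Proof.
move=> lin; pose L : {linear _ -> _} :=
  HB.pack f (GRing.isLinear.Build _ _ _ _ f lin).
rewrite -[f v]/(L v) [in LHS](row_sum_delta v) linear_sum.
by apply: eq_bigr => j _; rewrite linearZ.
Qed.

Lemma linear_bound p q (f : 'rV[R]_d -> 'M[R]_(p, q)) (b : R) v :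
  linear f -> (forall j, `|f (e_ j)| <= b) -> `|f v| <= d%:R * b * `|v|.
Proof.
move=> lin fb; rewrite (linear_row_scale v lin).
apply: le_trans (ler_norm_sum _ _ _) _.
rewrite (@le_trans _ _ (\sum_(j < d) (`|v| * b))) //.
  apply: ler_sum => j _; rewrite normrZ ler_pM //; exact: mx_norm_entry.
by rewrite sumr_const card_ord -[leLHS]mulr_natl -mulrA [b * _]mulrC.
Qed.

Lemma near_bounded p q (f : 'rV[R]_d -> 'M[R]_(p, q)) x0 :
  {for x0, continuous f} ->
  exists2 b : R, 0 <= b & \forall x \near x0, `|f x| <= b.
Proof.
move=> cf; exists (`|f x0| + 1); first by rewrite addr_ge0.
have /cvgrPdist_le/(_ _ ltr01) := cf; apply: filterS => x.
rewrite distrC => H; rewrite -[f x](subrK (f x0)).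
by rewrite addrC (le_trans (ler_normD _ _)) // lerD2l.
Qed.

Lemma near_bounded_fam (I : finType) p q
    (f : I -> 'rV[R]_d -> 'M[R]_(p, q)) x0 :
  (forall i, {for x0, continuous (f i)}) ->
  exists2 b : R, 0 <= b & \forall x \near x0, forall i, `|f i x| <= b.
Proof.
move=> cf.
have ex i : {b : R | 0 <= b /\ \forall x \near x0, `|f i x| <= b}.
  by apply: cid; have [b b0 H] := near_bounded (@cf i); exists b.
exists (\sum_i sval (ex i)).
  by apply: sumr_ge0 => i _; have [] := svalP (ex i).
have H i : \forall x \near x0, `|f i x| <= sval (ex i).
  by have [] := svalP (ex i).
have : \forall x \near x0, forall i, `|f i x| <= sval (ex i).
  exact: (@filter_forall _ _ (fun i => [set x | `|f i x| <= sval (ex i)]) _ _ H).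
apply: filterS => x Hx i; apply: le_trans (Hx i) _.
rewrite (bigD1 i) //= lerDl; apply: sumr_ge0 => j _.
by have [] := svalP (ex j).
Qed.

Lemma derive_linear_A x w : U x -> linear (fun v => 'D_w (A v) x).
Proof.
move=> Ux a u v; have D z : derivable (A z) x w.
  by apply: diff_derivable; have [+ _] := A_C2 z; apply.
rewrite -deriveZ // -deriveD //; last exact: derivableZ.
apply: near_eq_derive; apply: open_near U_open Ux _ => y Uy.
exact: A_linear.
Qed.

Lemma derive2_linear_A x w w' : U x ->
  linear (fun v => 'D_w' (fun y => 'D_w (A v) y) x).
Proof.
move=> Ux a u v; have D z : derivable (fun y => 'D_w (A z) y) x w'.
  by apply: diff_derivable; have [_ /(_ w)[+ _]] := A_C2 z; apply.
rewrite -deriveZ // -deriveD //; last exact: derivableZ.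
apply: near_eq_derive; apply: open_near U_open Ux _ => y Uy.
exact: derive_linear_A.
Qed.

Lemma derive2_linear x v w' : U x ->
  linear (fun w => 'D_w' (fun y => 'D_w (A v) y) x).
Proof.
move=> Ux a u w; have D z : derivable (fun y => 'D_z (A v) y) x w'.
  by apply: diff_derivable; have [_ /(_ z)[+ _]] := A_C2 v; apply.
rewrite -deriveZ // -deriveD //; last exact: derivableZ.
apply: near_eq_derive; apply: open_near U_open Ux _ => y Uy.
by apply: derive_linear; have [+ _] := A_C2 v; apply.
Qed.

(** [A v] and its derivatives are linear in [v] and in the directions of differentiation, so it is
    enough to bound the finitely many continuous functions obtained from basis vectors. *)
Lemma connection_bounds x0 : U x0 -> exists (B r : R),
  [/\ 0 <= B, 0 < r, ball x0 r `<=` U & forall x, ball x0 r x ->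
   [/\ forall v, `|A v x| <= B * `|v|,
       forall v w, `|'D_w (A v) x| <= B * `|v| * `|w| &
       forall v w, `|'D_w (fun y => 'D_w (A v) y) x| <=
         B * `|v| * `|w| * `|w| ]].
Proof.
move=> Ux0.
have c0 j : {for x0, continuous (A (e_ j))}.
  by have /CkS/CkS := A_C2 (e_ j); apply.
have c1 ij : {for x0, continuous (fun y => 'D_(e_ ij.1) (A (e_ ij.2)) y)}.
  by have [_ H] := A_C2 (e_ ij.2); have [D _] := H (e_ ij.1); exact/differentiable_continuous/D.
have c2 ijk : {for x0, continuous (fun y => 'D_(e_ ijk.1.1)
    (fun y => 'D_(e_ ijk.1.2) (A (e_ ijk.2)) y) y)}.
  have [_ H] := A_C2 (e_ ijk.2); have [_ H'] := H (e_ ijk.1.2).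
  exact: (H' (e_ ijk.1.1)).
have [b0 b0p H0] := near_bounded_fam c0.
have [b1 b1p H1] := near_bounded_fam c1.
have [b2 b2p H2] := near_bounded_fam c2.
have nU : \forall y \near x0, U y by apply: open_nbhs_nbhs.
have nb := @filterI _ (nbhs x0) _ _ _ (filterI nU H0) (filterI H1 H2).
have [r /= r0 Hr] := proj1 (nbhs_ballP _ _)
  (nb (nbhs_filter _) (nbhs_filter _) (nbhs_filter _)).
pose B0 := d%:R * b0; pose B1 := d%:R * (d%:R * b1).
pose B2 := d%:R * (d%:R * (d%:R * b2)).
have B0p : 0 <= B0 by rewrite mulr_ge0.
have B1p : 0 <= B1 by rewrite !mulr_ge0.
have B2p : 0 <= B2 by rewrite !mulr_ge0.
exists (B0 + B1 + B2), r; split=> //; first by rewrite !addr_ge0.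
  by move=> x /Hr [[]].
move=> x /Hr [[Ux K0] [K1 K2]].
have L0 v : `|A v x| <= B0 * `|v| by exact: linear_bound (A_linear Ux) K0.
have L1 v w : `|'D_w (A v) x| <= B1 * `|v| * `|w|.
  have dA : differentiable (A v) x by have [+ _] := A_C2 v; apply.
  rewrite (_ : B1 * `|v| = d%:R * (d%:R * b1 * `|v|)); last by rewrite /B1 !mulrA.
  apply: linear_bound (derive_linear dA) _ => i.
  by apply: linear_bound (derive_linear_A _ Ux) _ => j; exact: (K1 (i, j)).
have L2 v w : `|'D_w (fun y => 'D_w (A v) y) x| <= B2 * `|v| * `|w| * `|w|.
  have dA : differentiable (fun y => 'D_w (A v) y) x.
    by have [_ /(_ w)[+ _]] := A_C2 v; apply.
  rewrite (_ : B2 * `|v| * `|w| = d%:R * (d%:R * (d%:R * b2 * `|v|) * `|w|));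
    last by rewrite /B2 !mulrA.
  apply: linear_bound (derive_linear dA) _ => i.
  apply: (linear_bound (f := fun w => 'D_(e_ i) (fun y => 'D_w (A v) y) x)).
    exact: derive2_linear.
  move=> j.
  apply: (linear_bound (f := fun v => 'D_(e_ i) (fun y => 'D_(e_ j) (A v) y) x)).
    exact: derive2_linear_A.
  by move=> k; exact: (K2 (i, j, k)).
split=> [v|v w|v w].
- by apply: le_trans (L0 v) _; rewrite ler_wpM2r // -addrA lerDl addr_ge0.
- apply: le_trans (L1 v w) _; rewrite !ler_wpM2r // addrAC lerDr addr_ge0 //.
- by apply: le_trans (L2 v w) _; rewrite !ler_wpM2r // lerDr addr_ge0.
Qed.

Section Estimates.
Variables (x0 : 'rV[R]_d) (B r : R).
Hypotheses (B0 : 0 <= B) (r0 : 0 < r) (rU : ball x0 r `<=` U).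
Hypothesis bounds : forall x, ball x0 r x ->
   [/\ forall v, `|A v x| <= B * `|v|,
       forall v w, `|'D_w (A v) x| <= B * `|v| * `|w| &
       forall v w, `|'D_w (fun y => 'D_w (A v) y) x| <=
         B * `|v| * `|w| * `|w| ].

Lemma connection_increment x k v :
  (forall a : R, 0 <= a <= 1 -> ball x0 r (x + a *: k)) ->
  `|A v (x + k) - A v x| <= B * `|v| * `|k|.
Proof.
move=> seg; apply: mx_norm_le => [|i j]; first by rewrite !mulr_ge0.
have dA y : U y -> differentiable (A v) y by have [+ _] := A_C2 v; apply.
have dh (a : R) : 0 <= a <= 1 ->
    differentiable (fun y => A v y i j) (x + a *: k).
  by move=> a01; apply: differentiable_entry; exact/dA/rU/seg.
have [a a01] := mean_value_line ler01 dh.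
rewrite scale1r mul1r !mxE => ->.
have /diff_derivable d1 := dA _ (rU (seg _ a01)).
rewrite (derive_entry i j (d1 k)); apply: le_trans (mx_norm_entry _ _ _) _.
by have [_ + _] := bounds (seg _ a01); apply.
Qed.

(** Two nested mean value steps. Only the quadratic order in [k] matters later, so the usual factor
    1/2 is not sought. *)
Lemma connection_taylor x k v :
  (forall a : R, 0 <= a <= 1 -> ball x0 r (x + a *: k)) ->
  `|A v (x + k) - A v x - 'D_k (A v) x| <= B * `|v| * `|k| * `|k|.
Proof.
move=> seg; apply: mx_norm_le => [|i j]; first by rewrite !mulr_ge0.
have dA y : U y -> differentiable (A v) y by have [+ _] := A_C2 v; apply.
have dDA y : U y -> differentiable (fun y => 'D_k (A v) y) y.
  by have [_ /(_ k)[+ _]] := A_C2 v; apply.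
have dh (a : R) : 0 <= a <= 1 ->
    differentiable (fun y => A v y i j) (x + a *: k).
  by move=> a01; apply: differentiable_entry; exact/dA/rU/seg.
have [a a01] := mean_value_line ler01 dh.
have Ux : ball x0 r x.
  by have := seg 0; rewrite scale0r addr0; apply; rewrite lexx ler01.
have d1 y : U y -> derivable (A v) y k by move=> /dA/diff_derivable; apply.
rewrite scale1r mul1r (derive_entry i j (d1 _ (rU (seg _ a01)))) => E.
have -> : (A v (x + k) - A v x - 'D_k (A v) x) i j =
    ('D_k (A v) (x + a *: k)) i j - ('D_k (A v) x) i j by rewrite !mxE E.
have [a0 a1] := andP a01.
have dh' (b : R) : 0 <= b <= a ->
    differentiable (fun y => ('D_k (A v) y) i j) (x + b *: k).
  move=> /andP[b0 ba]; apply: differentiable_entry; apply: dDA; apply: rU.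
  by apply: seg; rewrite b0 (le_trans ba).
have [b /andP[b0 ba] ->] := mean_value_line a0 dh'.
have b01 : 0 <= b <= 1 by rewrite b0 (le_trans ba).
have d2 : derivable (fun y => 'D_k (A v) y) (x + b *: k) k.
  by apply: diff_derivable; apply: dDA; exact/rU/seg.
rewrite (derive_entry i j d2) normrM (ger0_norm a0) -[leRHS]mul1r.
apply: ler_pM => //; apply: le_trans (mx_norm_entry _ _ _) _.
by have [_ _] := bounds (seg _ b01); apply.
Qed.

Variable y0 : 'rV[R]_N.

(** The equation that a parallel section satisfies along the segment from [x0] to [x0 + xi]. Every
    segment is parametrized by the unit interval, so that a short [xi] means a small coefficient. *)
Definition ray_solution (xi : 'rV[R]_d) (y : R -> 'rV[R]_N) := y 0 = y0 /\
  forall t : R, 0 <= t <= 1 ->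
    is_derive t 1 y (y t *m A xi (x0 + t *: xi)).

Lemma ray_ball (rho : R) xi (t : R) : rho <= r -> `|xi| < rho -> 0 <= t <= 1 ->
  ball x0 r (x0 + t *: xi).
Proof.
move=> rhor xir /andP[t0 t1]; rewrite -ball_normE /= opprD addrA subrr add0r.
rewrite normrN normrZ (ger0_norm t0); apply: lt_le_trans rhor.
by apply: le_lt_trans xir; rewrite -[leRHS]mul1r ler_wpM2r.
Qed.

Lemma ray_solution_exists (rho : R) xi : rho <= r ->
  N%:R * (B * rho) <= 2^-1 -> `|xi| < rho -> exists y, ray_solution xi y.
Proof.
move=> rhor small xir.
pose M t := A xi (x0 + clamp t *: xi).
have cM : continuous M.
  move=> t; apply: (@continuous_comp _ _ _ (fun t => x0 + clamp t *: xi) (A xi)).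
    apply: cvgD; first exact: cst_continuous.
    by apply: cvgZr_tmp; exact: clamp_continuous.
  have /CkS/CkS := A_C2 xi; apply; apply: rU.
  exact: ray_ball rhor xir (clamp_itv t).
have bM t : N%:R * `|M t| <= 2^-1.
  apply: le_trans small; rewrite ler_wpM2l //.
  have [+ _ _] := bounds (ray_ball rhor xir (clamp_itv t)).
  move=> /(_ xi)/le_trans; apply; rewrite ler_wpM2l //; exact: ltW.
have [y [yE dy]] := linear_ode y0 cM bM.
by exists y; split=> // t t01; have := dy t t01; rewrite /M clamp_id.
Qed.

Lemma ray_mulmx (rho : R) xi (w : 'rV[R]_N) (t : R) : rho <= r ->
  N%:R * (B * rho) <= 2^-1 -> `|xi| < rho -> 0 <= t <= 1 ->
  `|w *m A xi (x0 + t *: xi)| <= `|w| / 2.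
Proof.
move=> rhor small xir t01; apply: le_trans (mx_norm_mulmx _ _) _.
rewrite mulrCA ler_wpM2l //; apply: le_trans small; rewrite ler_wpM2l //.
have [+ _ _] := bounds (ray_ball rhor xir t01).
by move=> /(_ xi)/le_trans; apply; rewrite ler_wpM2l //; exact: ltW.
Qed.

Lemma ray_solution_bound (rho : R) xi y (t : R) : rho <= r ->
  N%:R * (B * rho) <= 2^-1 -> `|xi| < rho -> ray_solution xi y ->
  0 <= t <= 1 -> `|y t| <= 2 * `|y0|.
Proof.
move=> rhor small xir [yE dy] t01.
have : `|y t - y0| <= 2 * (`|y0| / 2).
  apply: (@gronwall_unit _ _ (fun t => y t - y0)
    (fun t => y t *m A xi (x0 + t *: xi) - 0)) t01.
  - by rewrite yE subrr.
  - by move=> s s01; exact: is_deriveB (dy s s01) (is_derive_cst y0 s 1).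
  - move=> s s01; rewrite subr0.
    apply: le_trans (ray_mulmx _ rhor small xir s01) _.
    rewrite -mulrDl ler_pM2r ?invr_gt0 //.
    by rewrite -[y s in leLHS](subrK y0); exact: ler_normD.
rewrite mulrCA divff ?mulr1 // => H.
rewrite -[y t](subrK y0); apply: le_trans (ler_normD _ _) _.
by apply: le_trans (lerD H (lexx _)) _; lra.
Qed.

(** The place where flatness is used: solutions along neighbouring rays differ at time 1 by
    [y 1 *m A h] up to a quadratic error, so the end values have the derivative expected of a
    parallel section in all directions. In the constant, the outer 2 comes from the Gronwall
    estimate, [N%:R] from the matrix product, 2 |y0| bounds [y], and the last factor bounds the
    remainder in [key]. *)
Lemma ray_solution_increment (rho : R) xi h y z : rho <= r -> rho <= 1 ->
  N%:R * (B * rho) <= 2^-1 -> `|xi| < rho -> `|xi + h| < rho ->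
  ray_solution xi y -> ray_solution (xi + h) z ->
  `|z 1 - y 1 - y 1 *m A h (x0 + xi)| <=
    2 * (N%:R * (2 * `|y0|) * (2 * B + 2 * N%:R * B * B)) * (`|h| * `|h|).
Proof.
move=> rhor rho1 small xir xihr [y0E dy] [z0E dz].
pose p (t : R) := x0 + t *: xi; pose q (t : R) := x0 + t *: (xi + h).
have qE t : q t = p t + t *: h by rewrite /q /p scalerDr addrA.
have pball (t : R) : 0 <= t <= 1 -> ball x0 r (p t) by exact: ray_ball rhor xir.
have qball (t : R) : 0 <= t <= 1 -> ball x0 r (q t) by exact: ray_ball rhor xihr.
have xi1 : `|xi| <= 1 by exact: le_trans (ltW xir) rho1.
have seg (t a : R) : 0 <= t <= 1 -> 0 <= a <= 1 ->
    ball x0 r (p t + a *: (t *: h)).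
  move=> t01 /andP[a0 a1].
  have -> : p t + a *: (t *: h) = x0 + t *: ((1 - a) *: xi + a *: (xi + h)).
    rewrite [(1 - a) *: xi + _](_ : _ = xi + a *: h); last first.
      by rewrite scalerDr addrA -scalerDl subrK scale1r.
    by rewrite /p -addrA scalerDr !scalerA [t * a]mulrC.
  apply: (@ray_ball rho) => //; apply: le_lt_trans (ler_normD _ _) _.
  have a1' : 0 <= 1 - a by rewrite subr_ge0.
  rewrite !normrZ (ger0_norm a0) (ger0_norm a1').
  have [->|an0] := eqVneq a 0; first by rewrite subr0 mul1r mul0r addr0.
  have {an0 a0} a0 : 0 < a by rewrite lt_def an0.
  rewrite (_ : rho = (1 - a) * rho + a * rho); last by ring.
  apply: ler_ltD; first by rewrite ler_wpM2l // ltW.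
  by rewrite ltr_pM2l.
set K := 2 * B + 2 * N%:R * B * B.
have K0 : 0 <= K by rewrite addr_ge0 ?mulr_ge0.
(* At time [t] the two rays are [t *: h] apart, hence the predicted variation subtracted here. *)
pose E t := z t - y t - t *: (y t *m A h (p t)).
pose D t := (y t *m A xi (p t)) *m A h (p t) + y t *m 'D_xi (A h) (p t).
pose E' t := z t *m A (xi + h) (q t) - y t *m A xi (p t) -
  (y t *m A h (p t) + t *: D t).
have dE (t : R) : 0 <= t <= 1 -> is_derive t 1 E (E' t).
  move=> t01; apply: is_deriveB; first exact: is_deriveB (dz t t01) (dy t t01).
  rewrite -[y t *m A h (p t)]scale1r.
  apply: (is_derive_scalemx (is_derive_id t 1)).
  apply: (is_derive_mulmx (dy t t01)).
  apply: is_derive_line; apply: diff_derivable.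
  by have [+ _] := A_C2 h; apply; exact: rU (pball t t01).
have E0 : E 0 = 0 by rewrite /E y0E z0E subrr scale0r subrr.
have key (t : R) : 0 <= t <= 1 ->
    E' t = E t *m A (xi + h) (q t) + y t *m (
      (A xi (p t + t *: h) - A xi (p t) - 'D_(t *: h) (A xi) (p t)) +
      (A h (p t + t *: h) - A h (p t)) +
      t *: (A h (p t) *m (A xi (p t + t *: h) - A xi (p t) +
                          A h (p t + t *: h)))).
  move=> t01; have Up := rU (pball t t01); have Uq := rU (qball t t01).
  have dA : differentiable (A xi) (p t) by have [+ _] := A_C2 xi; apply.
  have DL : 'D_(t *: h) (A xi) (p t) = t *: 'D_h (A xi) (p t).
    by rewrite !(deriveE _ dA) linearZ.
  have AL : A (xi + h) (q t) = A xi (q t) + A h (q t).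
    by have := A_linear Uq 1 xi h; rewrite !scale1r.
  rewrite DL -qE.
  (* Flatness trades the derivative of [A h] along the ray for the transverse derivative of [A xi],
     which is the first-order term of [A xi (q t) - A xi (p t)]. Only terms quadratic in [h] survive
     besides [E t *m A (xi + h) (q t)]. *)
  have F : 'D_xi (A h) (p t) = 'D_h (A xi) (p t) + A h (p t) *m A xi (p t)
      - A xi (p t) *m A h (p t).
    have := A_flat h xi Up; set X := 'D_h _ _; set Y := 'D_xi _ _.
    move/eqP; rewrite subr_eq0 addrAC subr_eq => /eqP ->.
    by rewrite addrAC subrr add0r.
  rewrite /E' /E /D F AL.
  mx_ring.
have E'E (t : R) : 0 <= t <= 1 ->
    `|E' t| <= `|E t| / 2 + N%:R * (2 * `|y0|) * K * (`|h| * `|h|).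
  move=> t01; have [t0 t1] := andP t01; rewrite key //.
  apply: le_trans (ler_normD _ _) _; apply: lerD.
    exact: ray_mulmx rhor small xihr t01.
  apply: le_trans (mx_norm_mulmx _ _) _.
  rewrite -!mulrA ler_wpM2l // mulrA ler_pM //.
    exact: ray_solution_bound rhor small xir (conj y0E dy) t01.
  have th : `|t *: h| <= `|h|.
    by rewrite normrZ (ger0_norm t0) -[leRHS]mul1r ler_wpM2r.
  have xh (c c' : R) : 0 <= c -> c' <= c -> c' * `|xi| <= c.
    move=> c0 cc; rewrite -[leRHS]mulr1; apply: le_trans (_ : c * `|xi| <= _).
      by rewrite ler_wpM2r.
    by rewrite ler_wpM2l.
  have I1 := connection_increment xi (fun a => @seg t a t01).
  have I2 := connection_increment h (fun a => @seg t a t01).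
  have I3 := connection_taylor xi (fun a => @seg t a t01).
  have [I4 _ _] := bounds (pball t t01); have {}I4 := I4 h.
  have [I5 _ _] := bounds (qball t t01); have {}I5 := I5 h; rewrite qE in I5.
  have I6 := mx_norm_mulmx (A h (p t)) (A xi (p t + t *: h) - A xi (p t) +
                          A h (p t + t *: h)).
  have Bx : B * `|xi| <= B by exact: xh.
  have J1 : `|A xi (p t + t *: h) - A xi (p t)| <= B * `|h|.
    by apply: le_trans I1 _; apply: ler_pM => //; rewrite mulr_ge0.
  have J3 : `|A xi (p t + t *: h) - A xi (p t) - 'D_(t *: h) (A xi) (p t)| <=
      B * (`|h| * `|h|).
    apply: le_trans I3 _; rewrite mulrA.
    by do 2!(apply: ler_pM => //; rewrite ?mulr_ge0 //).
  have J2 : `|A h (p t + t *: h) - A h (p t)| <= B * (`|h| * `|h|).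
    by apply: le_trans I2 _; rewrite mulrA ler_wpM2l // mulr_ge0.
  have J4 : `|A xi (p t + t *: h) - A xi (p t) + A h (p t + t *: h)| <=
      2 * B * `|h|.
    apply: le_trans (ler_normD _ _) _; apply: le_trans (lerD J1 I5) _.
    by rewrite -mulrA mulr_natl mulr2n.
  have J6 : `|t *: (A h (p t) *m (A xi (p t + t *: h) - A xi (p t) +
               A h (p t + t *: h)))| <= 2 * N%:R * B * B * (`|h| * `|h|).
    rewrite normrZ (ger0_norm t0) -[leRHS]mul1r ler_pM //.
    apply: le_trans I6 _.
    rewrite (_ : 2 * _ * _ * _ * _ = N%:R * (B * `|h| * (2 * B * `|h|)));
      last by ring.
    by rewrite ler_wpM2l // ler_pM.
  apply: le_trans (ler_normD _ _) _.
  apply: le_trans (lerD (le_trans (ler_normD _ _) (lerD J3 J2)) J6) _.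
  by rewrite /K le_eqVlt; apply/orP; left; apply/eqP; ring.
have := gronwall_unit E0 dE E'E (t := 1); rewrite /E /p !scale1r.
by rewrite lexx ler01 !mulrA; exact.
Qed.

End Estimates.

Lemma quadratic_differentiable (V W : normedModType R) (f : V -> W)
    (L : {linear V -> W}) (x : V) (C rho : R) :
  continuous L -> 0 < rho ->
  (forall h, `|h| < rho -> `|f (x + h) - f x - L h| <= C * (`|h| * `|h|)) ->
  differentiable f x /\ 'd f x = L :> (V -> W).
Proof.
move=> cL rho0 H.
have e : f \o shift x = cst (f x) + L +o_ 0 id.
  apply/eqaddoP => _/posnumP[eps].
  pose s := Num.min rho (eps%:num / (`|C| + 1)).
  have C1 : 0 < `|C| + 1 by rewrite ltr_wpDl.
  have s0 : 0 < s by rewrite lt_min rho0 divr_gt0.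
  have ns : \forall h \near (0 : V), `|h| < s.
    by apply: filterS (nbhsx_ballx (0 : V) _ s0) => h; rewrite -ball_normE /= sub0r normrN.
  apply: filterS ns => h; rewrite lt_min => /andP[h1 h2].
  rewrite /= !fctE /= [h + x]addrC opprD addrA.
  apply: le_trans (H h h1) _; rewrite mulrA ler_wpM2r //.
  apply: le_trans (_ : `|C| * `|h| <= _); first by rewrite ler_wpM2r // ler_norm.
  rewrite ltr_pdivlMr // in h2; apply: le_trans (ltW h2); rewrite mulrC.
  by rewrite ler_wpM2l // lerDl.
have dL := diff_unique cL e.
by split=> //; apply/diff_locallyP; rewrite dL; split.
Qed.

(** [Y x] is the value at time 1 of the solution along the ray from [x0] to [x]. The increment
    estimate, applied around every [x] of the ball and not only around [x0], gives the full
    derivative. *)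
Lemma parallel_section (x0 : 'rV[R]_d) (y0 : 'rV[R]_N) : U x0 ->
  exists (Y : 'rV[R]_d -> 'rV[R]_N) (W : set 'rV[R]_d),
    [/\ open W, W x0, W `<=` U, Y x0 = y0 & forall x, W x ->
      differentiable Y x /\ forall v, 'D_v Y x = Y x *m A v x].
Proof.
move=> Ux0; have [B [r [B0 r0 rU bounds]]] := connection_bounds Ux0.
have NB : 0 < 2 * N%:R * B + 1 by rewrite ltr_wpDl // !mulr_ge0.
(* The last term ensures N B rho <= 1/2, the contraction condition; the [+ 1] keeps the denominator
   positive when N B = 0. *)
pose rho := Num.min (Num.min r 1) (2 * N%:R * B + 1)^-1.
have rho0 : 0 < rho by rewrite !lt_min r0 ltr01 invr_gt0.
have rhor : rho <= r by rewrite !ge_min lexx.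
have rho1 : rho <= 1 by rewrite !ge_min lexx orbT.
have small : N%:R * (B * rho) <= 2^-1.
  have h1 : (2 * N%:R * B + 1) * rho <= 1.
    by rewrite -ler_pdivlMl // mulr1 ge_min lexx orbT.
  have h2 : 2 * (N%:R * (B * rho)) = (2 * N%:R * B + 1) * rho - rho by ring.
  by have := ltW rho0; lra.
have ex xi : {y : R -> 'rV[R]_N | `|xi| < rho -> ray_solution x0 y0 xi y}.
  apply: cid; have [h|h] := ltP `|xi| rho; last by exists (fun=> 0).
  by have [y Hy] := ray_solution_exists B0 rU bounds y0 rhor small h; exists y.
pose Y x := sval (ex (x - x0)) 1.
exists Y, (ball x0 rho); split.
- exact: ball_open.
- exact: ballxx.
- by apply: subset_trans rU; exact: le_ball.
- rewrite /Y subrr; have n0 : `|0 : 'rV[R]_d| < rho by rewrite normr0.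
  have [y0E dy] := svalP (ex 0) n0.
  apply/eqP; rewrite -subr_eq0 -normr_le0.
  have -> : 0 = 2 * 0 :> R by rewrite mulr0.
  apply: (@gronwall_unit _ _ (fun t => sval (ex 0) t - y0)
    (fun t => sval (ex 0) t *m A 0 (x0 + t *: 0) - 0)).
  + by rewrite y0E subrr.
  + by move=> s s01; exact: is_deriveB (dy s s01) (is_derive_cst y0 s 1).
  + move=> s s01; have := A_linear (x := x0 + s *: 0).
    rewrite scaler0 addr0 => /(_ Ux0) l0.
    have -> : A 0 x0 = 0 by have := l0 (-1) 0 0; rewrite scaler0 addr0 scaleN1r addNr.
    by rewrite mulmx0 subrr normr0 addr0 divr_ge0.
  + by rewrite lexx ler01.
- move=> x; rewrite -ball_normE /= distrC => xr.
  have Hx : x0 + (x - x0) = x by rewrite addrC subrK.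
  have Ux : U x.
    apply: rU; rewrite -ball_normE /= distrC; exact: lt_le_trans xr rhor.
  have lin : linear (fun v => Y x *m A v x).
    by move=> c u v; rewrite (A_linear Ux) mulmxDr -scalemxAr.
  pose L : {linear _ -> _} := HB.pack (fun v => Y x *m A v x)
    (GRing.isLinear.Build _ _ _ _ (fun v => Y x *m A v x) lin).
  have cL : continuous L by exact: linear_mx_continuous.
  have rho1' : 0 < rho - `|x - x0| by rewrite subr_gt0.
  have H h : `|h| < rho - `|x - x0| -> `|Y (x + h) - Y x - L h| <=
      2 * (N%:R * (2 * `|y0|) * (2 * B + 2 * N%:R * B * B)) * (`|h| * `|h|).
    rewrite ltrBrDl => hr.
    have xhr : `|x - x0 + h| < rho by exact: le_lt_trans (ler_normD _ _) hr.
    have := ray_solution_increment B0 rU bounds rhor rho1 small xr xhr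
      (svalP (ex (x - x0)) xr) (svalP (ex (x - x0 + h)) xhr).
    by rewrite Hx /Y /L /= [x + h - x0]addrAC.
  have [dY dE] := quadratic_differentiable cL rho1' H.
  by split=> // v; rewrite (deriveE _ dY) dE.
Qed.

End ParallelSections.

(** * The Levi-Civita connection in coordinates *)

Section Forms.
Variables (R : realType) (n : nat).
Implicit Types (A B : 'M[R]_n) (u v w : 'rV[R]_n).

Lemma mx11_eq (A B : 'M[R]_1) : A 0 0 = B 0 0 -> A = B.
Proof. by move=> E; rewrite [A]mx11_scalar [B]mx11_scalar E. Qed.

Lemma row_form_eq p q (A B : 'M[R]_(p, q)) :
  (forall v : 'rV[R]_p, v *m A = v *m B) -> A = B.
Proof. by move=> E; apply/row_matrixP => i; rewrite !rowE. Qed.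

Lemma form_eq p q (A B : 'M[R]_(p, q)) :
  (forall (v : 'rV_p) (w : 'rV_q), v *m A *m w^T = v *m B *m w^T) -> A = B.
Proof.
move=> E; apply: row_form_eq => v; apply: trmx_inj; apply: row_form_eq => w.
by apply: trmx_inj; rewrite !trmx_mul !trmxK E.
Qed.

Lemma inner_basis A i j : inner A (basis_vec R i) (basis_vec R j) = A i j.
Proof. by rewrite /inner /basis_vec -rowE trmx_delta -colE !mxE. Qed.

Lemma inner_basisr A v j : inner A v (basis_vec R j) = (v *m A) 0 j.
Proof. by rewrite /inner /basis_vec trmx_delta -colE mxE. Qed.

Lemma inner_linearl A a u v w :
  inner A (a *: u + v) w = a * inner A u w + inner A v w.
Proof. by rewrite /inner !mulmxDl -!scalemxAl !mxE. Qed.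

Lemma inner_linearr A a u v w :
  inner A u (a *: v + w) = a * inner A u v + inner A u w.
Proof. by rewrite /inner linearP mulmxDr -!scalemxAr !mxE. Qed.

Lemma inner_linear_mx a A B u v :
  inner (a *: A + B) u v = a * inner A u v + inner B u v.
Proof. by rewrite /inner mulmxDr mulmxDl -scalemxAr -scalemxAl !mxE. Qed.

Lemma skew_inner G A v w : G^T = G -> A *m G + G *m A^T = 0 ->
  inner G (v *m A) w = - inner G (w *m A) v.
Proof.
move=> Gs E; apply/eqP; rewrite -addr_eq0 [X in _ + X]inner_sym //.
suff -> : inner G (v *m A) w + inner G v (w *m A) =
          inner (A *m G + G *m A^T) v w.
  by rewrite E /inner mulmx0 mul0mx mxE.
by rewrite /inner trmx_mul mulmxDr mulmxDl !mulmxA [RHS]mxE.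
Qed.

Lemma inner_nondegenerate G v : G \in unitmx ->
  (forall w, inner G v w = 0) -> v = 0.
Proof.
move=> Gu E; rewrite -(mulmxK Gu v) (_ : v *m G = 0) ?mul0mx //.
by apply/rowP => j; rewrite -inner_basisr E mxE.
Qed.

Lemma inner_inj A B : (forall v w, inner A v w = inner B v w) -> A = B.
Proof. by move=> E; apply: form_eq => v w; apply: mx11_eq; exact: E. Qed.

End Forms.

Lemma linear_at0 (R : pzRingType) (V W : lmodType R) (f : V -> W) :
  linear f -> f 0 = 0.
Proof.
move=> /(_ 1 0 0); rewrite !scale1r addr0 => E.
by apply: (addrI (f 0)); rewrite addr0 -E.
Qed.

(** Alternating three swaps of each kind yields the identity permutation, while the three skew ones
    reverse the sign. *)
Lemma sym_skew_eq0 (R : realFieldType) (T : Type) (t : T -> T -> T -> R) :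
  (forall u v w, t u v w = t v u w) -> (forall u v w, t u v w = - t u w v) ->
  forall u v w, t u v w = 0.
Proof.
move=> t_sym t_anti u v w.
have := t_anti u v w; have := t_sym u w v; have := t_anti w u v.
have := t_sym w v u; have := t_anti v w u; have := t_sym v u w.
move: (t u v w) (t u w v) (t w u v) (t w v u) (t v w u) (t v u w) => *.
lra.
Qed.

Lemma trmxD (R : pzRingType) p q (A B : 'M[R]_(p, q)) :
  (A + B)^T = A^T + B^T.
Proof. exact: linearD. Qed.

Lemma trmxB (R : pzRingType) p q (A B : 'M[R]_(p, q)) :
  (A - B)^T = A^T - B^T.
Proof. exact: linearB. Qed.

Lemma trmxN (R : pzRingType) p q (A : 'M[R]_(p, q)) : (- A)^T = - A^T.
Proof. exact: linearN. Qed.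

Lemma trmxZ (R : pzRingType) p q c (A : 'M[R]_(p, q)) : (c *: A)^T = c *: A^T.
Proof. exact: linearZ. Qed.

Record metric_on (R : realType) (n : nat) (U : set 'rV[R]_n)
    (g : 'rV[R]_n -> 'M[R]_n) : Prop := MetricOn {
  metric_open : open U;
  metric_smooth : smooth U g;
  metric_sym : forall x, U x -> (g x)^T = g x;
  metric_unit : forall x, U x -> g x \in unitmx }.

Definition connection_mx (R : realType) (n : nat) (g : 'rV[R]_n -> 'M[R]_n)
    (v x : 'rV[R]_n) : 'M[R]_n :=
  \matrix_i christoffel g x v (basis_vec R i).

(** To be read with [A], [B] the derivatives D_u Gam_v, D_v Gam_u and [C], [D] the matrices Gam_u,
    Gam_v. The products are reversed because matrices act on rows from the right. This is the
    curvature [nabla_u, nabla_v], opposite to the convention for [riem]; hence the minus sign in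
    [riemE]. *)
Definition curvature_alg (R : realType) (n : nat) (A B C D : 'M[R]_n) :
  'M[R]_n := A - B + D *m C - C *m D.

Lemma inner_curvature_alg (R : realType) (n : nat) (A B C D G : 'M[R]_n)
    (z w : 'rV[R]_n) :
  inner G (0 - (z *m A + z *m D *m C - (z *m B + z *m C *m D))) w =
  - inner (curvature_alg A B C D *m G) z w.
Proof.
rewrite /curvature_alg /inner; set Y := (_ *m w^T in RHS).
suff -> : (0 - (z *m A + z *m D *m C - (z *m B + z *m C *m D))) *m G *m w^T = - Y.
  by rewrite mxE.
by rewrite /Y; mx_ring.
Qed.

Definition curvature_mx (R : realType) (n : nat) (g : 'rV[R]_n -> 'M[R]_n)
    (u v x : 'rV[R]_n) : 'M[R]_n :=
  curvature_alg ('D_u (connection_mx g v) x) ('D_v (connection_mx g u) x)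
    (connection_mx g u x) (connection_mx g v x).

Section LocalConnection.
Variables (R : realType) (n : nat) (U : set 'rV[R]_n).
Variable g : 'rV[R]_n -> 'M[R]_n.
Hypothesis gU : metric_on U g.
Implicit Types (x u v w z : 'rV[R]_n).
Local Notation Gam := (connection_mx g).

Let U_open := metric_open gU.

Lemma metric_differentiable x : U x -> differentiable g x.
Proof. by have [+ _] := metric_smooth gU 1%N; apply. Qed.

Lemma metric_sym_near x : U x -> \near x, (g x)^T = g x.
Proof. by move=> Ux; apply: open_near U_open Ux (metric_sym gU). Qed.

Lemma derive_inner x u v w : U x ->
  'D_u (fun y => inner (g y) v w) x = inner ('D_u g x) v w.
Proof.
move=> Ux; have lin : linear (fun A : 'M[R]_n => inner A v w : R).
  move=> a A A'; rewrite /inner mulmxDr mulmxDl -scalemxAr -scalemxAl.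
  by rewrite !mxE.
pose L : {linear _ -> _} := HB.pack (fun A : 'M[R]_n => inner A v w : R)
  (GRing.isLinear.Build _ _ _ _ _ lin).
have cL : continuous L by exact: linear_mx_continuous.
exact (derive_lin u cL (metric_differentiable Ux)).
Qed.

Lemma koszulE x u v w : U x -> koszul g x u v w =
  inner ('D_u g x) v w + inner ('D_v g x) u w - inner ('D_w g x) u v.
Proof. by move=> Ux; rewrite /koszul !derive_inner. Qed.

Lemma christoffel_linear x u : U x -> linear (christoffel g x u).
Proof.
move=> Ux.
suff H (a : R) (v w : 'rV[R]_n) : christoffel g x u (a *: v + w) =
  a *: christoffel g x u v + christoffel g x u w by exact: H.
rewrite /christoffel /sharp scalemxAl -mulmxDl.
congr (_ *m _); apply/rowP => j; rewrite !mxE !koszulE //.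
have -> : 'D_(a *: v + w) g x = a *: 'D_v g x + 'D_w g x.
  exact (derive_linear (metric_differentiable Ux) a v w).
move: ('D_u g x) ('D_v g x) ('D_w g x) ('D_(basis_vec R j) g x) => A B C D.
by rewrite inner_linearl inner_linearr inner_linear_mx; ring.
Qed.

Lemma christoffelE x u v : U x -> christoffel g x u v = v *m Gam u x.
Proof.
move=> Ux; rewrite (linear_row_scale v (christoffel_linear u Ux)).
rewrite mulmx_sum_row; apply: eq_bigr => i _.
by congr (_ *: _); apply/rowP => j; rewrite !mxE.
Qed.

(** The explicit formula in the derivatives of [g], from which smoothness of the connection can be
    read off. *)
Lemma connection_mxE x u : U x -> Gam u x =
  (\matrix_(i, j) (2^-1 * (('D_u g x) i j +
     (u *m 'D_(basis_vec R i) g x) 0 j - (u *m 'D_(basis_vec R j) g x) 0 i)))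
  *m invmx (g x).
Proof.
move=> Ux.
have K i k : koszul g x u (basis_vec R i) (basis_vec R k) = ('D_u g x) i k +
   (u *m 'D_(basis_vec R i) g x) 0 k - (u *m 'D_(basis_vec R k) g x) 0 i.
  rewrite koszulE //.
  move: ('D_u g x) ('D_(basis_vec R i) g x) ('D_(basis_vec R k) g x) => A B C.
  by rewrite inner_basis !inner_basisr.
apply/row_matrixP => i; rewrite row_mul rowK /christoffel /sharp.
congr (_ *m _); apply/rowP => k.
transitivity (2^-1 * koszul g x u (basis_vec R i) (basis_vec R k)).
  exact: mxE.
rewrite K; symmetry; apply: etrans (mxE _ _ _ _) _; exact: mxE.
Qed.

Lemma connection_smooth u : smooth U (Gam u).
Proof.
move=> k; pose H x := (\matrix_(i, j) (2^-1 * (('D_u g x) i j +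
     (u *m 'D_(basis_vec R i) g x) 0 j - (u *m 'D_(basis_vec R j) g x) 0 i)))
  *m invmx (g x).
suff : Ck k U H.
  by apply: (Ck_ext U_open) => x Ux; apply: esym; exact: connection_mxE.
have Cg v : Ck k U (fun x => 'D_v g x).
  by have [_] := metric_smooth gU k.+1; apply.
apply: Ck_mulmx => //; last first.
  by apply: Ck_invmx => //; [exact: metric_unit gU|exact: metric_smooth gU k].
apply: Ck_mx => // i j; under eq_fun do rewrite mxE.
apply: (CkZ _ U_open); apply: CkB => //.
  apply: CkD => //; first exact (Ck_coord i j U_open (Cg u)).
  apply: (Ck_coord 0 j U_open).
  by apply: Ck_mulmx => //; exact: Ck_cst.
apply: (Ck_coord 0 i U_open).
by apply: Ck_mulmx => //; exact: Ck_cst.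
Qed.

Lemma connection_metric x u : U x ->
  'D_u g x = Gam u x *m g x + g x *m (Gam u x)^T.
Proof.
move=> Ux; apply: inner_inj => v w; rewrite -derive_inner //.
rewrite -(christoffel_metric (metric_differentiable Ux) (metric_sym_near Ux)
  (metric_unit gU Ux)) !christoffelE //.
move: (Gam u x) (g x) => A G.
by rewrite /inner trmx_mul !mulmxDr !mulmxDl !mulmxA [RHS]mxE.
Qed.

Lemma connection_sym x u v : U x -> v *m Gam u x = u *m Gam v x.
Proof.
move=> Ux; rewrite -(christoffelE u v Ux) -(christoffelE v u Ux).
have : ('D_u (cst v) x + christoffel g x u v) -
       ('D_v (cst u) x + christoffel g x v u) =
       'D_u (cst v) x - 'D_v (cst u) x.
  exact (nabla_torsion_free (metric_sym_near Ux) (cst u) (cst v)).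
rewrite (derive_cst v) (derive_cst u).
move: (christoffel g x u v) (christoffel g x v u) => A B.
by rewrite subr0 !add0r => /eqP; rewrite subr_eq0 => /eqP.
Qed.

Lemma connection_linear x : U x -> linear (Gam^~ x).
Proof.
move=> Ux; suff H (a : R) (u v : 'rV[R]_n) :
  Gam (a *: u + v) x = a *: Gam u x + Gam v x by exact: H.
apply: row_form_eq => w; rewrite (connection_sym _ w Ux) mulmxDl -scalemxAl.
by rewrite mulmxDr -scalemxAr (connection_sym u w Ux) (connection_sym v w Ux).
Qed.

(** The difference of two metric torsion-free connections, with its last index lowered, is symmetric
    in one pair of arguments and skew in another, hence zero. All later identifications of a
    connection go through this. *)
Lemma connection_unique x (S : 'rV[R]_n -> 'M[R]_n) : U x ->
  (forall u, 'D_u g x = S u *m g x + g x *m (S u)^T) ->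
  (forall u v, v *m S u = u *m S v) ->
  forall u, S u = Gam u x.
Proof.
move=> Ux S_metric S_sym.
pose t u v w := inner (g x) (v *m (S u - Gam u x)) w.
have t_sym u v w : t u v w = t v u w.
  by rewrite /t !mulmxBr S_sym connection_sym.
have t_anti u v w : t u v w = - t u w v.
  apply: skew_inner (metric_sym gU Ux) _.
  have K (A B G D : 'M[R]_n) : D = A *m G + G *m A^T -> D = B *m G + G *m B^T ->
      (A - B) *m G + G *m (A - B)^T = 0.
    by move=> DA DB; rewrite trmxB mulmxBl mulmxBr addrACA -opprD -DA -DB subrr.
  exact: K (S_metric u) (connection_metric u Ux).
have t0 := sym_skew_eq0 t_sym t_anti.
move=> u; apply/eqP; rewrite -subr_eq0; apply/eqP; apply: row_form_eq => v.
rewrite mulmx0; apply: inner_nondegenerate (metric_unit gU Ux) _ => w.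
exact: t0.
Qed.

Lemma connection_differentiable x u : U x -> differentiable (Gam u) x.
Proof. by have [+ _] := connection_smooth u 1%N; apply. Qed.

Lemma riemE x u v z w : U x ->
  riem g x u v z w = - inner (curvature_mx g u v x *m g x) z w.
Proof.
move=> Ux; rewrite /riem /curvature_op.
have -> : nabla g (lie_bracket (cst u) (cst v)) (cst z) x = 0.
  rewrite /nabla /lie_bracket !derive_cst subrr christoffelE // add0r.
  by rewrite (linear_at0 (connection_linear Ux)) mulmx0.
have N p q : nabla g (cst p) (nabla g (cst q) (cst z)) x =
    z *m 'D_p (Gam q) x + z *m Gam q x *m Gam p x.
  rewrite {1}/nabla; have Ey : \near x, nabla g (cst q) (cst z) x = z *m Gam q x.
    apply: open_near U_open Ux _ => y Uy.
    by rewrite /nabla derive_cst add0r christoffelE.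
  rewrite (near_eq_derive _ Ey) (nbhs_singleton Ey) christoffelE //.
  have dq := derivableP (diff_derivable (v := p) (connection_differentiable q Ux)).
  have [_ ->] := is_derive_mulmx (is_derive_cst z x p) dq.
  by rewrite mul0mx add0r.
rewrite !N; exact: inner_curvature_alg.
Qed.

End LocalConnection.

(** * Conformal changes of the metric *)

Section ConformalAlgebra.
Variables (R : realType) (n : nat).
Variables (G Gi : 'M[R]_n) (a : 'rV[R]_n).
Hypotheses (G_sym : G^T = G) (GiG : Gi *m G = 1%:M) (GGi : G *m Gi = 1%:M).
Implicit Types (u v h : 'rV[R]_n) (C : 'M[R]_n).

(** The difference of the Levi-Civita connections of exp(2s) g and g when [a] is the differential of
    s. Acting on w it gives a(v) w + a(w) v - g(w, v) a#, where a# is [a *m Gi]. *)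
Definition conformal_shift v : 'M[R]_n :=
  (v *m a^T) 0 0 *: 1%:M + a^T *m v - G *m v^T *m a *m Gi.

(* The derivative of [conformal_shift v] in a direction in which [a], [G] and
   [Gi] have derivatives [h], [C *m G + G *m C^T] and [- Gi *m C - C^T *m Gi]. *)
Definition conformal_shift_derive h C v : 'M[R]_n :=
  (v *m h^T) 0 0 *: 1%:M + h^T *m v
  - ((C *m G + G *m C^T) *m v^T *m a *m Gi + G *m v^T *m h *m Gi
     + G *m v^T *m a *m (- Gi *m C - C^T *m Gi)).

(** With [h] the derivative of [a] along [u] and [C] the connection matrix, this is nabla_u a - a(u)
    a + |a|^2 g(u, .) / 2, the tensor by which the Schouten tensor drops under the conformal
    change. *)
Definition conformal_hessian h C u : 'rV[R]_n :=
  h - a *m C^T - (u *m a^T) 0 0 *: a + (2^-1 * (a *m Gi *m a^T) 0 0) *: (u *m G).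

(** A Kulkarni-Nomizu product with the metric, written as an endomorphism: [r] and [s] stand for the
    covectors assigned to [u] and [v], and the last index is raised by [Gi]. *)
Definition kn_mx (r s : 'rV[R]_n) u v : 'M[R]_n :=
  r^T *m v - s^T *m u - G *m v^T *m r *m Gi + G *m u^T *m s *m Gi.

Lemma conformal_shift_covariant h C v :
  conformal_shift_derive h C v + conformal_shift v *m C - C *m conformal_shift v
  = (v *m h^T) 0 0 *: 1%:M + (h - a *m C^T)^T *m v + a^T *m (v *m C)
    - G *m (v *m C)^T *m a *m Gi - G *m v^T *m (h - a *m C^T) *m Gi.
Proof.
rewrite /conformal_shift_derive /conformal_shift.
move: ((v *m h^T) 0 0) ((v *m a^T) 0 0) => s t.
rewrite trmxB !trmx_mul ?trmxK.
rewrite !(mulmxDl, mulmxDr, mulNmx, mulmxN) -!scalemxAl -!scalemxAr mul1mx mulmx1.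
mx_ring.
Qed.

Lemma row_col_sym u v : (u *m v^T) 0 0 = (v *m u^T) 0 0.
Proof. by rewrite -[v in RHS]trmxK -trmx_mul [RHS]mxE. Qed.

Lemma mulmx_row_col u v p (Y : 'M[R]_(p, 1)) :
  Y *m u *m v^T = (u *m v^T) 0 0 *: Y.
Proof. by rewrite -mulmxA {1}[u *m v^T]mx11_scalar mul_mx_scalar. Qed.

Lemma conformal_shift_sym u v :
  u *m conformal_shift v = v *m conformal_shift u.
Proof.
have K x y : x *m conformal_shift y = (y *m a^T) 0 0 *: x
    + (x *m a^T) 0 0 *: y - (x *m G *m y^T) 0 0 *: (a *m Gi).
  rewrite /conformal_shift mulmxBr mulmxDr -scalemxAr mulmx1 !mulmxA.
  by rewrite {1}[x *m a^T]mx11_scalar {1}[x *m G *m y^T]mx11_scalar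
    !mul_scalar_mx scalemxAl.
rewrite !K -[(v *m G *m u^T) 0 0]/(inner G v u) inner_sym //.
by rewrite [X in X - _]addrC.
Qed.

Lemma conformal_shift_commutator u v :
  conformal_shift v *m conformal_shift u - conformal_shift u *m conformal_shift v
  = (v *m a^T) 0 0 *: (a^T *m u) - (u *m a^T) 0 0 *: (a^T *m v)
    - (a *m Gi *m a^T) 0 0 *: (G *m v^T *m u - G *m u^T *m v)
    + (u *m a^T) 0 0 *: (G *m v^T *m a *m Gi)
    - (v *m a^T) 0 0 *: (G *m u^T *m a *m Gi).
Proof.
have K x y : (a^T *m x - G *m x^T *m a *m Gi) *m (a^T *m y - G *m y^T *m a *m Gi)
   = (x *m a^T) 0 0 *: (a^T *m y) - (x *m G *m y^T) 0 0 *: (a^T *m a *m Gi)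
     - (a *m Gi *m a^T) 0 0 *: (G *m x^T *m y)
     + (y *m a^T) 0 0 *: (G *m x^T *m a *m Gi).
  rewrite mulmxDl !mulmxDr !mulmxN !mulNmx opprK !mulmxA.
  have E1 : a^T *m x *m a^T *m y = (x *m a^T) 0 0 *: (a^T *m y).
    by rewrite mulmx_row_col -!scalemxAl.
  have E2 : a^T *m x *m G *m y^T *m a *m Gi =
      (x *m G *m y^T) 0 0 *: (a^T *m a *m Gi).
    by rewrite -(mulmxA a^T x G) mulmx_row_col -!scalemxAl.
  have E3 : G *m x^T *m a *m Gi *m a^T *m y =
      (a *m Gi *m a^T) 0 0 *: (G *m x^T *m y).
    by rewrite -(mulmxA _ a Gi) mulmx_row_col -!scalemxAl.
  have E4 : G *m x^T *m a *m Gi *m G *m y^T *m a *m Gi =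
      (y *m a^T) 0 0 *: (G *m x^T *m a *m Gi).
    rewrite -(mulmxA _ Gi G) GiG mulmx1 mulmx_row_col -!scalemxAl.
    by rewrite (row_col_sym a y).
  by rewrite E1 E2 E3 E4; mx_ring.
have S v' u' : conformal_shift v' *m conformal_shift u' =
  (v' *m a^T) 0 0 *: ((u' *m a^T) 0 0 *: 1%:M + a^T *m u' - G *m u'^T *m a *m Gi)
  + (u' *m a^T) 0 0 *: (a^T *m v' - G *m v'^T *m a *m Gi)
  + (a^T *m v' - G *m v'^T *m a *m Gi) *m (a^T *m u' - G *m u'^T *m a *m Gi).
  rewrite /conformal_shift; move: ((v' *m a^T) 0 0) ((u' *m a^T) 0 0) => s t.
  rewrite -!addrA; move: (a^T *m v' - _) (a^T *m u' - _) => X Y.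
  rewrite mulmxDl !mulmxDr -!scalemxAl -!scalemxAr !mul1mx !mulmx1.
  by mx_ring.
rewrite !S !K.
have -> : (u *m G *m v^T) 0 0 = (v *m G *m u^T) 0 0 by exact: inner_sym.
move: ((v *m a^T) 0 0) ((u *m a^T) 0 0) ((v *m G *m u^T) 0 0)
  ((a *m Gi *m a^T) 0 0) => p q r s.
by mx_ring.
Qed.

(** Changing the connection by S changes its curvature by the exterior covariant derivative of S
    plus a commutator. The first two hypotheses, torsion-freeness and closedness of [a], let the
    three auxiliary identities assemble into conformal Hessians. *)
Lemma conformal_curvature_algebra u v hu hv Cu Cv (P Q : 'M[R]_n) :
  v *m Cu = u *m Cv -> (v *m hu^T) 0 0 = (u *m hv^T) 0 0 ->
  (P + conformal_shift_derive hu Cu v) - (Q + conformal_shift_derive hv Cv u)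
  + (Cv + conformal_shift v) *m (Cu + conformal_shift u)
  - (Cu + conformal_shift u) *m (Cv + conformal_shift v) =
  P - Q + Cv *m Cu - Cu *m Cv +
  kn_mx (conformal_hessian hu Cu u) (conformal_hessian hv Cv v) u v.
Proof.
move=> vC vh.
have E1 := conformal_shift_covariant hu Cu v.
have E2 := conformal_shift_covariant hv Cv u.
have E3 := conformal_shift_commutator u v.
rewrite /kn_mx /conformal_hessian.
move: (hu - a *m Cu^T) (hv - a *m Cv^T) E1 E2 E3 => Hu Hv.
rewrite vC vh; move: (conformal_shift_derive hu Cu v) => Du.
move: (conformal_shift_derive hv Cv u) => Dv.
move: (conformal_shift v) (conformal_shift u) => Sv Su E1 E2 E3.
have -> : P + Du - (Q + Dv) + (Cv + Sv) *m (Cu + Su) - (Cu + Su) *m (Cv + Sv) =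
  P - Q + Cv *m Cu - Cu *m Cv + (Du + Sv *m Cu - Cu *m Sv)
  - (Dv + Su *m Cv - Cv *m Su) + (Sv *m Su - Su *m Sv) by mx_ring.
rewrite E1 E2 E3 !(trmxD, trmxN, trmxZ) !trmx_mul G_sym.
move: ((v *m a^T) 0 0) ((u *m a^T) 0 0) ((u *m hv^T) 0 0)
  ((a *m Gi *m a^T) 0 0) => p q r s.
have K p0 (X : 'M[R]_(p0, n)) : X *m G *m Gi = X by rewrite -mulmxA GGi mulmx1.
repeat progress expand_mx; rewrite !K.
move: (Cv *m Cu) (Cu *m Cv) => X Y.
mx_field.
Qed.

End ConformalAlgebra.

Section ConformalChange.
Variables (R : realType) (n : nat) (U : set 'rV[R]_n).
Variables (g : 'rV[R]_n -> 'M[R]_n) (phi : 'rV[R]_n -> R).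
Variable (a : 'rV[R]_n -> 'rV[R]_n).
Hypotheses (gU : metric_on U g) (phi_smooth : smooth U phi).
Hypotheses (phi_gt0 : forall x, U x -> 0 < phi x) (a_smooth : smooth U a).
Hypothesis (phi_derive : forall x v, U x ->
  'D_v phi x = 2 * phi x * (v *m (a x)^T) 0 0).
Implicit Types (x u v w z : 'rV[R]_n).

Let U_open := metric_open gU.

Definition conformal_metric x : 'M[R]_n := phi x *: g x.

Lemma conformal_metric_on : metric_on U conformal_metric.
Proof.
split=> // [k|x Ux|x Ux].
- by apply: Ck_scalemx => //; exact: metric_smooth gU k.
- by rewrite /conformal_metric linearZ /= (metric_sym gU Ux).
- rewrite /conformal_metric unitmxZ ?(metric_unit gU Ux) // unitfE gt_eqF //.
  exact: phi_gt0.
Qed.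

Lemma is_derive_smooth p q (F : 'rV[R]_n -> 'M[R]_(p, q)) x u :
  smooth U F -> U x -> is_derive x u F ('D_u F x).
Proof. by move=> /(_ 1%N)[dF _] /dF/diff_derivable/derivableP; apply. Qed.

Lemma is_derive_metric x u : U x -> is_derive x u g
  (connection_mx g u x *m g x + g x *m (connection_mx g u x)^T).
Proof.
move=> Ux; rewrite -(connection_metric gU u Ux).
by apply: is_derive_smooth => //; exact: metric_smooth gU.
Qed.

(** Obtained by differentiating g^-1 g = 1, once the inverse is known to be smooth. *)
Lemma is_derive_metric_inv x u : U x -> is_derive x u (fun y => invmx (g y))
  (- invmx (g x) *m connection_mx g u x
   - (connection_mx g u x)^T *m invmx (g x)).
Proof.
move=> Ux; have gi_smooth : smooth U (fun y => invmx (g y)).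
  move=> k; apply: Ck_invmx => //; first exact: metric_unit gU.
  exact: metric_smooth gU k.
have D := is_derive_smooth u gi_smooth Ux; apply: is_derive_eq D _.
have := is_derive_mulmx (is_derive_smooth u gi_smooth Ux) (is_derive_metric u Ux).
move=> [_]; have gu := metric_unit gU Ux.
have E : \near x, invmx (g x) *m g x = 1%:M.
  by apply: open_near U_open Ux _ => y Uy; rewrite mulVmx // (metric_unit gU).
rewrite (near_eq_derive _ E) derive_cst.
move: ('D_u _ x) (connection_mx g u x) => D' C.
move: (g x) gu => G gu H; rewrite -[LHS](mulmxK gu).
have -> : D' *m G = - (invmx G *m (C *m G + G *m C^T)).
  by apply/eqP; rewrite -addr_eq0 -H.
rewrite mulmxDr mulNmx mulmxDl !mulmxA mulVmx // mul1mx mulmxK //.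
by rewrite opprD mulNmx.
Qed.

Lemma is_derive_conformal_shift x u v : U x ->
  is_derive x u (fun y => conformal_shift (g y) (invmx (g y)) (a y) v)
   (conformal_shift_derive (g x) (invmx (g x)) (a x) ('D_u a x)
      (connection_mx g u x) v).
Proof.
move=> Ux; have dg := is_derive_metric u Ux.
have dgi := is_derive_metric_inv u Ux.
have da := is_derive_smooth u a_smooth Ux.
have daT := is_derive_trmx da.
have dC p q (B : 'M[R]_(p, q)) := is_derive_cst B x u.
have d1 := is_derive_scalemx
  (proj2 (is_derive_mx _ _ _ _) (is_derive_mulmx (dC _ _ v) daT) 0 0)
  (dC _ _ (1%:M : 'M[R]_n)).
have d2 := is_derive_mulmx daT (dC _ _ v).
have d3 := is_derive_mulmx (is_derive_mulmx (is_derive_mulmx dg (dC _ _ v^T)) da) dgi.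
apply: is_derive_eq (is_deriveB (is_deriveD d1 d2) d3) _.
rewrite /conformal_shift_derive scaler0 !mul0mx !mulmx0 add0r !addr0.
by rewrite mulmxDl.
Qed.

(** [a] is half the differential of log [phi], hence closed. Concretely, in the second derivative of
    [phi] the term in a(p) a(q) is symmetric and drops out of Schwarz's equality. *)
Lemma conformal_closed x u v : U x ->
  (v *m ('D_u a x)^T) 0 0 = (u *m ('D_v a x)^T) 0 0.
Proof.
move=> Ux.
have E p q : 'D_p (fun y => 'D_q phi y) x = 2 * phi x *
   ((q *m ('D_p a x)^T) 0 0 + 2 * (p *m (a x)^T) 0 0 * (q *m (a x)^T) 0 0).
  pose f y := (q *m (a y)^T) 0 0.
  have Eq : \near x, 'D_q phi x = (2 *: phi * f) x.
    by apply: open_near U_open Ux _ => y Uy; rewrite phi_derive.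
  rewrite (near_eq_derive _ Eq).
  have dphi : is_derive x p phi ('D_p phi x).
    have [D _] := phi_smooth 1%N; exact: (derivableP (diff_derivable (D x Ux))).
  have df : is_derive x p f ((q *m ('D_p a x)^T) 0 0).
    have da := is_derive_trmx (is_derive_smooth p a_smooth Ux).
    have := proj2 (is_derive_mx _ _ _ _)
      (is_derive_mulmx (is_derive_cst q x p) da) 0 0.
    by rewrite mul0mx add0r.
  have [_ ->] := is_deriveM (is_deriveZ 2 dphi) df.
  rewrite phi_derive // /f.
  have aux (A B C D : R) : 2 * A * D + B * (2 * (2 * A * C)) =
    2 * A * (D + 2 * C * B) by ring.
  exact: aux.
have := derive_comm u v U_open Ux (phi_smooth 2).
rewrite !E => /mulfI H; have {}H := H _.
have p0 : 2 * phi x != 0 by rewrite mulf_neq0 ?pnatr_eq0 // gt_eqF // phi_gt0.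
move: (H p0); rewrite [2 * (u *m _) 0 0 * _]mulrAC.
by move/addIr.
Qed.

Lemma conformal_connection x u : U x -> connection_mx conformal_metric u x =
  connection_mx g u x + conformal_shift (g x) (invmx (g x)) (a x) u.
Proof.
move=> Ux; apply: esym; pose S u := connection_mx g u x +
  conformal_shift (g x) (invmx (g x)) (a x) u.
apply: (connection_unique conformal_metric_on (S := S)) => // {u} [u|u v].
  have dphi : is_derive x u phi ('D_u phi x).
    have [D _] := phi_smooth 1%N; exact: (derivableP (diff_derivable (D x Ux))).
  have -> : 'D_u conformal_metric x = 'D_u phi x *: g x + phi x *:
      (connection_mx g u x *m g x + g x *m (connection_mx g u x)^T).
    by have [_ E] := is_derive_scalemx dphi (is_derive_metric u Ux); exact: E.
  rewrite phi_derive // /conformal_metric /S.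
  have gu := metric_unit gU Ux; have gs := metric_sym gU Ux.
  move: (connection_mx g u x) (g x) (a x) (phi x) gu gs => C G b c gu gs.
  rewrite /conformal_shift !(trmxD, trmxN, trmxZ) !trmx_mul !trmxK trmx1.
  rewrite trmx_inv gs; set s := (u *m b^T) 0 0.
  have K p0 (X : 'M[R]_(p0, n)) : X *m invmx G *m G = X.
    by rewrite -mulmxA mulVmx // mulmx1.
  rewrite -!scalemxAr -!scalemxAl.
  repeat progress (rewrite ?mul1mx ?mulmx1; expand_mx).
  rewrite mulmxV // mul1mx K.
  mx_ring.
rewrite /S [LHS]mulmxDr [RHS]mulmxDr (connection_sym gU u v Ux).
by rewrite (conformal_shift_sym _ _ (metric_sym gU Ux) v u).
Qed.

Lemma conformal_curvature x u v : U x ->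
  curvature_mx conformal_metric u v x = curvature_mx g u v x +
  kn_mx (g x) (invmx (g x))
    (conformal_hessian (g x) (invmx (g x)) (a x) ('D_u a x)
       (connection_mx g u x) u)
    (conformal_hessian (g x) (invmx (g x)) (a x) ('D_v a x)
       (connection_mx g v x) v) u v.
Proof.
move=> Ux; rewrite /curvature_mx.
have D p q : 'D_p (connection_mx conformal_metric q) x =
   'D_p (connection_mx g q) x + conformal_shift_derive (g x) (invmx (g x)) (a x)
      ('D_p a x) (connection_mx g p x) q.
  have Eq : \near x, connection_mx conformal_metric q x = connection_mx g q x +
      conformal_shift (g x) (invmx (g x)) (a x) q.
    by apply: open_near U_open Ux _ => y Uy; exact: conformal_connection.
  rewrite (near_eq_derive _ Eq).
  have d1 := is_derive_smooth p (connection_smooth gU q) Ux.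
  by have [_ ->] := is_deriveD d1 (is_derive_conformal_shift p q Ux).
have gu := metric_unit gU Ux.
have H := conformal_curvature_algebra (a x) (metric_sym gU Ux) (mulVmx gu) (mulmxV gu)
  ('D_u (connection_mx g v) x) ('D_v (connection_mx g u) x)
  (connection_sym gU u v Ux) (conformal_closed u v Ux).
by rewrite (D u v) (D v u) (conformal_connection u Ux) (conformal_connection v Ux).
Qed.

End ConformalChange.

(** * Symmetries and naturality of the curvature *)

Section CurvatureAlgebra.
Variables (R : realType) (n : nat).
Implicit Types (A B C D E F G H X Y Z : 'M[R]_n) (u v w : 'rV[R]_n).

Lemma curvature_alg_antisym A B C D :
  curvature_alg A B C D = - curvature_alg B A D C.
Proof. by rewrite /curvature_alg; mx_ring. Qed.

Lemma curvature_alg_linear c A A1 A2 B B1 B2 C C1 C2 D :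
  A = c *: A1 + A2 -> B = c *: B1 + B2 -> C = c *: C1 + C2 ->
  curvature_alg A B C D =
  c *: curvature_alg A1 B1 C1 D + curvature_alg A2 B2 C2 D.
Proof. by move=> -> -> ->; rewrite /curvature_alg; mx_ring. Qed.

(** The hypothesis is the equality of the mixed second derivatives of the metric, each expanded by
    D_u G = Gam_u G + G Gam_u^T used twice. *)
Lemma curvature_alg_metric A B C D G :
  A *m G + D *m (C *m G + G *m C^T) + ((C *m G + G *m C^T) *m D^T + G *m A^T) =
  B *m G + C *m (D *m G + G *m D^T) + ((D *m G + G *m D^T) *m C^T + G *m B^T) ->
  curvature_alg A B C D *m G + G *m (curvature_alg A B C D)^T = 0.
Proof.
move=> /eqP; rewrite -subr_eq0 => /eqP <-.
by rewrite /curvature_alg !(trmxD, trmxN) !trmx_mul; mx_ring.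
Qed.

(* [Dpq] stands for the derivative along [p] of the connection matrix [Cq]. *)
Lemma curvature_alg_bianchi1 u v w
    (Cu Cv Cw Duv Dvu Dvw Dwv Dwu Duw : 'M[R]_n) :
  v *m Cu = u *m Cv -> w *m Cv = v *m Cw -> u *m Cw = w *m Cu ->
  w *m Duv = v *m Duw -> u *m Dvw = w *m Dvu -> v *m Dwu = u *m Dwv ->
  w *m curvature_alg Duv Dvu Cu Cv + u *m curvature_alg Dvw Dwv Cv Cw
  + v *m curvature_alg Dwu Duw Cw Cu = 0.
Proof.
move=> T1 T2 T3 S1 S2 S3; rewrite /curvature_alg.
by repeat progress expand_mx; rewrite T1 T2 T3 S1 S2 S3; mx_ring.
Qed.

(* [X], [Y], [Z] are the derivatives along [w], [u], [v] of the curvatures of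
   the pairs [(u, v)], [(v, w)], [(w, u)], and [Dpqr] stands for second
   derivatives of connection matrices. *)
Lemma curvature_alg_bianchi2
    (Cu Cv Cw Duv Dvu Dvw Dwv Dwu Duw Dwuv Dvwu Duvw : 'M[R]_n) X Y Z :
  X = Dwuv - Dvwu + (Dwv *m Cu + Cv *m Dwu) - (Dwu *m Cv + Cu *m Dwv) ->
  Y = Duvw - Dwuv + (Duw *m Cv + Cw *m Duv) - (Duv *m Cw + Cv *m Duw) ->
  Z = Dvwu - Duvw + (Dvu *m Cw + Cu *m Dvw) - (Dvw *m Cu + Cw *m Dvu) ->
  X + curvature_alg Duv Dvu Cu Cv *m Cw
  - Cw *m curvature_alg Duv Dvu Cu Cv
  + (Y + curvature_alg Dvw Dwv Cv Cw *m Cu - Cu *m curvature_alg Dvw Dwv Cv Cw)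
  + (Z + curvature_alg Dwu Duw Cw Cu *m Cv - Cv *m curvature_alg Dwu Duw Cw Cu)
  = 0.
Proof. by move=> -> -> ->; rewrite /curvature_alg; mx_ring. Qed.

End CurvatureAlgebra.

Section CurvatureSymmetries.
Variables (R : realType) (n : nat) (U : set 'rV[R]_n).
Variable g : 'rV[R]_n -> 'M[R]_n.
Hypothesis gU : metric_on U g.
Implicit Types (x u v w z : 'rV[R]_n).
Local Notation Gam := (connection_mx g).
Local Notation Tht := (curvature_mx g).

Let U_open := metric_open gU.

Lemma smooth_derive p q (F : 'rV[R]_n -> 'M[R]_(p, q)) u :
  smooth U F -> smooth U (fun x => 'D_u F x).
Proof. by move=> FU k; have [_] := FU k.+1; apply. Qed.

Lemma curvature_smooth u v : smooth U (Tht u v).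
Proof.
move=> k; have C w := connection_smooth gU w k.
have D w z := smooth_derive w (connection_smooth gU z) k.
have M w z := Ck_mulmx U_open (C w) (C z).
exact (CkB U_open (CkD U_open (CkB U_open (D u v) (D v u)) (M v u)) (M u v)).
Qed.

Lemma is_derive_connection x u v : U x ->
  is_derive x u (Gam v) ('D_u (Gam v) x).
Proof. by move=> Ux; exact (is_derive_smooth u (connection_smooth gU v) Ux). Qed.

Lemma curvature_antisym x u v : Tht u v x = - Tht v u x.
Proof. exact: curvature_alg_antisym. Qed.

Lemma curvature_linear x v : U x -> linear (fun u => Tht u v x).
Proof.
move=> Ux; suff H (c : R) (u w : 'rV[R]_n) :
  Tht (c *: u + w) v x = c *: Tht u v x + Tht w v x by exact: H.
have E1 : 'D_(c *: u + w) (Gam v) x = c *: 'D_u (Gam v) x + 'D_w (Gam v) x.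
  exact (derive_linear (connection_differentiable gU v Ux) c u w).
have E3 y : U y -> Gam (c *: u + w) y = c *: Gam u y + Gam w y.
  by move=> Uy; exact (connection_linear gU Uy c u w).
have E2 : 'D_v (Gam (c *: u + w)) x = c *: 'D_v (Gam u) x + 'D_v (Gam w) x.
  have Eq : \near x, Gam (c *: u + w) x = (c \*: Gam u + Gam w) x.
    exact: open_near U_open Ux E3.
  have [_ E] := is_deriveD (is_deriveZ c (is_derive_connection v u Ux))
    (is_derive_connection v w Ux).
  exact (etrans (near_eq_derive v Eq) E).
exact (curvature_alg_linear (Gam v x) E1 E2 (E3 x Ux)).
Qed.

Lemma curvature_metric x u v : U x ->
  Tht u v x *m g x + g x *m (Tht u v x)^T = 0.
Proof.
move=> Ux.
have D p q : 'D_p (fun y => 'D_q g y) x =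
    'D_p (Gam q) x *m g x + Gam q x *m (Gam p x *m g x + g x *m (Gam p x)^T)
    + ((Gam p x *m g x + g x *m (Gam p x)^T) *m (Gam q x)^T
       + g x *m ('D_p (Gam q) x)^T).
  have Eq : \near x, 'D_q g x = Gam q x *m g x + g x *m (Gam q x)^T.
    by apply: open_near U_open Ux _ => y Uy; exact (connection_metric gU q Uy).
  have dG := is_derive_connection p q Ux; have dg := is_derive_metric gU p Ux.
  have [_ E] := is_deriveD (is_derive_mulmx dG dg)
    (is_derive_mulmx dg (is_derive_trmx dG)).
  exact (etrans (near_eq_derive p Eq) E).
apply: curvature_alg_metric.
have C := derive_comm_mx u v U_open Ux (metric_smooth gU 2).
exact (etrans (esym (D u v)) (etrans C (D v u))).
Qed.

Lemma curvature_bianchi1 x u v w : U x ->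
  w *m Tht u v x + u *m Tht v w x + v *m Tht w u x = 0.
Proof.
move=> Ux.
have S p q r : q *m 'D_p (Gam r) x = r *m 'D_p (Gam q) x.
  have E (b c : 'rV[R]_n) : 'D_p (fun y => b *m Gam c y) x = b *m 'D_p (Gam c) x.
    have [_ F] := is_derive_mulmx (is_derive_cst b x p) (is_derive_connection p c Ux).
    by rewrite mul0mx add0r in F.
  have Eq : \near x, q *m Gam r x = r *m Gam q x.
    by apply: open_near U_open Ux _ => y Uy; exact (connection_sym gU r q Uy).
  exact (etrans (esym (E q r)) (etrans (near_eq_derive p Eq) (E r q))).
have T p q : q *m Gam p x = p *m Gam q x by exact (connection_sym gU p q Ux).
exact (curvature_alg_bianchi1 (T u v) (T v w) (T w u)
  (S u w v) (S v u w) (S w v u)).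
Qed.

Lemma curvature_bianchi2 x u v w : U x ->
  'D_w (Tht u v) x + Tht u v x *m Gam w x - Gam w x *m Tht u v x
  + ('D_u (Tht v w) x + Tht v w x *m Gam u x - Gam u x *m Tht v w x)
  + ('D_v (Tht w u) x + Tht w u x *m Gam v x - Gam v x *m Tht w u x) = 0.
Proof.
move=> Ux; pose DD r s t := 'D_r (fun y => 'D_s (Gam t) y) x.
have S p q r : DD p q r = DD q p r.
  exact (derive_comm_mx p q U_open Ux (connection_smooth gU r 2)).
have D p q r : 'D_r (Tht p q) x = DD r p q - DD q r p
    + ('D_r (Gam q) x *m Gam p x + Gam q x *m 'D_r (Gam p) x)
    - ('D_r (Gam p) x *m Gam q x + Gam p x *m 'D_r (Gam q) x).
  have dD s t : is_derive x r (fun y => 'D_s (Gam t) y) (DD r s t).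
    exact (is_derive_smooth r (smooth_derive s (connection_smooth gU t)) Ux).
  have dG s := is_derive_connection r s Ux.
  rewrite (S q r p); have [_ E] := is_deriveB (is_deriveD (is_deriveB (dD p q) (dD q p))
    (is_derive_mulmx (dG q) (dG p))) (is_derive_mulmx (dG p) (dG q)).
  exact: E.
exact (curvature_alg_bianchi2 (D u v w) (D v w u) (D w u v)).
Qed.

End CurvatureSymmetries.

Lemma near_is_derive (R : realType) (V W : normedModType R) (f h : V -> W) x v df :
  (\near x, f x = h x) -> is_derive x v h df -> is_derive x v f df.
Proof.
move=> fh; have hf : \near x, h x = f x by apply: filterS fh => y ->.
by move=> [d <-]; split; [exact: near_eq_derivable hf d|exact: near_eq_derive].
Qed.

Section MetricExtensionality.
Variables (R : realType) (n : nat) (U : set 'rV[R]_n).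
Variables g h : 'rV[R]_n -> 'M[R]_n.
Hypotheses (gU : metric_on U g) (gh : forall x, U x -> g x = h x).

Let U_open := metric_open gU.

Lemma metric_on_ext : metric_on U h.
Proof.
split=> [//|k|x Ux|x Ux].
- exact: Ck_ext U_open gh (metric_smooth gU k).
- by rewrite -gh // (metric_sym gU).
- by rewrite -gh // (metric_unit gU).
Qed.

Lemma connection_mx_ext x u : U x -> connection_mx g u x = connection_mx h u x.
Proof.
move=> Ux; apply: (connection_unique metric_on_ext Ux
  (S := fun u => connection_mx g u x)) => [v|v w].
  rewrite -gh // -(connection_metric gU v Ux); apply: near_eq_derive.
  by apply: open_near U_open Ux _ => y Uy; rewrite gh.
exact (connection_sym gU v w Ux).
Qed.

Lemma curvature_mx_ext x u v : U x -> curvature_mx g u v x = curvature_mx h u v x.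
Proof.
move=> Ux; have E p q : 'D_p (connection_mx g q) x = 'D_p (connection_mx h q) x.
  apply: near_eq_derive; apply: open_near U_open Ux _ => y.
  exact: connection_mx_ext.
exact (f_equal4 (@curvature_alg R n) (E u v) (E v u) (connection_mx_ext u Ux)
  (connection_mx_ext v Ux)).
Qed.

Lemma riem_ext x u v z w : U x -> riem g x u v z w = riem h x u v z w.
Proof.
move=> Ux; rewrite (riemE gU _ _ _ _ Ux) (riemE metric_on_ext _ _ _ _ Ux).
by rewrite (curvature_mx_ext u v Ux) (gh Ux).
Qed.

End MetricExtensionality.

Lemma metric_on_sub (R : realType) (n : nat) (U U' : set 'rV[R]_n) g :
  metric_on U g -> open U' -> U' `<=` U -> metric_on U' g.
Proof.
move=> gU oU' sub; split=> // [k|x /sub|x /sub].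
- exact: Ck_sub sub (metric_smooth gU k).
- exact: metric_sym.
- exact: metric_unit.
Qed.

(** * Naturality of the connection and the curvature under changes of coordinates *)

Section CoordinateChange.
Variables (R : realType) (n : nat) (U V : set 'rV[R]_n).
Variables (g h : 'rV[R]_n -> 'M[R]_n) (T : 'rV[R]_n -> 'rV[R]_n).
Variable J : 'rV[R]_n -> 'M[R]_n.
Hypotheses (gU : metric_on U g) (hV : metric_on V h).
Hypotheses (T_smooth : smooth U T) (J_smooth : smooth U J).
Hypothesis TV : forall x, U x -> V (T x).
Hypothesis T_derive : forall x v, U x -> 'D_v T x = v *m J x.
Hypothesis gJ : forall x, U x -> g x = J x *m h (T x) *m (J x)^T.
Implicit Types (x u v w z : 'rV[R]_n).

Let U_open := metric_open gU.
Let pull v x := connection_mx h (v *m J x) (T x).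

Lemma jacobian_unit x : U x -> J x \in unitmx.
Proof.
by move=> Ux; have := metric_unit gU Ux; rewrite gJ // !unitmx_mul => /andP[/andP[]].
Qed.

Lemma is_derive_jacobian x u : U x -> is_derive x u J ('D_u J x).
Proof. by move=> Ux; exact (is_derive_smooth u J_smooth Ux). Qed.

Lemma jacobian_derive_sym x u v : U x -> v *m 'D_u J x = u *m 'D_v J x.
Proof.
move=> Ux; have E p q : 'D_p (fun y => 'D_q T y) x = q *m 'D_p J x.
  have Eq : \near x, 'D_q T x = q *m J x.
    by apply: open_near U_open Ux _ => y Uy; exact: T_derive.
  have [_ F] := is_derive_mulmx (is_derive_cst q x p) (is_derive_jacobian p Ux).
  by rewrite mul0mx add0r in F; exact (etrans (near_eq_derive p Eq) F).
have C := derive_comm_mx u v U_open Ux (T_smooth 2).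
exact (etrans (esym (E u v)) (etrans C (E v u))).
Qed.

Lemma is_derive_comp_change p q (F : 'rV[R]_n -> 'M[R]_(p, q)) x u :
  U x -> differentiable F (T x) ->
  is_derive x u (fun y => F (T y)) ('D_(u *m J x) F (T x)).
Proof.
move=> Ux dF; have [dT _] := T_smooth 1; have dTx := dT x Ux.
split; first exact: (diff_derivable (differentiable_comp dTx dF)).
rewrite -(T_derive u Ux); exact (derive_comp_diff u dTx dF).
Qed.

Lemma connection_derive_linear y w : V y ->
  linear (fun v => 'D_w (connection_mx h v) y).
Proof.
move=> Vy; suff H (c : R) (u v : 'rV[R]_n) :
  'D_w (connection_mx h (c *: u + v)) y =
  c *: 'D_w (connection_mx h u) y + 'D_w (connection_mx h v) y by exact: H.
have Eq : \near y, connection_mx h (c *: u + v) y =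
    (c \*: connection_mx h u + connection_mx h v) y.
  apply: open_near (metric_open hV) Vy _ => t Vt.
  exact (connection_linear hV Vt c u v).
have [_ E] := is_deriveD (is_deriveZ c (is_derive_connection hV w u Vy))
    (is_derive_connection hV w v Vy).
exact (etrans (near_eq_derive w Eq) E).
Qed.

(** [pull v] depends on the point through both [T] and the vector [v *m J]. Expanding the vector in
    the standard basis separates the two dependences, and linearity reassembles the two sums. *)
Lemma is_derive_pull x u v : U x -> is_derive x u (pull v)
  (connection_mx h (v *m 'D_u J x) (T x)
   + 'D_(u *m J x) (connection_mx h (v *m J x)) (T x)).
Proof.
move=> Ux; have Vx := TV Ux.
pose F k := connection_mx h (delta_mx 0 k : 'rV[R]_n).
pose c k y := (v *m J y) 0 k.
have Eq : \near x, pull v x = (\sum_k (fun y => c k y *: F k (T y))) x.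
  apply: open_near U_open Ux _ => y Uy; rewrite fct_sumE.
  exact (linear_row_scale (v *m J y) (connection_linear hV (TV Uy))).
apply: near_is_derive Eq _.
have dc k : is_derive x u (c k) ((v *m 'D_u J x) 0 k).
  have := proj2 (is_derive_mx _ _ _ _)
    (is_derive_mulmx (is_derive_cst v x u) (is_derive_jacobian u Ux)) 0 k.
  by rewrite mul0mx add0r.
have dF k : is_derive x u (fun y => F k (T y)) ('D_(u *m J x) (F k) (T x)).
  apply: is_derive_comp_change => //.
  exact (connection_differentiable hV (delta_mx 0 k) Vx).
have D := is_derive_sum (fun k => is_derive_scalemx (dc k) (dF k)).
apply: is_derive_eq D _; rewrite big_split /=; apply: esym; congr (_ + _).
  exact (linear_row_scale (v *m 'D_u J x) (connection_linear hV Vx)).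
exact (linear_row_scale (v *m J x) (connection_derive_linear (u *m J x) Vx)).
Qed.

Lemma connection_change_metric (C C' G H Jm Jd : 'M[R]_n) :
  C *m Jm = Jm *m C' + Jd -> G = Jm *m H *m Jm^T ->
  Jd *m H *m Jm^T + Jm *m (C' *m H + H *m C'^T) *m Jm^T + Jm *m H *m Jd^T =
  C *m G + G *m C^T.
Proof.
move=> E ->.
have -> : C *m (Jm *m H *m Jm^T) = (Jm *m C' + Jd) *m H *m Jm^T.
  by rewrite -E !mulmxA.
have -> : Jm *m H *m Jm^T *m C^T = Jm *m H *m (Jm *m C' + Jd)^T.
  by rewrite -E trmx_mul !mulmxA.
by rewrite trmxD !trmx_mul; mx_ring.
Qed.

Lemma connection_change_sym (A P Q D E : 'M[R]_n) v w :
  v *m A *m P = w *m A *m Q -> v *m D = w *m E ->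
  forall B : 'M[R]_n, v *m ((A *m P + D) *m B) = w *m ((A *m Q + E) *m B).
Proof. by move=> H1 H2 B; rewrite !mulmxA !mulmxDr !mulmxA H1 H2. Qed.

(** The pulled-back connection, including the inhomogeneous term ['D_u J x], is metric and
    torsion-free. The latter uses the symmetry of the second derivatives of [T]. *)
Lemma connection_change x u : U x ->
  connection_mx g u x *m J x = J x *m pull u x + 'D_u J x.
Proof.
move=> Ux; have Ju := jacobian_unit Ux; have Vx := TV Ux.
pose S u := (J x *m pull u x + 'D_u J x) *m invmx (J x).
have SJ v : S v *m J x = J x *m pull v x + 'D_v J x by rewrite mulmxKV.
rewrite -SJ; congr (_ *m _); apply: esym.
apply: (connection_unique gU Ux (S := S)) => [v|v w]; last first.
  exact (connection_change_sym (connection_sym hV (v *m J x) (w *m J x) Vx)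
    (jacobian_derive_sym v w Ux) (invmx (J x))).
have dh := is_derive_comp_change v Ux (metric_differentiable hV Vx).
rewrite (connection_metric hV (v *m J x) Vx) in dh.
have dJ := is_derive_jacobian v Ux.
have D := is_derive_mulmx (is_derive_mulmx dJ dh) (is_derive_trmx dJ).
have Eq : \near x, g x = J x *m h (T x) *m (J x)^T.
  exact: open_near U_open Ux gJ.
have [_ ->] := near_is_derive Eq D.
by rewrite -(connection_change_metric (SJ v) (gJ Ux)) mulmxDl.
Qed.

Lemma curvature_change_alg (Cu Cv C'u C'v Duv Dvu D'uv D'vu K
    Jm Ju Jv Juv : 'M[R]_n) :
  Cu *m Jm = Jm *m C'u + Ju -> Cv *m Jm = Jm *m C'v + Jv ->
  Duv *m Jm + Cv *m Ju = Ju *m C'v + Jm *m (K + D'uv) + Juv ->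
  Dvu *m Jm + Cu *m Jv = Jv *m C'u + Jm *m (K + D'vu) + Juv ->
  curvature_alg Duv Dvu Cu Cv *m Jm = Jm *m curvature_alg D'uv D'vu C'u C'v.
Proof.
move=> Eu Ev /(canRL (addrK _)) Euv /(canRL (addrK _)) Evu.
rewrite /curvature_alg !(mulmxDl, mulNmx) Euv Evu -!mulmxA Eu Ev.
rewrite !(mulmxDr _ (Jm *m _)) !mulmxA Eu Ev.
by mx_ring.
Qed.

(** [connection_change] is differentiated along [u] and [v] and the results are antisymmetrized;
    second derivatives of [J] and the inhomogeneous terms cancel. *)
Lemma curvature_change x u v : U x -> curvature_mx g u v x *m J x =
  J x *m curvature_mx h (u *m J x) (v *m J x) (T x).
Proof.
move=> Ux.
have D p q : 'D_p (connection_mx g q) x *m J x + connection_mx g q x *m 'D_p J x =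
  'D_p J x *m pull q x + J x *m (connection_mx h (q *m 'D_p J x) (T x)
   + 'D_(p *m J x) (connection_mx h (q *m J x)) (T x)) + 'D_p (fun y => 'D_q J y) x.
  have dJ := is_derive_jacobian p Ux.
  have [_ <-] := is_derive_mulmx (is_derive_connection gU p q Ux) dJ.
  have d2 := is_derive_smooth p (smooth_derive q J_smooth) Ux.
  have [_ <-] := is_deriveD (is_derive_mulmx dJ (is_derive_pull p q Ux)) d2.
  apply: near_eq_derive; apply: open_near U_open Ux _ => y Uy.
  exact: connection_change.
have JJ := derive_comm_mx u v U_open Ux (J_smooth 2).
have E1 := D u v; have E2 := D v u; rewrite -(jacobian_derive_sym u v Ux) in E2.
have {}E2 := etrans E2 (congr1 (fun X => _ + X) (esym JJ)).
exact: (curvature_change_alg (connection_change u Ux)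
  (connection_change v Ux) E1 E2).
Qed.

Lemma riem_change x u v z w : U x -> riem g x u v z w =
  riem h (T x) (u *m J x) (v *m J x) (z *m J x) (w *m J x).
Proof.
move=> Ux; rewrite (riemE gU _ _ _ _ Ux) (riemE hV _ _ _ _ (TV Ux)).
rewrite gJ // !mulmxA (curvature_change u v Ux).
move: (curvature_mx h _ _ _) (h (T x)) => A H.
by rewrite /inner trmx_mul !mulmxA.
Qed.

End CoordinateChange.

(** * Connection and curvature of a product metric *)

Section ProductMetric.
Variables (R : realType) (m n : nat) (U1 : set 'rV[R]_m) (U2 : set 'rV[R]_n).
Variables (g1 : 'rV[R]_m -> 'M[R]_m) (g2 : 'rV[R]_n -> 'M[R]_n).
Hypotheses (gU1 : metric_on U1 g1) (gU2 : metric_on U2 g2).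
Implicit Types (x u v w z : 'rV[R]_(m + n)).

Definition product_metric x : 'M[R]_(m + n) :=
  block_mx (g1 (lsubmx x)) 0 0 (g2 (rsubmx x)).

Let U := rV_setX U1 U2.

Lemma product_open : open U.
Proof. by apply: rV_setX_open; [exact: metric_open gU1|exact: metric_open gU2]. Qed.

Lemma product_metric_on : metric_on U product_metric.
Proof.
have o1 := metric_open gU1; have o2 := metric_open gU2.
split=> [|k|x [U1x U2x]|x [U1x U2x]]; first exact: product_open.
- apply: Ck_mx => [|a b]; first exact: product_open.
  rewrite /product_metric.
  case: (split_ordP a) => a' ->; case: (split_ordP b) => b' ->.
  + under eq_fun do rewrite block_mxEul.
    exact: Ck_prodl (Ck_coord _ _ o1 (metric_smooth gU1 k)).
  + by under eq_fun do rewrite block_mxEur mxE; exact: Ck_cst.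
  + by under eq_fun do rewrite block_mxEdl mxE; exact: Ck_cst.
  + under eq_fun do rewrite block_mxEdr.
    exact: Ck_prodr (Ck_coord _ _ o2 (metric_smooth gU2 k)).
- rewrite /product_metric tr_block_mx !trmx0.
  by rewrite (metric_sym gU1) // (metric_sym gU2).
- rewrite /product_metric unitmxE det_ublock unitrM -!unitmxE.
  by rewrite (metric_unit gU1) // (metric_unit gU2).
Qed.

Lemma is_derive_block (F1 : 'rV[R]_m -> 'M[R]_m) (F2 : 'rV[R]_n -> 'M[R]_n) x u :
  differentiable F1 (lsubmx x) -> differentiable F2 (rsubmx x) ->
  is_derive x u (fun y => block_mx (F1 (lsubmx y)) 0 0 (F2 (rsubmx y)))
    (block_mx ('D_(lsubmx u) F1 (lsubmx x)) 0 0 ('D_(rsubmx u) F2 (rsubmx x))).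
Proof.
move=> d1 d2.
have D1 : is_derive x u (fun y : 'rV[R]_(m + n) => F1 (lsubmx y))
    ('D_(lsubmx u) F1 (lsubmx x)).
  split; last exact (derive_comp_lin (P := lsubmx) u d1).
  apply: diff_derivable; apply: differentiable_comp d1.
  exact: differentiable_lsubmx.
have D2 : is_derive x u (fun y : 'rV[R]_(m + n) => F2 (rsubmx y))
    ('D_(rsubmx u) F2 (rsubmx x)).
  split; last exact (derive_comp_lin (P := rsubmx) u d2).
  apply: diff_derivable; apply: differentiable_comp d2.
  exact: differentiable_rsubmx.
have E1 := proj2 (is_derive_mx _ _ _ _) D1.
have E2 := proj2 (is_derive_mx _ _ _ _) D2.
apply/is_derive_mx => a b.
case: (split_ordP a) => a' ->; case: (split_ordP b) => b' ->.
- by rewrite block_mxEul; under eq_fun do rewrite block_mxEul; exact: E1.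
- rewrite block_mxEur mxE; under eq_fun do rewrite block_mxEur mxE.
  exact: is_derive_cst.
- rewrite block_mxEdl mxE; under eq_fun do rewrite block_mxEdl mxE.
  exact: is_derive_cst.
- by rewrite block_mxEdr; under eq_fun do rewrite block_mxEdr; exact: E2.
Qed.

Lemma block_connection_sym (A B : 'M[R]_m) (C D : 'M[R]_n) v w :
  lsubmx w *m A = lsubmx v *m B -> rsubmx w *m C = rsubmx v *m D ->
  w *m block_mx A 0 0 C = v *m block_mx B 0 0 D.
Proof.
move=> E F; rewrite -[w]hsubmxK -[v in RHS]hsubmxK !mul_row_block.
by rewrite !(mulmx0, addr0, add0r) E F.
Qed.

Lemma curvature_alg_block (A B C D : 'M[R]_m) (A' B' C' D' : 'M[R]_n) :
  curvature_alg (block_mx A 0 0 A') (block_mx B 0 0 B') (block_mx C 0 0 C')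
    (block_mx D 0 0 D') =
  block_mx (curvature_alg A B C D) 0 0 (curvature_alg A' B' C' D').
Proof.
rewrite /curvature_alg !mulmx_block !opp_block_mx !add_block_mx.
by rewrite !(mulmx0, mul0mx, oppr0, addr0, add0r).
Qed.

Lemma product_connection x u : U x -> connection_mx product_metric u x =
  block_mx (connection_mx g1 (lsubmx u) (lsubmx x)) 0 0
           (connection_mx g2 (rsubmx u) (rsubmx x)).
Proof.
move=> Ux; have [U1x U2x] := Ux; apply: esym.
pose S u := block_mx (connection_mx g1 (lsubmx u) (lsubmx x)) 0 0
           (connection_mx g2 (rsubmx u) (rsubmx x)).
apply: (connection_unique product_metric_on Ux (S := S)) => [v|v w].
  have [_ E] := is_derive_block v (metric_differentiable gU1 U1x)
    (metric_differentiable gU2 U2x).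
  apply: etrans E _.
  rewrite (connection_metric gU1 (lsubmx v) U1x).
  rewrite (connection_metric gU2 (rsubmx v) U2x) /S /product_metric.
  move: (connection_mx g1 _ _) (connection_mx g2 _ _) => A B.
  rewrite tr_block_mx !mulmx_block !trmx0.
  by rewrite !(mulmx0, mul0mx, addr0, add0r) add_block_mx !addr0.
apply: block_connection_sym; first exact (connection_sym gU1 (lsubmx v) (lsubmx w) U1x).
exact (connection_sym gU2 (rsubmx v) (rsubmx w) U2x).
Qed.

Lemma product_curvature x u v : U x -> curvature_mx product_metric u v x =
  block_mx (curvature_mx g1 (lsubmx u) (lsubmx v) (lsubmx x)) 0 0
           (curvature_mx g2 (rsubmx u) (rsubmx v) (rsubmx x)).
Proof.
move=> Ux; have [U1x U2x] := Ux.
have D p q : 'D_p (connection_mx product_metric q) x =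
  block_mx ('D_(lsubmx p) (connection_mx g1 (lsubmx q)) (lsubmx x)) 0 0
           ('D_(rsubmx p) (connection_mx g2 (rsubmx q)) (rsubmx x)).
  have [_ E] := is_derive_block p
    (connection_differentiable gU1 (lsubmx q) U1x)
    (connection_differentiable gU2 (rsubmx q) U2x).
  apply: etrans E; apply: near_eq_derive.
  apply: open_near product_open Ux _ => y Uy; exact: product_connection.
rewrite /curvature_mx (D u v) (D v u) (product_connection u Ux).
rewrite (product_connection v Ux); exact: curvature_alg_block.
Qed.

Lemma product_riem x u v z w : U x -> riem product_metric x u v z w =
  riem g1 (lsubmx x) (lsubmx u) (lsubmx v) (lsubmx z) (lsubmx w)
  + riem g2 (rsubmx x) (rsubmx u) (rsubmx v) (rsubmx z) (rsubmx w).
Proof.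
move=> Ux; have [U1x U2x] := Ux.
rewrite (riemE product_metric_on _ _ _ _ Ux) (riemE gU1 _ _ _ _ U1x).
rewrite (riemE gU2 _ _ _ _ U2x) (product_curvature u v Ux) /product_metric.
move: (curvature_mx g1 _ _ _) (curvature_mx g2 _ _ _) => A B.
move: (g1 _) (g2 _) => G H.
rewrite mulmx_block !(mulmx0, mul0mx, addr0, add0r) /inner.
rewrite -[z in LHS]hsubmxK mul_row_block !(mulmx0, addr0, add0r).
rewrite -[w in LHS]hsubmxK tr_row_mx mul_row_col -opprD.
by rewrite !mxE.
Qed.

End ProductMetric.

(** * Algebraic curvature tensors *)

Section CurvatureTensors.
Variables (R : realType) (n : nat).
Local Notation V := 'rV[R]_n.
Implicit Types (G P Q : 'M[R]_n) (u v w z a b : V) (T : V -> V -> R).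
Implicit Types (f h : V -> R) (Rm : V -> V -> V -> V -> R).

Record curvature_tensor Rm : Prop := CurvatureTensor {
  curv_linear : forall v z w (c : R) (u u' : V),
    Rm (c *: u + u') v z w = c * Rm u v z w + Rm u' v z w;
  curv_anti12 : forall u v z w, Rm u v z w = - Rm v u z w;
  curv_anti34 : forall u v z w, Rm u v z w = - Rm u v w z;
  curv_bianchi : forall u v w z, Rm u v w z + Rm v w u z + Rm w u v z = 0 }.

(** The classical combination of four cyclic instances of the Bianchi identity; the many
    antisymmetry instances only identify the unknowns of the resulting linear system. *)
Lemma curv_pair Rm : curvature_tensor Rm ->
  forall u v z w, Rm u v z w = Rm z w u v.
Proof.
move=> [_ A12 A34 B] u v z w.
have := B u v z w; have := B v z w u; have := B z w u v; have := B w u v z.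
have := A34 u v w z; have := A34 v z w u; have := A34 z w u v.
have := A34 w u v z; have := A34 u v z w; have := A34 z u v w.
have := A34 z u w v; have := A34 v w z u; have := A34 v w u z.
have := A12 z u v w; have := A12 u z v w; have := A12 v w z u.
have := A12 w v z u; have := A12 u v z w; have := A12 v u z w.
have := A12 z w u v; have := A12 w z u v; have := A12 z w v u.
have := A12 w u v z; have := A12 u w v z; have := A12 w u z v.
have := A12 v z w u; have := A12 z v w u; have := A12 z v u w.
have := A34 w z u v; have := A34 u w v z; have := A34 z v w u.
have := A34 u z v w; have := A34 v u z w; have := A34 w v z u.
lra.
Qed.

Definition alg_ricci G Rm v w : R := metric_trace G (fun a b => Rm v a w b).

Definition alg_schouten G Rm v w : R :=
  (n%:R - 2)^-1 * (alg_ricci G Rm v w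
    - metric_trace G (alg_ricci G Rm) / (2 * (n%:R - 1)) * inner G v w).

Definition kulkarni_nomizu (C D : V -> V -> R) v w z u : R :=
  C v z * D w u + C w u * D v z - C v u * D w z - C w z * D v u.

Definition alg_weyl G Rm v w z u : R :=
  Rm v w z u - kulkarni_nomizu (alg_schouten G Rm) (inner G) v w z u.

Lemma metric_trace_eq G T T' : (forall a b, T a b = T' a b) ->
  metric_trace G T = metric_trace G T'.
Proof. by move=> E; do 2!(apply: eq_bigr => ? _); rewrite E. Qed.

Lemma metric_traceD G T T' :
  metric_trace G (fun a b => T a b + T' a b) = metric_trace G T + metric_trace G T'.
Proof.
rewrite /metric_trace -big_split /=; apply: eq_bigr => i _.
by rewrite -big_split /=; apply: eq_bigr => j _; rewrite mulrDr.
Qed.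

Lemma metric_traceZ G c T :
  metric_trace G (fun a b => c * T a b) = c * metric_trace G T.
Proof.
rewrite /metric_trace mulr_sumr; apply: eq_bigr => i _.
by rewrite mulr_sumr; apply: eq_bigr => j _; rewrite mulrCA.
Qed.

Lemma metric_traceN G T :
  metric_trace G (fun a b => - T a b) = - metric_trace G T.
Proof.
rewrite -mulN1r -metric_traceZ; apply: metric_trace_eq => a b.
by rewrite mulN1r.
Qed.

Lemma metric_trace_scale G c T : c != 0 -> G \in unitmx ->
  metric_trace (c *: G) T = c^-1 * metric_trace G T.
Proof.
move=> c0 Gu; rewrite /metric_trace mulr_sumr; apply: eq_bigr => i _.
rewrite mulr_sumr; apply: eq_bigr => j _.
by rewrite invmxZ ?unitmxZ ?unitfE // mxE mulrA.
Qed.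

Section Trace.
Variable G : 'M[R]_n.
Hypotheses (G_sym : G^T = G) (G_unit : G \in unitmx).

Lemma metric_inv_sym : (invmx G)^T = invmx G.
Proof. by rewrite trmx_inv G_sym. Qed.

Lemma metric_trace_swap T :
  metric_trace G (fun a b => T b a) = metric_trace G T.
Proof.
rewrite /metric_trace exchange_big /=; apply: eq_bigr => i _.
by apply: eq_bigr => j _; rewrite -[in LHS]metric_inv_sym mxE.
Qed.

Lemma metric_trace_inner : metric_trace G (inner G) = n%:R.
Proof.
have -> : n%:R = \tr (1%:M : 'M[R]_n) by rewrite mxtrace1.
rewrite -(mulVmx G_unit) /metric_trace /mxtrace; apply: eq_bigr => i _.
rewrite mxE; apply: eq_bigr => j _; rewrite inner_basis; congr (_ * _).
by rewrite -{1}G_sym mxE.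
Qed.

Lemma metric_trace_contract f w : linear f ->
  metric_trace G (fun a b => f a * inner G w b) = f w.
Proof.
move=> lin; rewrite (linear_row w lin) /metric_trace; apply: eq_bigr => i _.
have -> : w 0 i = \sum_j invmx G i j * (w *m G) 0 j.
  rewrite -[w in LHS](mulmxK G_unit) mxE; apply: eq_bigr => j _.
  by rewrite mulrC -[in LHS]metric_inv_sym mxE.
rewrite mulr_suml; apply: eq_bigr => j _; rewrite inner_basisr.
by rewrite mulrA mulrAC.
Qed.

Lemma inner_linear_form P w : linear (inner P w : V -> R).
Proof. by move=> c u v; rewrite inner_linearr. Qed.

Lemma inner_linear_form_l P w : linear (fun v => inner P v w : R).
Proof. by move=> c u v; rewrite inner_linearl. Qed.

Lemma ricci_kulkarni_nomizu P v w : P^T = P ->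
  alg_ricci G (kulkarni_nomizu (inner P) (inner G)) v w =
  (n%:R - 2) * inner P v w + metric_trace G (inner P) * inner G v w.
Proof.
move=> Ps; rewrite /alg_ricci /kulkarni_nomizu.
rewrite !metric_traceD !metric_traceN metric_traceZ metric_trace_inner.
have -> : metric_trace G (fun a b => inner P a b * inner G v w) =
    inner G v w * metric_trace G (inner P).
  by rewrite -metric_traceZ; apply: metric_trace_eq => a b; rewrite mulrC.
have -> : metric_trace G (fun a b => inner P v b * inner G a w) = inner P v w.
  rewrite -metric_trace_swap -[RHS](metric_trace_contract w (inner_linear_form P v)).
  by apply: metric_trace_eq => a b; rewrite [inner G b w]inner_sym.
have -> : metric_trace G (fun a b => inner P a w * inner G v b) = inner P v w.
  by rewrite (metric_trace_contract v (inner_linear_form_l P w)).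
ring.
Qed.

Hypothesis n2 : (2 < n)%N.

Let n2_neq0 : n%:R - 2 != 0 :> R.
Proof. by rewrite subr_eq0 eqr_nat gtn_eqF. Qed.

Let n1_neq0 : n%:R - 1 != 0 :> R.
Proof. by rewrite subr_eq0 pnatr_eq1 gtn_eqF // ltnW. Qed.

(** The constants of the Schouten tensor are chosen to make it a left inverse of the product with
    the metric. Conformal invariance of the Weyl tensor and its vanishing on such products both rest
    on this. *)
Lemma schouten_kulkarni_nomizu P v w : P^T = P ->
  alg_schouten G (kulkarni_nomizu (inner P) (inner G)) v w = inner P v w.
Proof.
move=> Ps; rewrite /alg_schouten ricci_kulkarni_nomizu //.
have -> : metric_trace G (alg_ricci G (kulkarni_nomizu (inner P) (inner G))) =
    (2 * (n%:R - 1)) * metric_trace G (inner P).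
  rewrite (metric_trace_eq G (fun a b => ricci_kulkarni_nomizu a b Ps)).
  by rewrite metric_traceD !metric_traceZ metric_trace_inner; ring.
by field; rewrite n1_neq0.
Qed.

Lemma alg_schoutenB Rm Rm' v w :
  alg_schouten G (fun a b c d => Rm a b c d - Rm' a b c d) v w =
  alg_schouten G Rm v w - alg_schouten G Rm' v w.
Proof.
have E a b : alg_ricci G (fun a b c d => Rm a b c d - Rm' a b c d) a b =
    alg_ricci G Rm a b - alg_ricci G Rm' a b.
  by rewrite /alg_ricci metric_traceD metric_traceN.
rewrite /alg_schouten (metric_trace_eq G E) metric_traceD metric_traceN E.
by field; rewrite n2_neq0 n1_neq0.
Qed.

Lemma alg_schouten_eq G' Rm Rm' v w :
  (forall a b c d, Rm a b c d = Rm' a b c d) ->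
  alg_schouten G' Rm v w = alg_schouten G' Rm' v w.
Proof.
move=> E; have F a b : alg_ricci G' Rm a b = alg_ricci G' Rm' a b.
  by apply: metric_trace_eq => c d; rewrite E.
by rewrite /alg_schouten (metric_trace_eq G' F) F.
Qed.

Lemma alg_schouten_scale c Rm v w : c != 0 ->
  alg_schouten (c *: G) (fun a b d e => c * Rm a b d e) v w =
  alg_schouten G Rm v w.
Proof.
move=> c0; have E a b : alg_ricci (c *: G) (fun a b d e => c * Rm a b d e) a b =
    alg_ricci G Rm a b.
  by rewrite /alg_ricci metric_traceZ metric_trace_scale // mulVKf.
rewrite /alg_schouten (metric_trace_eq _ E) metric_trace_scale // E.
have -> : inner (c *: G) v w = c * inner G v w.
  by rewrite /inner -scalemxAr -scalemxAl mxE.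
by field; rewrite c0 n1_neq0 n2_neq0.
Qed.

(** The product subtracted from the curvature is exactly compensated by the change of the Schouten
    tensor, which itself ignores a simultaneous scaling of metric and curvature. *)
Lemma alg_weyl_conformal c Q Rm Rm' v w z u : c != 0 -> Q^T = Q ->
  (forall a b d e, Rm' a b d e =
    c * (Rm a b d e - kulkarni_nomizu (inner Q) (inner G) a b d e)) ->
  alg_weyl (c *: G) Rm' v w z u = c * alg_weyl G Rm v w z u.
Proof.
move=> c0 Qs E; rewrite /alg_weyl E.
have F a b : alg_schouten (c *: G) Rm' a b = alg_schouten G Rm a b - inner Q a b.
  rewrite (alg_schouten_eq _ _ _ E).
  rewrite (alg_schouten_scale (fun a b d e => Rm a b d e -
    kulkarni_nomizu (inner Q) (inner G) a b d e)) //.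
  by rewrite alg_schoutenB schouten_kulkarni_nomizu.
have H a b : inner (c *: G) a b = c * inner G a b.
  by rewrite /inner -scalemxAr -scalemxAl mxE.
by rewrite /kulkarni_nomizu !F !H; ring.
Qed.

Lemma alg_weyl_flat Q Rm v w z u : Q^T = Q ->
  (forall a b d e, Rm a b d e = kulkarni_nomizu (inner Q) (inner G) a b d e) ->
  alg_weyl G Rm v w z u = 0.
Proof.
move=> Qs E; rewrite /alg_weyl E /kulkarni_nomizu !(alg_schouten_eq _ _ _ E).
by rewrite !schouten_kulkarni_nomizu // subrr.
Qed.

Section Weyl.
Variable Rm : V -> V -> V -> V -> R.
Hypothesis Rm_curv : curvature_tensor Rm.

Definition schouten_mx : 'M[R]_n :=
  \matrix_(i, j) alg_schouten G Rm (basis_vec R i) (basis_vec R j).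

Lemma alg_ricci_sym v w : alg_ricci G Rm v w = alg_ricci G Rm w v.
Proof.
rewrite /alg_ricci -[RHS]metric_trace_swap; apply: metric_trace_eq => a b.
exact: curv_pair.
Qed.

Lemma alg_schouten_sym v w : alg_schouten G Rm v w = alg_schouten G Rm w v.
Proof. by rewrite /alg_schouten alg_ricci_sym [inner G v w]inner_sym. Qed.

Lemma alg_ricci_linear w c u v :
  alg_ricci G Rm (c *: u + v) w = c * alg_ricci G Rm u w + alg_ricci G Rm v w.
Proof.
rewrite /alg_ricci -metric_traceZ -metric_traceD; apply: metric_trace_eq => a b.
exact: curv_linear.
Qed.

Lemma alg_schouten_linear w c u v : alg_schouten G Rm (c *: u + v) w =
  c * alg_schouten G Rm u w + alg_schouten G Rm v w.
Proof. by rewrite /alg_schouten alg_ricci_linear inner_linearl; ring. Qed.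

Lemma schouten_mx_sym : schouten_mx^T = schouten_mx.
Proof. by apply/matrixP => i j; rewrite !mxE alg_schouten_sym. Qed.

Lemma alg_schoutenE v w : alg_schouten G Rm v w = inner schouten_mx v w.
Proof.
have lin z : linear (fun v => alg_schouten G Rm v z : R).
  by move=> c u t; rewrite alg_schouten_linear.
have lin' z : linear (fun v => alg_schouten G Rm z v : R).
  by move=> c u t; rewrite !(alg_schouten_sym z) alg_schouten_linear.
rewrite (linear_row v (lin w)) (linear_row v (inner_linear_form_l schouten_mx w)).
apply: eq_bigr => i _; congr (_ * _).
rewrite (linear_row w (lin' _)) (linear_row w (inner_linear_form schouten_mx _)).
by apply: eq_bigr => j _; rewrite inner_basis mxE.
Qed.

Lemma kulkarni_nomizu_curvature P : P^T = P ->
  curvature_tensor (kulkarni_nomizu (inner P) (inner G)).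
Proof.
move=> Ps; split=> [v z w c u u'|u v z w|u v z w|u v w z];
  rewrite /kulkarni_nomizu ?inner_linearl; try ring.
rewrite [inner P v u]inner_sym // [inner P w u]inner_sym // [inner P w v]inner_sym //.
by rewrite [inner G v u]inner_sym // [inner G w u]inner_sym //
  [inner G w v]inner_sym //; ring.
Qed.

Lemma alg_weylE v w z u : alg_weyl G Rm v w z u =
  Rm v w z u - kulkarni_nomizu (inner schouten_mx) (inner G) v w z u.
Proof. by rewrite /alg_weyl /kulkarni_nomizu !alg_schoutenE. Qed.

Lemma alg_weyl_curvature : curvature_tensor (alg_weyl G Rm).
Proof.
have [K1 K2 K3 K4] := kulkarni_nomizu_curvature schouten_mx_sym.
have [R1 R2 R3 R4] := Rm_curv.
split=> [v z w c u u'|u v z w|u v z w|u v w z]; rewrite !alg_weylE.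
- by rewrite K1 R1; ring.
- by rewrite K2 R2; ring.
- by rewrite K3 R3; ring.
- have := K4 u v w z; have := R4 u v w z; lra.
Qed.

Lemma alg_weyl_traceless v w : alg_ricci G (alg_weyl G Rm) v w = 0.
Proof.
have Cs := schouten_mx_sym.
have -> : alg_ricci G (alg_weyl G Rm) v w = alg_ricci G Rm v w -
    alg_ricci G (kulkarni_nomizu (inner schouten_mx) (inner G)) v w.
  rewrite /alg_ricci -metric_traceN -metric_traceD.
  by apply: metric_trace_eq => a b; rewrite alg_weylE.
rewrite ricci_kulkarni_nomizu // -alg_schoutenE.
have -> : metric_trace G (inner schouten_mx) =
   metric_trace G (alg_ricci G Rm) / (2 * (n%:R - 1)).
  rewrite -(metric_trace_eq G alg_schoutenE) /alg_schouten metric_traceZ.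
  rewrite metric_traceD metric_traceN metric_traceZ metric_trace_inner.
  by field; rewrite n1_neq0 n2_neq0.
by rewrite /alg_schouten; field; rewrite n1_neq0 n2_neq0.
Qed.

End Weyl.
End Trace.
End CurvatureTensors.

Lemma riem_curvature_tensor (R : realType) (n : nat) (U : set 'rV[R]_n) g x :
  metric_on U g -> U x -> curvature_tensor (riem g x).
Proof.
move=> gU Ux; split.
- move=> v z w c u u'; rewrite !(riemE gU _ _ _ _ Ux).
  have -> : curvature_mx g (c *: u + u') v x =
      c *: curvature_mx g u v x + curvature_mx g u' v x.
    exact (curvature_linear gU v Ux c u u').
  move: (curvature_mx g u v x) (curvature_mx g u' v x) (g x) => A B G.
  by rewrite mulmxDl -scalemxAl inner_linear_mx; ring.
- move=> u v z w; rewrite !(riemE gU _ _ _ _ Ux) curvature_antisym.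
  move: (curvature_mx g v u x) => A.
  by rewrite /inner mulNmx mulmxN mulNmx mxE.
- move=> u v z w; rewrite !(riemE gU _ _ _ _ Ux).
  have := curvature_metric gU u v Ux; have := metric_sym gU Ux.
  move: (curvature_mx g u v x) (g x) => A G Gs E.
  have E' p q : inner (A *m G) p q = inner G (p *m A) q by rewrite /inner mulmxA.
  by rewrite !E' (skew_inner _ _ Gs E).
- move=> u v w z; rewrite !(riemE gU _ _ _ _ Ux).
  have := curvature_bianchi1 gU u v w Ux.
  move: (curvature_mx g u v x) (curvature_mx g v w x) (curvature_mx g w u x) (g x).
  move=> A B C G E; rewrite -!opprD; apply/eqP; rewrite oppr_eq0; apply/eqP.
  have E' (X : 'M[R]_n) p q : inner (X *m G) p q = ((p *m X) *m G *m q^T) 0 0.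
    by rewrite /inner mulmxA.
  rewrite !E'; have : ((w *m A + u *m B + v *m C) *m G *m z^T) 0 0 = 0.
    by rewrite E !mul0mx mxE.
  by rewrite !mulmxDl !mxE.
Qed.

(** * Conformal Jacobi operators *)

Lemma mup_prod_XsubC (F : fieldType) (r : seq F) (x : F) :
  mup x (\prod_(z <- r) ('X - z%:P)) = count_mem x r.
Proof.
elim: r => [|z r IH]; first by rewrite big_nil mupNroot // root1.
rewrite big_cons mupM ?polyXsubC_eq0 //; last first.
  by rewrite monic_neq0 // monic_prod_XsubC.
by rewrite IH /= -['X - z%:P]expr1 mup_XsubCX; case: eqVneq.
Qed.

Lemma monic_eq_mup (F : closedFieldType) (p q : {poly F}) :
  p \is monic -> q \is monic -> (forall x, mup x p = mup x q) -> p = q.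
Proof.
move=> /monicP lp /monicP lq.
have [r] := closed_field_poly_normal p; have [s] := closed_field_poly_normal q.
rewrite lp lq !scale1r => -> -> E; apply: perm_big; apply/allP => x _ /=.
by have := E x; rewrite !mup_prod_XsubC => ->.
Qed.

(** The determinant of the factorization X^2 - A^2 = (X - A)(X + A). It shows that [char_poly A]
    determines [char_poly (A *m A)], and so the trace of the square, over any commutative ring. *)
Lemma char_poly_sqr (F : comNzRingType) n (A : 'M[F]_n) :
  char_poly (A *m A) \Po 'X^2 =
  char_poly A * ((-1) ^+ n * (char_poly A \Po - 'X)).
Proof.
have C (q : {poly F}) (B : 'M[F]_n) :
    char_poly B \Po q = \det (q%:M - map_mx polyC B).
  rewrite /char_poly /char_poly_mx -(det_map_mx (comp_poly q)).
  rewrite map_mxB map_scalar_mx /= comp_polyX; congr (\det (_ - _)).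
  by apply/matrixP => i j; rewrite !mxE comp_polyC.
rewrite !C -detZ -det_mulmx; congr (\det _).
rewrite map_mxM scaleN1r opprB.
have -> : (- 'X)%:M = - ('X%:M : 'M[{poly F}]_n).
  by apply/matrixP => i j; rewrite !mxE mulNrn.
rewrite opprK mulmxDr !mulmxBl -scalar_mxM mul_scalar_mx mul_mx_scalar -expr2.
by rewrite [RHS]addrC addrA subrK.
Qed.

Lemma comp_poly_X2_inj (F : nzRingType) (p q : {poly F}) :
  p \Po 'X^2 = q \Po 'X^2 -> p = q.
Proof.
move=> E; apply/polyP => i; have := congr1 (fun r : {poly F} => r`_(i * 2)) E.
by rewrite !coef_comp_poly_Xn // dvdn_mull // mulnK.
Qed.

Lemma char_poly_eq_trace_sqr (F : comNzRingType) n (A B : 'M[F]_n) :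
  char_poly A = char_poly B -> \tr (A *m A) = \tr (B *m B).
Proof.
(* In size 0 there is no subleading coefficient from which a trace could be read. *)
case: n A B => [A B _|n A B E]; first by rewrite /mxtrace !big_ord0.
have c2 : char_poly (A *m A) = char_poly (B *m B).
  by apply: comp_poly_X2_inj; rewrite !char_poly_sqr E.
by apply: oppr_inj; rewrite -!char_poly_trace // c2.
Qed.

Lemma eigen_mult_trace_sqr (R : realType) n (A B : 'M[R]_n) :
  (forall l, eigen_mult A l = eigen_mult B l) -> \tr (A *m A) = \tr (B *m B).
Proof.
move=> E; apply: (fmorph_inj (real_complex R)).
have M (X : 'M[R]_n) : \tr (map_mx (real_complex R) X *m map_mx (real_complex R) X)
    = real_complex R (\tr (X *m X)) by rewrite -map_mxM trace_map_mx.
apply: etrans (esym (M A)) (etrans _ (M B)).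
apply: char_poly_eq_trace_sqr; apply: monic_eq_mup => //.
  exact: char_poly_monic.
exact: char_poly_monic.
Qed.

(** * Orthonormal bases for forms of arbitrary signature *)

Lemma entry_inner (R : realType) n p (G : 'M[R]_n) (Q : 'M[R]_(p, n)) i j :
  (Q *m G *m Q^T) i j = inner G (row i Q) (row j Q).
Proof.
rewrite /inner tr_row -!row_mul !mxE.
by apply: eq_bigr => k _; rewrite !mxE.
Qed.

(** Gram-Schmidt with pivoting: the form may be indefinite, so a vector of nonzero square norm has
    to be produced before each elimination step. *)
Lemma orthonormal_basis (R : realType) n (G : 'M[R]_n) :
  G^T = G -> G \in unitmx -> exists (E : 'M[R]_n) (e : 'rV[R]_n),
    E *m G *m E^T = diag_mx e /\ forall i, e 0 i = 1 \/ e 0 i = -1.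
Proof.
elim: n G => [G _ _|n IH G Gs Gu].
  by exists 0, 0; split=> [|[]//]; apply/matrixP => -[].
(* If some diagonal entry is nonzero, a transposition brings it to the front. Otherwise e_0 is
   replaced by e_0 + e_j with [G 0 j] nonzero, whose square norm is 2 [G 0 j]. *)
have [P [Pu P00]] : exists P : 'M[R]_n.+1, P \in unitmx /\ (P *m G *m P^T) 0 0 != 0.
  have perm_ok (H : 'M[R]_n.+1) i : H i i != 0 ->
      (tperm_mx 0 i *m H *m (tperm_mx 0 i)^T) 0 0 != 0.
    rewrite entry_inner (_ : row 0 _ = basis_vec R i) ?inner_basis //.
    by apply/rowP => j; rewrite !mxE tpermL eqxx eq_sym.
  have [[i Gii]|/forallNP Gd] := pselect (exists i, G i i != 0).
    by exists (tperm_mx 0 i); split; [exact: unitmx_perm|exact: perm_ok].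
  have G0 i : G i i = 0 by apply/eqP; have /negP := Gd i; rewrite negbK.
  have [j Gj] : exists j, G ord0 j != 0.
    apply: contrapT => /forallNP Z; have : row ord0 G = 0.
      apply/rowP => j; rewrite !mxE; apply/eqP.
      by have /negP := Z j; rewrite negbK.
    move=> r0; have : row ord0 (G *m invmx G) = 0 by rewrite row_mul r0 mul0mx.
    rewrite mulmxV // => /rowP /(_ ord0) /eqP.
    by rewrite !mxE eqxx oner_eq0.
  pose Q : 'M[R]_n.+1 := 1%:M + delta_mx ord0 j.
  have j0 : j != ord0 by apply: contraNneq Gj => ->; rewrite G0.
  have dd : delta_mx ord0 j *m delta_mx ord0 j = 0 :> 'M[R]_n.+1.
    by rewrite mul_delta_mx_0.
  have Qu : Q \in unitmx.
    have : Q *m (1%:M - delta_mx ord0 j) = 1%:M.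
      by rewrite /Q mulmxDl mul1mx mulmxBr mulmx1 dd subr0 subrK.
    by move/mulmx1_unit => [].
  exists Q; split=> //.
  rewrite entry_inner (_ : row 0 Q = 1 *: basis_vec R 0 + basis_vec R j).
    rewrite !inner_linearl !inner_linearr !inner_basis !G0 !mul1r.
    have -> : G j 0 = G 0 j by rewrite -{1}Gs mxE.
    by rewrite addr0 add0r -mulr2n mulrn_eq0.
  by rewrite /Q linearD /= row1 rowE mul_delta_mx scale1r.
have [H HE] : exists H : 'M[R]_(1 + n), H = (P *m G *m P^T : 'M[R]_(n.+1)).
  by exists (P *m G *m P^T).
rewrite -HE in P00; pose a := H 0 0.
have Hs : H^T = H by rewrite HE !trmx_mul trmxK Gs mulmxA.
have Hu : H \in unitmx by rewrite HE !unitmx_mul Pu Gu unitmx_tr.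
pose b := ursubmx H; pose D := drsubmx H.
have HbE : H = block_mx a%:M b b^T D.
  have <- : ulsubmx H = a%:M.
    apply/matrixP => i j; rewrite !ord1 [RHS]mxE mulr1n /a !mxE.
    have -> : lshift n (0 : 'I_1) = 0 :> 'I_n.+1 by apply: val_inj.
    by [].
  have <- : dlsubmx H = b^T by rewrite /b trmx_ursub Hs.
  by rewrite submxK.
(* One step of elimination. The Schur complement [D'] is again symmetric and invertible, as the
   induction demands, and the pivot is then normalized by 1 / sqrt |a|. *)
pose L : 'M[R]_(1 + n) := block_mx 1%:M 0 (- a^-1 *: b^T) 1%:M.
pose D' := D - a^-1 *: (b^T *m b).
have LHL : L *m H *m L^T = block_mx a%:M 0 0 D'.
  rewrite HbE /L tr_block_mx !mulmx_block !trmx1 !trmx0 trmxZ trmxK.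
  rewrite !(mul0mx, mulmx0, mul1mx, mulmx1, addr0).
  have e1 : a%:M *m (- a^-1 *: b) + b = 0.
    by rewrite mul_scalar_mx scalerA mulrN mulfV // scaleN1r addNr.
  have e2 : - a^-1 *: b^T *m a%:M + b^T = 0.
    by rewrite mul_mx_scalar scalerA mulrN mulfV // scaleN1r addNr.
  by rewrite e1 e2 mul0mx add0r /D' -scalemxAl scaleNr [- _ + D]addrC.
have Lu : L \in unitmx by rewrite unitmxE /L det_lblock !det1 mulr1 unitr1.
have D's : D'^T = D'.
  have -> : D' = drsubmx (L *m H *m L^T) by rewrite LHL block_mxKdr.
  by rewrite trmx_drsub !trmx_mul trmxK Hs mulmxA.
have D'u : D' \in unitmx.
  have : L *m H *m L^T \in unitmx by rewrite !unitmx_mul Lu Hu unitmx_tr.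
  by rewrite LHL !unitmxE det_ublock unitrM => /andP[].
have [E [e [EE e1]]] := IH D' D's D'u.
pose c := (Num.sqrt `|a|)^-1.
exists ((block_mx c%:M 0 0 E : 'M[R]_(1 + n)) *m L *m P).
exists (row_mx (Num.sg a)%:M e : 'rV[R]_(1 + n)); split; last first.
  suff S (i : 'I_(1 + n)) : row_mx (Num.sg a)%:M e 0 i = 1 \/
      row_mx (Num.sg a)%:M e 0 i = -1 by exact: S.
  case: (split_ordP i) => j ->.
    rewrite row_mxEl !ord1 mxE mulr1n; case: (ltrgt0P a) => [a0|a0|a0].
    - by left; exact: gtr0_sg.
    - by right; exact: ltr0_sg.
    - by move: P00; rewrite -/a a0 eqxx.
  by rewrite row_mxEr.
set K := block_mx _ _ _ _.
have -> : K *m L *m P *m G *m (K *m L *m P)^T = K *m (L *m H *m L^T) *m K^T.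
  by rewrite HE !trmx_mul !mulmxA.
rewrite LHL /K tr_block_mx !mulmx_block !trmx0 tr_scalar_mx.
rewrite !(mul0mx, mulmx0, addr0, add0r) EE -!scalar_mxM.
have -> : c * a * c = Num.sg a.
  have a0 : `|a| != 0 by rewrite normr_eq0.
  rewrite mulrAC -invfM -expr2 sqr_sqrtr // {2}[a]numEsg mulrCA mulVf //.
  by rewrite mulr1.
apply: etrans (esym (diag_mx_row (Num.sg a)%:M e)).
by congr block_mx; apply/matrixP => i j; rewrite !ord1 !mxE.
Qed.

(** * Trace-free curvature tensors in four dimensions with a reflection symmetry *)

Section ReflectiveWeyl.
Variables (R : realType) (n : nat).
Local Notation V := 'rV[R]_n.
Variable W : V -> V -> V -> V -> R.
Hypothesis cW : curvature_tensor W.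

Let A12 := curv_anti12 cW.
Let A34 := curv_anti34 cW.
Let PW := curv_pair cW.

Lemma curv_diag12 u z w : W u u z w = 0.
Proof. by have := A12 u u z w; lra. Qed.

Lemma curv_diag34 u z w : W z w u u = 0.
Proof. by rewrite PW curv_diag12. Qed.

Lemma curv_quadratic (c d : R) u v x y : W (c *: u + d *: v) x (c *: u + d *: v) y =
  c ^+ 2 * W u x u y + c * d * (W u x v y + W v x u y) + d ^+ 2 * W v x v y.
Proof.
have L z t r : W (c *: u + d *: v) z t r = c * W u z t r + d * W v z t r.
  have E := curv_linear cW z t r d v 0; rewrite addr0 in E.
  have Z : W 0 z t r = 0.
    by have := curv_linear cW z t r 1 0 0; rewrite scale1r addr0; lra.
  by rewrite (curv_linear cW) E Z addr0.
rewrite L !(PW _ x (_ + _) y) !L !(PW _ y _ x); ring.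
Qed.

Section Basis.
Variables (f0 f1 f2 f3 : V) (s0 s1 s2 s3 : R).
Hypotheses (s0E : s0 = 1 \/ s0 = -1) (s1E : s1 = 1 \/ s1 = -1).
Hypotheses (s2E : s2 = 1 \/ s2 = -1) (s3E : s3 = 1 \/ s3 = -1).
Hypothesis traceless : forall v w, s0 * W v f0 w f0 + s1 * W v f1 w f1
  + s2 * W v f2 w f2 + s3 * W v f3 w f3 = 0.

(** The trace of the squared Jacobi operator of [v] in an orthonormal basis with signs [s0], ...,
    [s3]: squares of signs are already replaced by 1, and the symmetric off-diagonal terms are
    counted twice. *)
Definition jacobi_trace_sqr v : R :=
  let q x y := W v x v y ^+ 2 in
  q f0 f0 + q f1 f1 + q f2 f2 + q f3 f3
  + 2 * (s0 * s1 * q f0 f1 + s0 * s2 * q f0 f2 + s0 * s3 * q f0 f3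
         + s1 * s2 * q f1 f2 + s1 * s3 * q f1 f3 + s2 * s3 * q f2 f3).

Let F x := [\/ x = f1, x = f2 | x = f3].
Hypothesis reflective : forall x y z, F x -> F y -> F z -> W f0 x y z = 0.

Let F1 : F f1. Proof. by constructor. Qed.
Let F2 : F f2. Proof. by constructor. Qed.
Let F3 : F f3. Proof. by constructor. Qed.

(** By [reflective], components containing [f0] exactly once vanish, as if the tensor were invariant
    under the reflection of [f0]. This removes the cross terms in c d from the entries that do not
    involve [f0] or [f1]. *)
Lemma jacobi_trace_sqr_direction (c d : R) :
  jacobi_trace_sqr (c *: f0 + d *: f1) =
  W f0 f1 f0 f1 ^+ 2 * ((d ^+ 2) ^+ 2 + (c ^+ 2) ^+ 2 + 2 * s0 * s1 * c ^+ 2 * d ^+ 2)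
  + 2 * (s0 * s2 * c ^+ 2 * d ^+ 2 + s1 * s2 * (c ^+ 2) ^+ 2) * W f0 f1 f0 f2 ^+ 2
  + 2 * (s0 * s3 * c ^+ 2 * d ^+ 2 + s1 * s3 * (c ^+ 2) ^+ 2) * W f0 f1 f0 f3 ^+ 2
  + (c ^+ 2 * W f0 f2 f0 f2 + d ^+ 2 * W f1 f2 f1 f2) ^+ 2
  + (c ^+ 2 * W f0 f3 f0 f3 + d ^+ 2 * W f1 f3 f1 f3) ^+ 2
  + 2 * s2 * s3 * (c ^+ 2 * W f0 f2 f0 f3 + d ^+ 2 * W f1 f2 f1 f3) ^+ 2.
Proof.
rewrite /jacobi_trace_sqr !curv_quadratic !(curv_diag12, curv_diag34).
have E x y : F x -> F y -> W f1 x f0 y = 0 /\ W f0 x f1 y = 0.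
  by move=> Fx Fy; rewrite (PW f1 x) !reflective.
have [-> ->] := E _ _ F2 F2; have [-> ->] := E _ _ F3 F3.
have [-> ->] := E _ _ F2 F3.
have -> : W f1 f0 f1 f0 = W f0 f1 f0 f1 by rewrite A12 A34 opprK.
have -> : W f1 f0 f0 f1 = - W f0 f1 f0 f1 by rewrite A12.
have -> : W f1 f0 f0 f2 = - W f0 f1 f0 f2 by rewrite A12.
have -> : W f1 f0 f0 f3 = - W f0 f1 f0 f3 by rewrite A12.
have -> : W f1 f0 f1 f2 = 0 by rewrite A12 reflective ?oppr0.
have -> : W f1 f0 f1 f3 = 0 by rewrite A12 reflective ?oppr0.
have -> : W f0 f1 f1 f2 = 0 by rewrite reflective.
have -> : W f0 f1 f1 f3 = 0 by rewrite reflective.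
ring.
Qed.

Hypothesis osserman : forall c d : R, c ^+ 2 * s0 + d ^+ 2 * s1 = s0 ->
  jacobi_trace_sqr (c *: f0 + d *: f1) = jacobi_trace_sqr f0.

(** With u equal to [s1] times the first left side and w the second one, the condition at c f0 + d
    f1 reduces to d^2 (u + c^2 w) = 0. Two admissible values of c^2 with d nonzero then give u = w =
    0. *)
Lemma reflective_direction :
  s2 * W f0 f1 f0 f2 ^+ 2 + s3 * W f0 f1 f0 f3 ^+ 2 = 0 /\
  (s2 * W f0 f2 f0 f2 - s3 * W f0 f3 f0 f3) ^+ 2
    + 4 * s2 * s3 * W f0 f2 f0 f3 ^+ 2 = 0.
Proof.
have T (c d : R) : c ^+ 2 * s0 + d ^+ 2 * s1 = s0 ->
    jacobi_trace_sqr (c *: f0 + d *: f1) = jacobi_trace_sqr (1 *: f0 + 0 *: f1).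
  by rewrite scale1r scale0r addr0; exact: osserman.
(* The triples 3-4-5 and 5-12-13 give two rational points on the circle when [s0 = s1], and on the
   hyperbola when the signs differ. *)
have [a [b [a' [b' [ab ab' abE]]]]] : exists a b a' b' : R,
    [/\ a ^+ 2 * s0 + b ^+ 2 * s1 = s0, a' ^+ 2 * s0 + b' ^+ 2 * s1 = s0 &
      (s0 = s1 /\ [/\ a ^+ 2 = 9/25, b ^+ 2 = 16/25, a' ^+ 2 = 25/169 & b' ^+ 2 = 144/169])
     \/ (s0 = - s1 /\ [/\ a ^+ 2 = 25/9, b ^+ 2 = 16/9, a' ^+ 2 = 169/25 & b' ^+ 2 = 144/25])].
  case: s0E s1E => -> [] ->.
  - exists (3/5), (4/5), (5/13), (12/13); split; try lra.
    by left; split=> //; split; lra.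
  - exists (5/3), (4/3), (13/5), (12/5); split; try lra.
    by right; split; [lra|split; lra].
  - exists (5/3), (4/3), (13/5), (12/5); split; try lra.
    by right; split; [lra|split; lra].
  - exists (3/5), (4/5), (5/13), (12/13); split; try lra.
    by left; split=> //; split; lra.
have := T a b ab; have := T a' b' ab'; rewrite !jacobi_trace_sqr_direction.
move=> T1 T2 {T}.
have := traceless f0 f0; have := traceless f1 f1; have := traceless f2 f2.
have := traceless f3 f3; have := traceless f2 f3.
rewrite !(curv_diag12, curv_diag34).
have flip x y z t : W x y z t = W y x t z by rewrite A12 A34 opprK.
rewrite (flip f1 f0) (flip f2 f0 f2) (flip f2 f1 f2) (flip f3 f0) (flip f3 f1).
rewrite (flip f3 f2) (flip f2 f0) (flip f2 f1).
move: (W f0 f1 f0 f1) (W f0 f2 f0 f2) (W f0 f3 f0 f3) (W f0 f1 f0 f2)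
  (W f0 f1 f0 f3) (W f0 f2 f0 f3) (W f1 f2 f1 f2) (W f1 f3 f1 f3)
  (W f1 f2 f1 f3) (W f2 f3 f2 f3) T1 T2.
move=> E11 E22 E33 E12 E13 E23 X Y Z Q T1 T2 t23 t33 t22 t11 t00.
have q (s : R) : s = 1 \/ s = -1 -> s * s = 1 by case=> ->; rewrite ?mulrNN mulr1.
have [q1 q2 q3] := And3 (q _ s1E) (q _ s2E) (q _ s3E).
have M (c x : R) : x = 0 -> c * x = 0 by move=> ->; rewrite mulr0.
have e0 := M s0 _ t00; have e1 := M s1 _ t11; have e2 := M s2 _ t22.
have e3 := M s3 _ t33; have e4 := M s1 _ t23.
(* In dimension four trace-freeness expresses the components along f1 f2 and f1 f3 by the electric
   part, with the complementary index. Afterwards only the electric part is left in the two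
   equations. *)
have XE : X = (s0 * s1) * (s2 * s3 * E33).
  have H : s1 * s2 * X = s0 * s3 * E33 by lra.
  transitivity (s1 * s1 * (s2 * s2) * X); first by rewrite q1 q2 !mul1r.
  by transitivity (s1 * s2 * (s1 * s2 * X)); [ring|rewrite H; ring].
have YE : Y = (s0 * s1) * (s2 * s3 * E22).
  have H : s1 * s3 * Y = s0 * s2 * E22 by lra.
  transitivity (s1 * s1 * (s3 * s3) * Y); first by rewrite q1 q3 !mul1r.
  by transitivity (s1 * s3 * (s1 * s3 * Y)); [ring|rewrite H; ring].
have ZE : Z = - (s0 * s1) * E23.
  have H : s1 * s1 * Z = - (s0 * s1) * E23 by lra.
  by rewrite -H q1 mul1r.
pose m := s2 * s3; have mm : m * m = 1 by rewrite /m mulrACA q2 q3 mulr1.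
have sqr (c d x y : R) : (c * x + d * (m * y)) ^+ 2 =
    c ^+ 2 * x ^+ 2 + d ^+ 2 * y ^+ 2 + 2 * c * d * (m * x * y).
  transitivity (c ^+ 2 * x ^+ 2 + d ^+ 2 * y ^+ 2 * (m * m) + 2 * c * d * (m * x * y)).
    by ring.
  by rewrite mm mulr1.
have s1K x : s1 * x = 0 -> x = 0.
  by move=> H; rewrite -[x]mul1r -q1 -mulrA H mulr0.
suff [u0 w0] : s1 * (s2 * E12 ^+ 2 + s3 * E13 ^+ 2) = 0 /\
    E22 ^+ 2 + E33 ^+ 2 - 2 * (m * E22 * E33) + 4 * (m * E23 ^+ 2) = 0.
  split; first exact: s1K.
  transitivity (s2 * s2 * E22 ^+ 2 + s3 * s3 * E33 ^+ 2 - 2 * (m * E22 * E33)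
    + 4 * (m * E23 ^+ 2)); first by rewrite /m; ring.
  by rewrite q2 q3 !mul1r.
have ss x : 2 * s2 * s3 * x = 2 * (m * x) by rewrite /m !mulrA.
move: T1 T2; rewrite XE YE ZE !ss -/m.
move: m sqr {q M XE YE ZE e0 e1 e2 e3 e4 t00 t11 t22 t33 t23 mm ss X Y Z Q ab ab' s1K}.
move=> m sqr; case: abE => [[s01 [-> -> -> ->]]|[s01 [-> -> -> ->]]].
  have -> : s0 * s1 = 1 by rewrite s01.
  have s01' (x : R) : 2 * s0 * s1 * x = 2 * x by rewrite s01 -(mulrA 2) q1 mulr1.
  by rewrite -!(mulrA (2 * s0 * s1)) !s01' !mul1r s01 !sqr => H1 H2; split; lra.
have -> : s0 * s1 = -1 by rewrite s01 mulNr q1.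
have s01' (x : R) : 2 * s0 * s1 * x = - (2 * x).
  by rewrite s01 -(mulrA 2) mulNr q1 mulrN1 mulNr.
rewrite -!(mulrA (2 * s0 * s1)) !s01' !mulN1r -!mulrN s01 !sqr => H1 H2; split; lra.
Qed.
End Basis.

Lemma jacobi_trace_sqr_swap12 f0 f1 f2 f3 s0 s1 s2 s3 v :
  jacobi_trace_sqr f0 f1 f2 f3 s0 s1 s2 s3 v =
  jacobi_trace_sqr f0 f2 f1 f3 s0 s2 s1 s3 v.
Proof.
rewrite /jacobi_trace_sqr (PW v f2 v f1).
move: (W v f0 v f0) (W v f1 v f1) (W v f2 v f2) (W v f3 v f3).
move: (W v f0 v f1) (W v f0 v f2) (W v f0 v f3) (W v f1 v f2) (W v f1 v f3).
by move: (W v f2 v f3) => *; ring.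
Qed.

Lemma jacobi_trace_sqr_swap23 f0 f1 f2 f3 s0 s1 s2 s3 v :
  jacobi_trace_sqr f0 f1 f2 f3 s0 s1 s2 s3 v =
  jacobi_trace_sqr f0 f1 f3 f2 s0 s1 s3 s2 v.
Proof.
rewrite /jacobi_trace_sqr (PW v f3 v f2).
move: (W v f0 v f0) (W v f1 v f1) (W v f2 v f2) (W v f3 v f3).
move: (W v f0 v f1) (W v f0 v f2) (W v f0 v f3) (W v f1 v f2) (W v f1 v f3).
by move: (W v f2 v f3) => *; ring.
Qed.

(* Among three signs two agree, and a definite two-dimensional form has no
   nonzero isotropic vector. *)
Lemma electric_part_eq0 (s1 s2 s3 E11 E22 E33 E12 E13 E23 : R) :
  (s1 = 1 \/ s1 = -1) -> (s2 = 1 \/ s2 = -1) -> (s3 = 1 \/ s3 = -1) ->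
  s1 * E11 + s2 * E22 + s3 * E33 = 0 ->
  s2 * E12 ^+ 2 + s3 * E13 ^+ 2 = 0 -> s1 * E12 ^+ 2 + s3 * E23 ^+ 2 = 0 ->
  s1 * E13 ^+ 2 + s2 * E23 ^+ 2 = 0 ->
  (s2 * E22 - s3 * E33) ^+ 2 + 4 * s2 * s3 * E23 ^+ 2 = 0 ->
  (s1 * E11 - s3 * E33) ^+ 2 + 4 * s1 * s3 * E13 ^+ 2 = 0 ->
  [/\ E11 = 0, E22 = 0 & E33 = 0] /\ [/\ E12 = 0, E13 = 0 & E23 = 0].
Proof.
move=> h1 h2 h3 tr A1 A2 A3 B1 B2.
have sq (x : R) : x ^+ 2 = 0 -> x = 0 by move/eqP; rewrite sqrf_eq0 => /eqP.
have [z12 [z13 z23]] : E12 = 0 /\ E13 = 0 /\ E23 = 0.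
  suff [q12 [q13 q23]] : E12 ^+ 2 = 0 /\ E13 ^+ 2 = 0 /\ E23 ^+ 2 = 0.
    by split; [|split]; exact: sq.
  have := sqr_ge0 E12; have := sqr_ge0 E13; have := sqr_ge0 E23.
  move: (E12 ^+ 2) (E13 ^+ 2) (E23 ^+ 2) A1 A2 A3 {B1 B2 tr} => x y z.
  case: h1 h2 h3 => -> [] -> [] -> A1 A2 A3 z0 y0 x0; split; [|split| | split
   | |split| |split| |split| |split| |split| |split]; lra.
rewrite z23 z13 expr0n /= !mulr0 !addr0 in B1 B2.
have e1 := sq _ B1; have e2 := sq _ B2.
by split; [|split=> //]; case: h1 h2 h3 tr e1 e2 => -> [] -> [] -> *; split; lra.
Qed.

(** [reflective_direction] is used with [f1], [f2] and [f3] in turn as second vector, after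
    relabelling. Once the electric part is zero, trace-freeness becomes a linear system that kills
    the components among [f1], [f2], [f3]. *)
Lemma reflective_weyl_eq0 f0 f1 f2 f3 (s0 s1 s2 s3 : R) :
  (s0 = 1 \/ s0 = -1) -> (s1 = 1 \/ s1 = -1) ->
  (s2 = 1 \/ s2 = -1) -> (s3 = 1 \/ s3 = -1) ->
  (forall v w, s0 * W v f0 w f0 + s1 * W v f1 w f1
    + s2 * W v f2 w f2 + s3 * W v f3 w f3 = 0) ->
  (forall x y z, [\/ x = f1, x = f2 | x = f3] -> [\/ y = f1, y = f2 | y = f3] ->
     [\/ z = f1, z = f2 | z = f3] -> W f0 x y z = 0) ->
  (forall s x, (s = s1 /\ x = f1) \/ (s = s2 /\ x = f2) \/ (s = s3 /\ x = f3) ->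
    forall c d : R, c ^+ 2 * s0 + d ^+ 2 * s = s0 ->
    jacobi_trace_sqr f0 f1 f2 f3 s0 s1 s2 s3 (c *: f0 + d *: x) =
    jacobi_trace_sqr f0 f1 f2 f3 s0 s1 s2 s3 f0) ->
  forall x y z t, x \in [:: f0; f1; f2; f3] -> y \in [:: f0; f1; f2; f3] ->
    z \in [:: f0; f1; f2; f3] -> t \in [:: f0; f1; f2; f3] -> W x y z t = 0.
Proof.
move=> h0 h1 h2 h3 tr refl oss.
have [A1 B1] := reflective_direction h0 h1 h2 h3 tr refl
  (oss s1 f1 (or_introl (conj erefl erefl))).
have tr2 v w : s0 * W v f0 w f0 + s2 * W v f2 w f2 + s1 * W v f1 w f1
    + s3 * W v f3 w f3 = 0 by rewrite -[RHS](tr v w); ring.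
have refl2 x y z : [\/ x = f2, x = f1 | x = f3] -> [\/ y = f2, y = f1 | y = f3] ->
    [\/ z = f2, z = f1 | z = f3] -> W f0 x y z = 0.
  by move=> hx hy hz; apply: refl; [case: hx|case: hy|case: hz] => ->;
    by [constructor 1|constructor 2|constructor 3].
have [A2 B2] := reflective_direction h0 h2 h1 h3 tr2 refl2 (fun c d E =>
  etrans (esym (jacobi_trace_sqr_swap12 _ _ _ _ _ _ _ _ _))
   (etrans (oss s2 f2 (or_intror (or_introl (conj erefl erefl))) c d E)
     (jacobi_trace_sqr_swap12 _ _ _ _ _ _ _ _ _))).
have tr3 v w : s0 * W v f0 w f0 + s3 * W v f3 w f3 + s1 * W v f1 w f1
    + s2 * W v f2 w f2 = 0 by rewrite -[RHS](tr v w); ring.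
have refl3 x y z : [\/ x = f3, x = f1 | x = f2] -> [\/ y = f3, y = f1 | y = f2] ->
    [\/ z = f3, z = f1 | z = f2] -> W f0 x y z = 0.
  by move=> hx hy hz; apply: refl; [case: hx|case: hy|case: hz] => ->;
    by [constructor 1|constructor 2|constructor 3].
have S3 v : jacobi_trace_sqr f0 f1 f2 f3 s0 s1 s2 s3 v =
    jacobi_trace_sqr f0 f3 f1 f2 s0 s3 s1 s2 v.
  by rewrite jacobi_trace_sqr_swap23 jacobi_trace_sqr_swap12.
have [A3 _] := reflective_direction h0 h3 h1 h2 tr3 refl3 (fun c d E =>
  etrans (esym (S3 _))
   (etrans (oss s3 f3 (or_intror (or_intror (conj erefl erefl))) c d E) (S3 _))).
have t00 := tr f0 f0; rewrite curv_diag12 mulr0 add0r in t00.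
rewrite [W f0 f2 f0 f1]PW in A2 B2; rewrite [W f0 f3 f0 f1]PW in A3.
rewrite [W f0 f3 f0 f2]PW in A3.
have [[E11 E22 E33] [E12 E13 E23]] :=
  electric_part_eq0 h1 h2 h3 t00 A1 A2 A3 B1 B2.
have E21 : W f0 f2 f0 f1 = 0 by rewrite PW.
have E31 : W f0 f3 f0 f1 = 0 by rewrite PW.
have E32 : W f0 f3 f0 f2 = 0 by rewrite PW.
have flip x y z t : W x y z t = W y x t z by rewrite A12 A34 opprK.
have t11 := tr f1 f1; have t22 := tr f2 f2; have t33 := tr f3 f3.
have t12 := tr f1 f2; have t13 := tr f1 f3; have t23 := tr f2 f3.
rewrite !(curv_diag12, curv_diag34) in t11 t22 t33 t12 t13 t23.
rewrite !(flip _ f0) ?E11 ?E22 ?E33 ?E12 ?E13 ?E23 in t11 t22 t33 t12 t13 t23.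
rewrite (flip f2 f1) (flip f3 f1) ?(flip f3 f2) in t22 t33 t23 t11 t12 t13.
have X0 : W f1 f2 f1 f2 = 0.
  by case: h1 h2 h3 t11 t22 t33 {t12 t13 t23 tr refl oss tr2 refl2 tr3 refl3
    S3 A1 A2 A3 B1 B2 flip} => -> [] -> [] -> *; lra.
have Y0 : W f1 f3 f1 f3 = 0.
  by case: h2 h3 t11 {t22 t33 t12 t13 t23 tr refl oss tr2 refl2 tr3 refl3
    S3 A1 A2 A3 B1 B2 flip} => -> [] -> *; lra.
have Q0 : W f2 f3 f2 f3 = 0.
  by case: h1 h3 t22 {t11 t33 t12 t13 t23 tr refl oss tr2 refl2 tr3 refl3
    S3 A1 A2 A3 B1 B2 flip} => -> [] -> *; lra.
have s_neq0 (s u : R) : (s = 1 \/ s = -1) -> s * u = 0 -> u = 0.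
  by case=> ->; rewrite ?mul1r // mulN1r => /eqP; rewrite oppr_eq0 => /eqP.
rewrite !mulr0 ?addr0 ?add0r in t12 t13 t23.
have Z1 : W f1 f2 f1 f3 = 0 by rewrite flip; exact: s_neq0 t23.
have Z2 : W f1 f3 f2 f3 = 0 by exact: s_neq0 t12.
have Z3 : W f1 f2 f2 f3 = 0 by rewrite A34 (s_neq0 _ _ h2 t13) oppr0.
pose F x := [\/ x = f1, x = f2 | x = f3].
(* A second [f0] in the first pair gives zero by antisymmetry, one in the second pair leads to the
   electric part, and with no further [f0] the reflection hypothesis applies. *)
have D0 y z t : y = f0 \/ F y -> z = f0 \/ F z -> t = f0 \/ F t -> W f0 y z t = 0.
  case=> [->|Fy]; first by rewrite curv_diag12.
  case=> [->|Fz]; case=> [->|Ft]; rewrite ?curv_diag34 //; last exact: refl.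
    by case: Fy => ->; case: Ft => ->.
  by rewrite A34; case: Fy => ->; case: Fz => ->; rewrite ?E11 ?E22 ?E33 ?E12
    ?E13 ?E23 ?E21 ?E31 ?E32 oppr0.
have DF x y : F x -> F y -> (forall z t, F z -> F t -> W x y z t = 0) ->
    forall z t, z = f0 \/ F z -> t = f0 \/ F t -> W x y z t = 0.
  move=> Fx Fy H z t; case=> [->|Fz] ht.
    by rewrite PW; apply: D0 => //; right.
  case: ht => [->|Ft]; last exact: H.
  by rewrite A34 PW D0 ?oppr0 //; right.
have K12 z t : F z -> F t -> W f1 f2 z t = 0.
  by case=> ->; case=> ->; rewrite ?curv_diag34 // A34
    ?X0 ?Z1 ?Z3 ?oppr0 // -A34.
have K13 z t : F z -> F t -> W f1 f3 z t = 0.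
  by case=> ->; case=> ->; rewrite ?curv_diag34 // ?Y0 ?Z2 ?[W f1 f3 f1 f2]PW ?Z1 //
    A34 ?Y0 ?Z2 ?[W f1 f3 f1 f2]PW ?Z1 ?oppr0.
have K23 z t : F z -> F t -> W f2 f3 z t = 0.
  by case=> ->; case=> ->; rewrite ?curv_diag34 // ?Q0 ?[W f2 f3 f1 f2]PW ?Z3
    ?[W f2 f3 f1 f3]PW ?Z2 // A34 ?Q0 ?[W f2 f3 f1 f2]PW ?Z3
    ?[W f2 f3 f1 f3]PW ?Z2 ?oppr0.
have KF x y z t : F x -> F y -> F z -> F t -> W x y z t = 0.
  move=> Fx Fy Fz Ft.
  by case: Fx => ->; case: Fy => ->; rewrite ?curv_diag12 ?K12 ?K13 ?K23 //
    A12 ?K12 ?K13 ?K23 ?oppr0.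
have M x : x \in [:: f0; f1; f2; f3] -> x = f0 \/ F x.
  rewrite !inE => /or4P[] /eqP ->; [by left|right; constructor 1..|
    right; constructor 2|right; constructor 3] => //.
move=> x y z t /M hx /M hy /M hz /M ht.
case: hx hy => [->|Fx] hy; first exact: D0.
case: hy => [->|Fy]; first by rewrite A12 D0 ?oppr0 //; right.
by apply: DF => // z' t'; exact: KF.
Qed.

End ReflectiveWeyl.

(** * Jacobi operators in an orthonormal basis *)

Section OssermanReflective.
Variables (R : realType) (n : nat).
Local Notation V := 'rV[R]_n.
Variables (G E : 'M[R]_n) (e : V) (W : V -> V -> V -> V -> R).
Hypotheses (G_sym : G^T = G) (G_unit : G \in unitmx).
Hypotheses (EGE : E *m G *m E^T = diag_mx e) (e1 : forall i, e 0 i = 1 \/ e 0 i = -1).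
Hypothesis cW : curvature_tensor W.

Lemma basis_inner i j : inner G (row i E) (row j E) = e 0 i *+ (i == j).
Proof. by rewrite -entry_inner EGE mxE. Qed.

Lemma basis_unit : E \in unitmx.
Proof.
have : E *m G *m E^T \in unitmx.
  rewrite EGE unitmxE det_diag unitfE; apply/prodf_neq0 => i _.
  by case: (e1 i) => ->; rewrite ?oppr_eq0 oner_eq0.
by rewrite !unitmx_mul => /andP[/andP[]].
Qed.

Lemma linear_basis_eq0 (f : V -> R) : linear f ->
  (forall i, f (row i E) = 0) -> forall v, f v = 0.
Proof.
move=> lin f0 v; rewrite -[v](mulmxKV basis_unit) mulmx_sum_row.
pose L : {linear _ -> _} := HB.pack f (GRing.isLinear.Build _ _ _ _ f lin).
rewrite -[LHS]/(L _) linear_sum big1 // => i _.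
by rewrite linearZ /= f0 [LHS]mulr0.
Qed.

Lemma curv_linear1 v z w : linear (fun u => W u v z w).
Proof. by move=> c u u'; exact: curv_linear. Qed.

Lemma curv_linear2 u z w : linear (fun v => W u v z w).
Proof.
move=> c v v'; rewrite !(curv_anti12 cW u) (curv_linear cW).
by rewrite opprD -mulrN.
Qed.

Lemma curv_linear3 u v w : linear (fun z => W u v z w).
Proof. by move=> c z z'; rewrite !(curv_pair cW u v) (curv_linear cW). Qed.

Lemma curv_linear4 u v z : linear (fun w => W u v z w).
Proof.
move=> c w w'; rewrite !(curv_pair cW u v) !(curv_anti12 cW z) (curv_linear cW).
by rewrite opprD -mulrN.
Qed.

Lemma curv_basis_eq0 :
  (forall i j k l, W (row i E) (row j E) (row k E) (row l E) = 0) ->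
  forall u v z w, W u v z w = 0.
Proof.
move=> W0 u v z w.
apply: (linear_basis_eq0 (curv_linear1 v z w)) => i {u}.
apply: (linear_basis_eq0 (curv_linear2 (row i E) z w)) => j {v}.
apply: (linear_basis_eq0 (curv_linear3 (row i E) (row j E) w)) => k {z}.
exact: (linear_basis_eq0 (curv_linear4 (row i E) (row j E) (row k E))).
Qed.

Lemma ricci_basis v w : alg_ricci G W v w =
  \sum_i e 0 i * W v (row i E) w (row i E).
Proof.
apply: (trace_orthonormal (T := fun a b => W v a w b)) basis_inner e1 => a.
  exact: curv_linear4.
exact: curv_linear2.
Qed.

Definition jacobi_mx v : 'M[R]_n := lin1_mx (fun y => sharp G (W v y v)).

Lemma row_jacobi_mx v i : row i E *m jacobi_mx v = sharp G (W v (row i E) v).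
Proof.
have lin : linear (fun y => sharp G (W v y v)).
  move=> c y y'; rewrite /sharp scalemxAl -mulmxDl; congr (_ *m _).
  by apply/rowP => j; rewrite !mxE curv_linear2.
pose L : {linear _ -> _} := HB.pack (fun y => sharp G (W v y v))
  (GRing.isLinear.Build _ _ _ _ (fun y => sharp G (W v y v)) lin).
exact: (mul_rV_lin1 L).
Qed.

(** Conjugation by [E] turns the operator into the matrix with entries W(v, e_i, v, e_j) times the
    sign of e_j; pair symmetry of [W] then makes each term of the trace a square. *)
Lemma jacobi_mx_trace_sqr v : \tr (jacobi_mx v *m jacobi_mx v) =
  \sum_i \sum_j e 0 i * e 0 j * W v (row i E) v (row j E) ^+ 2.
Proof.
pose M : 'M[R]_n := \matrix_(i, j) (W v (row i E) v (row j E) * e 0 j).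
have EJ : E *m jacobi_mx v = M *m E.
  apply/row_matrixP => i; rewrite !row_mul row_jacobi_mx.
  apply/eqP; rewrite -subr_eq0; apply/eqP.
  apply: (inner_nondegenerate G_unit) => w.
  pose s := sharp G (W v (row i E) v) - row i M *m E.
  apply: (linear_basis_eq0 (f := inner G s)) => [|j].
    exact: inner_linear_form.
  have lW : linear (W v (row i E) v) by exact: curv_linear4.
  rewrite /s -[sharp _ _ - _]scale1r -[_ - _]addrC.
  have -> : inner G (1 *: (- (row i M *m E) + sharp G (W v (row i E) v))) (row j E)
     = inner G (sharp G (W v (row i E) v)) (row j E) - inner G (row i M *m E) (row j E).
    rewrite scale1r -scaleN1r inner_linearl; ring.
  rewrite (sharpP _ G_unit lW) mulmx_sum_row.
  have -> : inner G (\sum_k row i M 0 k *: row k E) (row j E) =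
      \sum_k row i M 0 k * inner G (row k E) (row j E).
    rewrite /inner !mulmx_suml summxE; apply: eq_bigr => k _.
    by rewrite -!scalemxAl mxE.
  rewrite (bigD1 j) //= big1 ?addr0 => [|k kj].
    rewrite basis_inner eqxx mulr1n !mxE -mulrA.
    by case: (e1 j) => ->; rewrite ?mulrNN !mulr1 subrr.
  by rewrite basis_inner (negbTE kj) mulr0n mulr0.
have JE : jacobi_mx v = invmx E *m M *m E.
  by rewrite -mulmxA -EJ mulKmx // basis_unit.
rewrite JE !mulmxA -(mulmxA _ E (invmx E)) (mulmxV basis_unit) mulmx1.
rewrite mxtrace_mulC !mulmxA (mulmxV basis_unit) mul1mx /mxtrace.
apply: eq_bigr => i _; rewrite mxE; apply: eq_bigr => j _; rewrite !mxE.
by rewrite (curv_pair cW v (row j E)); ring.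
Qed.

End OssermanReflective.

Lemma inner_quadratic (R : realType) n (G : 'M[R]_n) c d u v :
  inner G (c *: u + d *: v) (c *: u + d *: v) =
  c ^+ 2 * inner G u u + c * d * (inner G u v + inner G v u) + d ^+ 2 * inner G v v.
Proof.
have L p : inner G p (c *: u + d *: v) = c * inner G p u + d * inner G p v.
  rewrite inner_linearr -[d *: v in LHS]addr0 inner_linearr.
  have -> : inner G p 0 = 0 by rewrite /inner trmx0 mulmx0 mxE.
  by rewrite addr0.
have L' p : inner G (d *: v) p = d * inner G v p.
  have E := inner_linearl G d v 0 p; rewrite addr0 in E.
  have -> : inner G (d *: v) p = d * inner G v p + inner G 0 p by [].
  by rewrite [X in _ + X](_ : _ = 0) ?addr0 // /inner !mul0mx mxE.
by rewrite inner_linearl L' !L; ring.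
Qed.

Lemma weyl_osserman_reflective (R : realType) (n : nat) (G E : 'M[R]_n)
    (e : 'rV[R]_n) (W : 'rV[R]_n -> 'rV[R]_n -> 'rV[R]_n -> 'rV[R]_n -> R) (k : 'I_n) :
  n = 4 -> G^T = G -> G \in unitmx -> E *m G *m E^T = diag_mx e ->
  (forall i, e 0 i = 1 \/ e 0 i = -1) -> curvature_tensor W ->
  (forall v w, alg_ricci G W v w = 0) ->
  (forall i j l, i != k -> j != k -> l != k ->
    W (row k E) (row i E) (row j E) (row l E) = 0) ->
  (forall s, s = 1 \/ s = -1 -> forall v w, inner G v v = s -> inner G w w = s ->
    \tr (jacobi_mx G W v *m jacobi_mx G W v) =
    \tr (jacobi_mx G W w *m jacobi_mx G W w)) ->
  forall u v z w, W u v z w = 0.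
Proof.
move=> n4; subst n => Gs Gu EGE e1 cW ric refl oss.
apply: (curv_basis_eq0 EGE e1 cW).
(* The distinguished index [k] is moved to position 0, where the four-vector lemma places the
   reflected vector. *)
pose p : {perm 'I_4} := tperm 0 k.
pose f i := row (p i) E; pose s i := e 0 (p i).
have p0 : p 0 = k by rewrite tpermL.
have s1 i : s i = 1 \/ s i = -1 by exact: e1.
pose i1 : 'I_4 := lift ord0 ord0; pose i2 : 'I_4 := lift ord0 (lift ord0 ord0).
pose i3 : 'I_4 := lift ord0 (lift ord0 (lift ord0 ord0)).
have sum4 (F : 'I_4 -> R) : \sum_i F i = F 0 + F i1 + F i2 + F i3.
  by rewrite !big_ord_recl big_ord0 addr0 !addrA.
have inn i j : inner G (f i) (f j) = s i *+ (i == j).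
  by rewrite (basis_inner EGE) (inj_eq perm_inj).
have tr v w : s 0 * W v (f 0) w (f 0) + s i1 * W v (f i1) w (f i1)
    + s i2 * W v (f i2) w (f i2) + s i3 * W v (f i3) w (f i3) = 0.
  rewrite -(ric v w) (ricci_basis EGE e1 cW) (reindex_perm p) /=.
  by rewrite sum4.
have T v : \tr (jacobi_mx G W v *m jacobi_mx G W v) =
   jacobi_trace_sqr W (f 0) (f i1) (f i2) (f i3) (s 0) (s i1) (s i2) (s i3) v.
  rewrite (jacobi_mx_trace_sqr Gu EGE e1 cW) (reindex_perm p) /=.
  under eq_bigr do rewrite (reindex_perm p) /=.
  rewrite sum4 !(sum4 (fun j => _ * e 0 (p j) * _)) -!/(s _) -!/(f _).
  rewrite /jacobi_trace_sqr.
  rewrite (curv_pair cW v (f i1) v (f 0)) (curv_pair cW v (f i2) v (f 0))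
    (curv_pair cW v (f i3) v (f 0)) (curv_pair cW v (f i2) v (f i1))
    (curv_pair cW v (f i3) v (f i1)) (curv_pair cW v (f i3) v (f i2)).
  have ss i : s i * s i = 1 by case: (s1 i) => ->; rewrite ?mulrNN mulr1.
  by rewrite !ss; ring.
have Fk (x : 'rV[R]_4) : [\/ x = f i1, x = f i2 | x = f i3] ->
    exists2 i, i != k & x = row i E.
  have ne i : i != 0 -> p i != k.
    by move=> i0; apply: contraNneq i0 => E'; rewrite -(inj_eq (@perm_inj _ p)) E' p0.
  by case=> ->; [exists (p i1)|exists (p i2)|exists (p i3)] => //; exact: ne.
have R4 x y z : [\/ x = f i1, x = f i2 | x = f i3] ->
    [\/ y = f i1, y = f i2 | y = f i3] -> [\/ z = f i1, z = f i2 | z = f i3] ->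
    W (f 0) x y z = 0.
  move=> /Fk[a ak ->] /Fk[b bk ->] /Fk[c ck ->].
  by rewrite /f p0; exact: refl.
have O s' x : (s' = s i1 /\ x = f i1) \/ (s' = s i2 /\ x = f i2) \/
     (s' = s i3 /\ x = f i3) -> forall c d : R, c ^+ 2 * s 0 + d ^+ 2 * s' = s 0 ->
  jacobi_trace_sqr W (f 0) (f i1) (f i2) (f i3) (s 0) (s i1) (s i2) (s i3)
    (c *: f 0 + d *: x) =
  jacobi_trace_sqr W (f 0) (f i1) (f i2) (f i3) (s 0) (s i1) (s i2) (s i3) (f 0).
  move=> hx c d cd; rewrite -!T; apply: (oss (s 0) (s1 0)); last first.
    by rewrite inn eqxx.
  have [i i0 [sE ->]] : exists2 i, i != 0 & s' = s i /\ x = f i.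
    by case: hx => [|[]] [-> ->]; [exists i1|exists i2|exists i3].
  rewrite inner_quadratic !inn [0 == i]eq_sym (negbTE i0) !eqxx.
  by rewrite !mulr1n !mulr0n addr0 mulr0 addr0 -sE.
have Z := reflective_weyl_eq0 cW (s1 0) (s1 i1) (s1 i2) (s1 i3) tr R4 O.
have mem i : row i E \in [:: f 0; f i1; f i2; f i3].
  have -> : row i E = f (p i) by rewrite /f tpermK.
  case: (p i) => -[|[|[|[|//]]]] lt; rewrite !inE.
  - by have -> : Ordinal lt = 0 by [apply: val_inj]; rewrite eqxx.
  - by have -> : Ordinal lt = i1 by [apply: val_inj]; rewrite eqxx orbT.
  - by have -> : Ordinal lt = i2 by [apply: val_inj]; rewrite eqxx !orbT.
  - by have -> : Ordinal lt = i3 by [apply: val_inj]; rewrite eqxx !orbT.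
by move=> a b c d; exact: Z.
Qed.

(** * The Weyl-Schouten theorem *)

Section CottonAlgebra.
Variables (R : realType) (n : nat).
Local Notation V := 'rV[R]_n.
Implicit Types (G C : 'M[R]_n) (u v w z t : V).

Definition kn_form G C u v : 'M[R]_n :=
  C *m u^T *m v *m G + G *m u^T *m v *m C
  - C *m v^T *m u *m G - G *m v^T *m u *m C.

Lemma inner_kn_form G C u v z t : G^T = G -> C^T = C ->
  inner (kn_form G C u v) z t = kulkarni_nomizu (inner C) (inner G) u v z t.
Proof.
move=> Gs Cs.
have P (X Y : 'M[R]_n) a b : (z *m X *m a^T *m b *m Y *m t^T) 0 0 =
    inner X z a * inner Y b t.
  rewrite /inner -(mulmxA _ Y) -(mulmxA _ b) -[in RHS](mulmxA b).
  by rewrite {1}[z *m X *m a^T]mx11_scalar mul_scalar_mx mxE.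
rewrite /kulkarni_nomizu /kn_form /inner.
rewrite !(mulmxDr, mulmxDl, mulmxN, mulNmx) !mulmxA.
have E (A B D F : 'M[R]_1) : (A + B - D - F) 0 0 = A 0 0 + B 0 0 - D 0 0 - F 0 0.
  by rewrite !mxE.
rewrite E !P (inner_sym z u Cs) (inner_sym z u Gs) (inner_sym z v Cs).
by rewrite (inner_sym z v Gs) /inner; ring.
Qed.

(* The derivative of [kn_form G C u v] when those of [G] and [C] are
   [K *m G + G *m K^T] and [T + K *m C + C *m K^T]. *)
Definition kn_form_derive G C T K u v : 'M[R]_n :=
  (T + K *m C + C *m K^T) *m u^T *m v *m G
  + C *m u^T *m v *m (K *m G + G *m K^T)
  + (K *m G + G *m K^T) *m u^T *m v *m C
  + G *m u^T *m v *m (T + K *m C + C *m K^T)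
  - ((T + K *m C + C *m K^T) *m v^T *m u *m G
  + C *m v^T *m u *m (K *m G + G *m K^T)
  + (K *m G + G *m K^T) *m v^T *m u *m C
  + G *m v^T *m u *m (T + K *m C + C *m K^T)).

Lemma kn_form_covariant G C T K u v : kn_form_derive G C T K u v
    - K *m kn_form G C u v - kn_form G C u v *m K^T =
  T *m u^T *m v *m G + G *m u^T *m v *m T - T *m v^T *m u *m G - G *m v^T *m u *m T
  + (C *m K^T *m u^T *m v *m G + G *m K^T *m u^T *m v *m C
     + C *m u^T *m v *m K *m G + G *m u^T *m v *m K *m C)
  - (C *m K^T *m v^T *m u *m G + G *m K^T *m v^T *m u *m C
     + C *m v^T *m u *m K *m G + G *m v^T *m u *m K *m C).
Proof. by rewrite /kn_form_derive /kn_form; mx_ring. Qed.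

(** The Cotton tensor (nabla_w C)(u, .) - (nabla_u C)(w, .), with [Tw] and [Tu] the covariant
    derivatives of the Schouten tensor. *)
Definition cotton_row (Tu Tw : 'M[R]_n) w u : V := u *m Tw - w *m Tu.

Lemma bianchi_kn_form G C (Gu Gv Gw Tu Tv Tw : 'M[R]_n) u v w :
  C^T = C -> Tu^T = Tu -> Tv^T = Tv -> Tw^T = Tw ->
  v *m Gu = u *m Gv -> w *m Gv = v *m Gw -> u *m Gw = w *m Gu ->
  let D := fun T K u v => kn_form_derive G C T K u v
    - K *m kn_form G C u v - kn_form G C u v *m K^T in
  D Tw Gw u v + D Tu Gu v w + D Tv Gv w u =
  (cotton_row Tu Tw w u)^T *m v *m G - G *m v^T *m cotton_row Tu Tw w u
  + ((cotton_row Tv Tu u v)^T *m w *m G - G *m w^T *m cotton_row Tv Tu u v)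
  + ((cotton_row Tw Tv v w)^T *m u *m G - G *m u^T *m cotton_row Tw Tv v w).
Proof.
move=> Cs Tus Tvs Tws S1 S2 S3 D; rewrite /D (kn_form_covariant G C Tw Gw u v) (kn_form_covariant G C Tu Gu v w).
rewrite (kn_form_covariant G C Tv Gv w u) /cotton_row.
have S1' : Gu^T *m v^T = Gv^T *m u^T by rewrite -!trmx_mul S1.
have S2' : Gv^T *m w^T = Gw^T *m v^T by rewrite -!trmx_mul S2.
have S3' : Gw^T *m u^T = Gu^T *m w^T by rewrite -!trmx_mul S3.
rewrite !(trmxD, trmxN) !trmx_mul Tus Tvs Tws.
have K1 p (X : 'M[R]_(p, n)) : X *m Gu^T *m v^T = X *m Gv^T *m u^T.
  by rewrite -!mulmxA S1'.
have K2 p (X : 'M[R]_(p, n)) : X *m Gv^T *m w^T = X *m Gw^T *m v^T.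
  by rewrite -!mulmxA S2'.
have K3 p (X : 'M[R]_(p, n)) : X *m Gw^T *m u^T = X *m Gu^T *m w^T.
  by rewrite -!mulmxA S3'.
have L1 p (X : 'M[R]_(p, 1)) : X *m v *m Gu = X *m u *m Gv by rewrite -!mulmxA S1.
have L2 p (X : 'M[R]_(p, 1)) : X *m w *m Gv = X *m v *m Gw by rewrite -!mulmxA S2.
have L3 p (X : 'M[R]_(p, 1)) : X *m u *m Gw = X *m w *m Gu by rewrite -!mulmxA S3.
repeat progress expand_mx.
rewrite ?K1 ?K2 ?K3 ?L1 ?L2 ?L3.
mx_ring.
Qed.

Section CottonTrace.
Variables (G : 'M[R]_n) (D : V -> V -> V -> R).
Hypotheses (G_sym : G^T = G) (G_unit : G \in unitmx) (n4 : (3 < n)%N).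
Hypothesis D_linear1 : forall w z, linear (fun u => D u w z).
Hypothesis D_linear3 : forall w z, linear (fun u => D w z u).
Hypothesis D_skew : forall u w z, D u w z = - D w u z.
Hypothesis D_bianchi : forall u v w z t,
  D w u z * inner G v t - inner G v z * D w u t
  + (D u v z * inner G w t - inner G w z * D u v t)
  + (D v w z * inner G u t - inner G u z * D v w t) = 0.

Let D_linear2 w z : linear (fun u => D w u z).
Proof.
move=> c u v; rewrite !(D_skew w) (D_linear1 w z c u v).
by rewrite opprD -scalerN.
Qed.

(** One contraction of the Bianchi relation expresses (n - 3) D by its trace [tau]; a second one
    gives 2 (n - 2) tau = 0. Division by n - 3 is where dimension three is excluded. *)
Lemma cotton_trace_eq0 w u z : D w u z = 0.
Proof.
pose tau w := metric_trace G (fun a b => D w a b).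
have E1 u' w' z' : (n%:R - 3) * D w' u' z' = inner G w' z' * tau u' - inner G u' z' * tau w'.
  have : metric_trace G (fun v t => D w' u' z' * inner G v t - inner G v z' * D w' u' t
    + (D u' v z' * inner G w' t - inner G w' z' * D u' v t)
    + (D v w' z' * inner G u' t - inner G u' z' * D v w' t)) = 0.
    transitivity (metric_trace G (fun a b => 0 * inner G a b)).
      by apply: metric_trace_eq => a b; rewrite D_bianchi mul0r.
    by rewrite metric_traceZ mul0r.
  rewrite !metric_traceD !metric_traceN !metric_traceZ metric_trace_inner //.
  have -> : metric_trace G (fun a b => inner G a z' * D w' u' b) = D w' u' z'.
    rewrite -(metric_trace_swap G_sym) -(metric_trace_contract G_sym G_unit z' (D_linear3 w' u')).
    by apply: metric_trace_eq => a b; rewrite mulrC inner_sym.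
  rewrite (metric_trace_contract G_sym G_unit w' (D_linear2 u' z')).
  rewrite (metric_trace_contract G_sym G_unit u' (D_linear1 w' z')).
  have -> : metric_trace G (fun a b => D a w' b) = - tau w'.
    by rewrite -metric_traceN; apply: metric_trace_eq => a b; exact: D_skew.
  by rewrite (D_skew u' w') -/(tau u'); lra.
have tau_lin : linear tau.
  move=> c u' v'; rewrite /tau.
  transitivity (metric_trace G (fun a b => c * D u' a b + D v' a b)).
    by apply: metric_trace_eq => a b; exact: D_linear1.
  by rewrite metric_traceD metric_traceZ.
have E2 w' : (n%:R - 3) * tau w' = tau w' - n%:R * tau w'.
  transitivity (metric_trace G (fun a b => inner G w' b * tau a - inner G a b * tau w')).
    rewrite -metric_traceZ; apply: metric_trace_eq => a b; exact: E1.
  rewrite metric_traceD metric_traceN.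
  rewrite (_ : metric_trace G (fun a b => inner G w' b * tau a) = tau w'); last first.
    rewrite -(metric_trace_contract G_sym G_unit w' tau_lin).
    by apply: metric_trace_eq => a b; rewrite mulrC.
  rewrite (_ : metric_trace G (fun a b => inner G a b * tau w') = n%:R * tau w') //.
  rewrite -(metric_trace_inner G_sym G_unit) mulrC -metric_traceZ.
  by apply: metric_trace_eq => a b; rewrite mulrC.
have n3 : n%:R - 3 != 0 :> R by rewrite subr_eq0 eqr_nat gtn_eqF.
have n2 : n%:R - 2 != 0 :> R by rewrite subr_eq0 eqr_nat gtn_eqF // ltnW.
have tau0 w' : tau w' = 0.
  have := E2 w' => E3; have : 2 * (n%:R - 2) * tau w' = 0 by lra.
  by move/eqP; rewrite !mulf_eq0 (negbTE n2) pnatr_eq0 /= => /eqP.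
by have /eqP := E1 u w z; rewrite !tau0 !mulr0 subrr mulf_eq0 (negbTE n3) => /eqP.
Qed.

End CottonTrace.

End CottonAlgebra.

(** * The tractor connection and its flatness *)

Section TractorAlgebra.
Variables (R : realType) (n N : nat).
Variables (i1 : 'rV[R]_N) (i2 : 'M[R]_(n, N)) (i3 : 'rV[R]_N).
Hypotheses (i11 : i1 *m i1^T = 1%:M) (i12 : i1 *m i2^T = 0) (i13 : i1 *m i3^T = 0).
Hypotheses (i21 : i2 *m i1^T = 0) (i22 : i2 *m i2^T = 1%:M) (i23 : i2 *m i3^T = 0).
Hypotheses (i31 : i3 *m i1^T = 0) (i32 : i3 *m i2^T = 0) (i33 : i3 *m i3^T = 1%:M).
Implicit Types (G Gi C K : 'M[R]_n) (u v w : 'rV[R]_n).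

(** Acts from the right on w i1 + om i2 + mu i3, where [i1], [i2], [i3] embed the three blocks: each
    summand starts with the transpose of the source block and ends with the target block. [K] is the
    connection matrix of [v], transposed because om is a covector. *)
Definition tractor_mx G Gi C K v : 'M[R]_N :=
  - (i1^T *m v *m C *m i2) + i2^T *m v^T *m i1 + i2^T *m K^T *m i2
  - i2^T *m Gi *m C *m v^T *m i3 + i3^T *m v *m G *m i2.

Lemma tractor_mx_comp G Gi C Ku Kv u v :
  tractor_mx G Gi C Ku u *m tractor_mx G Gi C Kv v =
  - (i1^T *m (u *m C *m v^T) *m i1) - i1^T *m (u *m C *m Kv^T) *m i2
  + i1^T *m (u *m C *m Gi *m C *m v^T) *m i3
  + i2^T *m (Ku^T *m v^T) *m i1
  + i2^T *m (Ku^T *m Kv^T - u^T *m v *m C - Gi *m C *m u^T *m v *m G) *m i2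
  - i2^T *m (Ku^T *m Gi *m C *m v^T) *m i3
  + i3^T *m (u *m G *m v^T) *m i1 + i3^T *m (u *m G *m Kv^T) *m i2
  - i3^T *m (u *m G *m Gi *m C *m v^T) *m i3.
Proof.
rewrite /tractor_mx.
have r11 p (X : 'M[R]_(p, 1)) : X *m i1 *m i1^T = X by rewrite -mulmxA i11 mulmx1.
have r12 p (X : 'M[R]_(p, 1)) : X *m i1 *m i2^T = 0 by rewrite -mulmxA i12 mulmx0.
have r13 p (X : 'M[R]_(p, 1)) : X *m i1 *m i3^T = 0 by rewrite -mulmxA i13 mulmx0.
have r21 p (X : 'M[R]_(p, n)) : X *m i2 *m i1^T = 0 by rewrite -mulmxA i21 mulmx0.
have r22 p (X : 'M[R]_(p, n)) : X *m i2 *m i2^T = X by rewrite -mulmxA i22 mulmx1.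
have r23 p (X : 'M[R]_(p, n)) : X *m i2 *m i3^T = 0 by rewrite -mulmxA i23 mulmx0.
have r31 p (X : 'M[R]_(p, 1)) : X *m i3 *m i1^T = 0 by rewrite -mulmxA i31 mulmx0.
have r32 p (X : 'M[R]_(p, 1)) : X *m i3 *m i2^T = 0 by rewrite -mulmxA i32 mulmx0.
have r33 p (X : 'M[R]_(p, 1)) : X *m i3 *m i3^T = X by rewrite -mulmxA i33 mulmx1.
repeat progress expand_mx.
rewrite ?(r11, r12, r13, r21, r22, r23, r31, r32, r33) ?mul0mx.
mx_ring.
Qed.

Definition tractor_mx_derive (dG dGi dC Gi C dK : 'M[R]_n) v : 'M[R]_N :=
  - (i1^T *m v *m dC *m i2) + i2^T *m dK^T *m i2
  - (i2^T *m dGi *m C *m v^T *m i3 + i2^T *m Gi *m dC *m v^T *m i3)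
  + i3^T *m v *m dG *m i2.

(** The block from i2 to i2 vanishes because the curvature is the product of [C] with the metric,
    the blocks i1 to i2 and i2 to i3 by the Codazzi hypothesis on [Tu] and [Tv], the others by
    symmetry and torsion-freeness. *)
Lemma tractor_flat G Gi C Ku Kv P Q Tu Tv u v :
  G^T = G -> Gi^T = Gi -> C^T = C -> G *m Gi = 1%:M -> Gi *m G = 1%:M ->
  v *m Ku = u *m Kv -> v *m Tu = u *m Tv -> Tu^T = Tu -> Tv^T = Tv ->
  curvature_alg P Q Ku Kv *m G = - kn_form G C u v ->
  tractor_mx_derive (Ku *m G + G *m Ku^T) (- Gi *m Ku - Ku^T *m Gi)
    (Tu + Ku *m C + C *m Ku^T) Gi C P v
  - tractor_mx_derive (Kv *m G + G *m Kv^T) (- Gi *m Kv - Kv^T *m Gi)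
    (Tv + Kv *m C + C *m Kv^T) Gi C Q u
  + tractor_mx G Gi C Ku u *m tractor_mx G Gi C Kv v
  - tractor_mx G Gi C Kv v *m tractor_mx G Gi C Ku u = 0.
Proof.
move=> Gs Gis Cs GGi GiG S T Tus Tvs; rewrite /curvature_alg => E.
have S' : Ku^T *m v^T = Kv^T *m u^T by rewrite -!trmx_mul S.
have T' : Tu *m v^T = Tv *m u^T by rewrite -{1}Tus -{1}Tvs -!trmx_mul T.
have symM (M : 'M[R]_n) : M^T = M -> v *m M *m u^T = u *m M *m v^T.
  by move=> Ms; apply: mx11_eq; exact: inner_sym.
have sC := symM _ Cs; have sG := symM _ Gs.
have sCC : v *m C *m Gi *m C *m u^T = u *m C *m Gi *m C *m v^T.
  have := symM (C *m Gi *m C); rewrite !trmx_mul Cs Gis !mulmxA; exact.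
have {}E : P^T = Q^T - Ku^T *m Kv^T + Kv^T *m Ku^T
  + u^T *m v *m C + Gi *m C *m u^T *m v *m G - v^T *m u *m C
  - Gi *m C *m v^T *m u *m G.
  apply: trmx_inj; rewrite trmxK.
  have -> : P = (P - Q + Kv *m Ku - Ku *m Kv) *m G *m Gi + Q - Kv *m Ku + Ku *m Kv.
    by rewrite -mulmxA GGi mulmx1; mx_ring.
  rewrite E /kn_form !(trmxD, trmxN) !trmx_mul !trmxK Cs Gs Gis.
  have K (X : 'M[R]_n) : X *m G *m Gi = X by rewrite -mulmxA GGi mulmx1.
  repeat progress expand_mx.
  rewrite !K; mx_ring.
rewrite !tractor_mx_comp /tractor_mx_derive E.
have J (X : 'rV[R]_n) : X *m G *m Gi = X by rewrite -mulmxA GGi mulmx1.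
rewrite !J sC sG sCC S'.
have K1 p (X : 'M[R]_(p, n)) : X *m Ku^T *m v^T = X *m Kv^T *m u^T.
  by rewrite -!mulmxA S'.
have K2 p (X : 'M[R]_(p, 1)) : X *m v *m Ku = X *m u *m Kv by rewrite -!mulmxA S.
have K3 p (X : 'M[R]_(p, n)) : X *m Tu *m v^T = X *m Tv *m u^T.
  by rewrite -!mulmxA T'.
have K4 p (X : 'M[R]_(p, 1)) : X *m v *m Tu = X *m u *m Tv by rewrite -!mulmxA T.
repeat progress expand_mx.
rewrite ?K1 ?K2 ?K3 ?K4.
mx_ring.
Qed.

End TractorAlgebra.

Lemma cotton_form (R : realType) (n : nat) (G : 'M[R]_n)
    (b c d u v w z t : 'rV[R]_n) : G^T = G ->
  (z *m (b^T *m v *m G - G *m v^T *m b + (c^T *m w *m G - G *m w^T *m c)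
    + (d^T *m u *m G - G *m u^T *m d)) *m t^T) 0 0 =
  (b *m z^T) 0 0 * inner G v t - inner G v z * (b *m t^T) 0 0
  + ((c *m z^T) 0 0 * inner G w t - inner G w z * (c *m t^T) 0 0)
  + ((d *m z^T) 0 0 * inner G u t - inner G u z * (d *m t^T) 0 0).
Proof.
move=> gs.
have Q1 (a' a : 'rV[R]_n) : (z *m (a'^T *m a *m G) *m t^T) 0 0 =
    (a' *m z^T) 0 0 * inner (G) a t.
  rewrite (row_col_sym a') /inner -[in RHS](mulmxA a) !(mulmxA z) -!(mulmxA (z *m _)).
  rewrite -(mulmxA a) {1}[z *m a'^T]mx11_scalar mul_scalar_mx; exact: mxE.
have Q2 (a' a : 'rV[R]_n) : (z *m (G *m a^T *m a') *m t^T) 0 0 =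
    inner (G) a z * (a' *m t^T) 0 0.
  rewrite (inner_sym _ _ gs) /inner !mulmxA -(mulmxA _ a' t^T).
  by rewrite {1}[z *m G *m a^T]mx11_scalar mul_scalar_mx mxE.
have Q3 (M1 M2 M3 M4 M5 M6 : 'M[R]_n) :
   (z *m (M1 - M2 + (M3 - M4) + (M5 - M6)) *m t^T) 0 0 =
   (z *m M1 *m t^T) 0 0 - (z *m M2 *m t^T) 0 0 +
   ((z *m M3 *m t^T) 0 0 - (z *m M4 *m t^T) 0 0) +
   ((z *m M5 *m t^T) 0 0 - (z *m M6 *m t^T) 0 0).
  by rewrite !(mulmxDr, mulmxN, mulmxDl, mulNmx) !mxE.
rewrite Q3 (Q1 b v) (Q1 c w) (Q1 d u) (Q2 b v) (Q2 c w); congr (_ + (_ - _)).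
exact: Q2.
Qed.

(** * The Codazzi equation for the Schouten tensor when W = 0 *)

Section WeylFlatMetric.
Variables (R : realType) (n : nat) (U : set 'rV[R]_n).
Variable g : 'rV[R]_n -> 'M[R]_n.
Hypotheses (gU : metric_on U g) (n4 : (3 < n)%N).
Implicit Types (x u v w z t : 'rV[R]_n).
Local Notation Gam := (connection_mx g).
Local Notation Tht := (curvature_mx g).

Let U_open := metric_open gU.

Lemma form_smooth F z w : smooth U F ->
  smooth U (fun x => inner (F x : 'M[R]_n) z w).
Proof.
move=> CF k; apply: (@Ck_coord _ _ _ _ _ U) => //.
apply: Ck_mulmx => //; last exact: Ck_cst.
by apply: Ck_mulmx => //; exact: Ck_cst.
Qed.

Lemma riem_smooth u v z w : smooth U (fun x => riem g x u v z w).
Proof.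
move=> k; apply: (Ck_ext (h := fun x => - inner (Tht u v x *m g x) z w)) => //.
  by move=> x Ux; rewrite (riemE gU).
apply: CkN => //; apply: form_smooth => {}k.
by apply: Ck_mulmx => //; [exact: (curvature_smooth gU)|exact: (metric_smooth gU)].
Qed.

Lemma metric_trace_smooth (T : 'rV[R]_n -> 'rV[R]_n -> 'rV[R]_n -> R) :
  (forall a b, smooth U (fun x => T x a b)) ->
  smooth U (fun x => metric_trace (g x) (T x)).
Proof.
move=> CT k; rewrite /metric_trace.
rewrite (_ : (fun _ => _) = \sum_i \sum_j (fun x => invmx (g x) i j *
    T x (basis_vec R i) (basis_vec R j))); last first.
  apply/funext => x; rewrite fct_sumE; apply: eq_bigr => i _.
  by rewrite fct_sumE.
do 2!(apply: Ck_sum => // ?); apply: CkM => //; last exact: CT.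
apply: Ck_coord => //; apply: Ck_invmx => //; first exact: metric_unit gU.
exact: (metric_smooth gU).
Qed.

Definition schouten_field x : 'M[R]_n := schouten_mx (g x) (riem g x).
Local Notation C := schouten_field.

Lemma schouten_smooth : smooth U C.
Proof.
move=> k; apply: Ck_mx => // i j.
rewrite (_ : (fun _ => _) = fun x => (n%:R - 2)^-1 *:
   (alg_ricci (g x) (riem g x) (basis_vec R i) (basis_vec R j)
   - (metric_trace (g x) (alg_ricci (g x) (riem g x)) *
     ((2 * (n%:R - 1))^-1 *: inner (g x) (basis_vec R i) (basis_vec R j)))));
  last by apply/funext => x; rewrite mxE /alg_schouten mulrA.
have Cric v w : smooth U (fun x => alg_ricci (g x) (riem g x) v w).
  by apply: metric_trace_smooth => a b; exact: riem_smooth.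
apply: CkZ => //; apply: CkB => //; first exact: Cric.
apply: CkM => //; first exact: metric_trace_smooth.
by apply: CkZ => //; apply: form_smooth; exact: (metric_smooth gU).
Qed.

Lemma schouten_field_sym x : U x -> (C x)^T = C x.
Proof.
move=> Ux; apply: schouten_mx_sym; first exact: (metric_sym gU).
exact: (riem_curvature_tensor gU).
Qed.

Hypothesis weyl0 : forall x, U x -> forall v w z u,
  alg_weyl (g x) (riem g x) v w z u = 0.

Lemma curvature_schouten x u v : U x ->
  Tht u v x *m g x = - kn_form (g x) (C x) u v.
Proof.
move=> Ux; have gs := metric_sym gU Ux; have gu := metric_unit gU Ux.
have cR := riem_curvature_tensor gU Ux.
apply: inner_inj => z w.
have -> : inner (- kn_form (g x) (C x) u v) z w =
   - inner (kn_form (g x) (C x) u v) z w.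
  by rewrite /inner mulmxN mulNmx mxE.
rewrite (inner_kn_form _ _ _ _ gs (schouten_field_sym Ux)).
apply: oppr_inj; rewrite opprK -(riemE gU) //; apply/eqP.
rewrite -subr_eq0 -(alg_weylE gs cR); apply/eqP; exact: weyl0.
Qed.

Definition schouten_covariant w x : 'M[R]_n :=
  'D_w C x - Gam w x *m C x - C x *m (Gam w x)^T.
Local Notation T := schouten_covariant.

Lemma schouten_derive w x : 
  'D_w C x = T w x + Gam w x *m C x + C x *m (Gam w x)^T.
Proof. by rewrite /T; move: ('D_w C x) => D; rewrite addrAC !subrK. Qed.

Lemma is_derive_schouten w x : U x ->
  is_derive x w C (T w x + Gam w x *m C x + C x *m (Gam w x)^T).
Proof.
move=> Ux; rewrite -schouten_derive.
exact: (is_derive_smooth w schouten_smooth Ux).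
Qed.

Lemma schouten_covariant_sym w x : U x -> (T w x)^T = T w x.
Proof.
move=> Ux; have Cs := schouten_field_sym Ux.
have D : ('D_w C x)^T = 'D_w C x.
  have d := is_derive_smooth w schouten_smooth Ux.
  have [_ <-] := is_derive_trmx d.
  apply: near_eq_derive; apply: open_near U_open Ux _ => y Uy.
  exact: (schouten_field_sym Uy).
rewrite /T !trmxB !trmx_mul trmxK Cs D.
by rewrite addrAC.
Qed.

Lemma schouten_covariant_linear x : U x -> linear (T^~ x).
Proof.
move=> Ux c u v; rewrite /T.
have [dC _] := schouten_smooth 1%N.
rewrite (derive_linear (dC x Ux) c u v) (connection_linear gU Ux c u v).
move: ('D_u C x) ('D_v C x) (C x) (Gam u x) (Gam v x) => A B D E F.
rewrite trmxD trmxZ; mx_ring.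
Qed.

Lemma is_derive_kn_form w u v x : U x ->
  is_derive x w (fun y => kn_form (g y) (C y) u v)
    (kn_form_derive (g x) (C x) (T w x) (Gam w x) u v).
Proof.
move=> Ux; have hC := is_derive_schouten w Ux.
have hG := is_derive_metric gU w Ux.
have K p q (B : 'M[R]_(p, q)) := is_derive_cst B x w.
have P (F H : 'rV[R]_n -> 'M[R]_n) dF dH (a b : 'rV[R]_n) : is_derive x w F dF ->
    is_derive x w H dH -> is_derive x w (fun y => F y *m a^T *m b *m H y)
      (dF *m a^T *m b *m H x + F x *m a^T *m b *m dH).
  move=> hF hH; have := is_derive_mulmx
    (is_derive_mulmx (is_derive_mulmx hF (K _ _ a^T)) (K _ _ b)) hH.
  by rewrite !mulmx0 !addr0.
have := is_deriveB (is_deriveB (is_deriveD (P _ _ _ _ u v hC hG) (P _ _ _ _ u v hG hC))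
  (P _ _ _ _ v u hC hG)) (P _ _ _ _ v u hG hC).
move=> H; apply: is_derive_eq H _.
by rewrite /kn_form_derive !opprD !addrA.
Qed.

(** With W = 0 the second Bianchi identity becomes a relation for the Cotton tensor alone, which
    [cotton_trace_eq0] shows to have only the zero solution. *)
Lemma schouten_codazzi x u w : U x -> u *m T w x = w *m T u x.
Proof.
move=> Ux; have gs := metric_sym gU Ux; have gu := metric_unit gU Ux.
have Cs := schouten_field_sym Ux.
(* The covariant derivative of the endomorphism-valued curvature, with an index lowered: it passes
   through the parallel metric to the derivative of [kn_form]. *)
have B w' u' v' : ('D_w' (Tht u' v') x + Tht u' v' x *m Gam w' x
   - Gam w' x *m Tht u' v' x) *m g x =
   - (kn_form_derive (g x) (C x) (T w' x) (Gam w' x) u' v'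
     - Gam w' x *m kn_form (g x) (C x) u' v'
     - kn_form (g x) (C x) u' v' *m (Gam w' x)^T).
  have h1 := is_derive_smooth w' (curvature_smooth gU u' v') Ux.
  have [_ h2] := is_derive_mulmx h1 (is_derive_metric gU w' Ux).
  have Eq : \near x, Tht u' v' x *m g x = - kn_form (g x) (C x) u' v'.
    by apply: open_near U_open Ux _ => y Uy; exact: curvature_schouten.
  have h3 := is_deriveN (is_derive_kn_form w' u' v' Ux).
  move: h2; rewrite (near_eq_derive w' Eq); have [_ ->] := h3.
  have := curvature_schouten u' v' Ux.
  move: (kn_form_derive _ _ _ _ _ _) ('D_w' (Tht u' v') x) => D D'.
  move: (Tht u' v' x) (Gam w' x) (kn_form (g x) (C x) u' v').
  move: (g x) => G X Y M E1 E2.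

  rewrite -[M]opprK -E1 -[D]opprK E2.
  mx_ring.
pose D w' u' z := (cotton_row (T u' x) (T w' x) w' u' *m z^T) 0 0.
suff D0 z : D w u z = 0.
  apply/eqP; rewrite -subr_eq0; apply/eqP/rowP => j.
  have := D0 (delta_mx 0 j); rewrite /D /cotton_row trmx_delta -colE mxE => ->.
  by rewrite mxE.
apply: (@cotton_trace_eq0 _ _ (g x) D) => //.
- move=> w' z' c a b; rewrite /D /cotton_row (schouten_covariant_linear Ux c a b).
  move: (T a x) (T b x) (T w' x) => Ta Tb Tw.
  rewrite mulmxDr -scalemxAr !(mulmxDl, mulNmx) -!scalemxAl !mxE.
  by rewrite -[_ *: _]/(_ * _); ring.
- by move=> w' z' c a b; rewrite /D linearD linearZ /= mulmxDr -scalemxAr !mxE.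
- move=> a b z'; rewrite /D /cotton_row; move: (T a x) (T b x) => A A'.
  by rewrite -[b *m A - _]opprB mulNmx mxE.
move=> u' v' w' z' t.
have S a b := connection_sym gU a b Ux.
have := bianchi_kn_form (g x) Cs (schouten_covariant_sym u' Ux)
  (schouten_covariant_sym v' Ux) (schouten_covariant_sym w' Ux)
  (S u' v') (S v' w') (S w' u').
move=> /= bianchi.
have sum0 (X Y Z G A1 A2 A3 : 'M[R]_n) : X *m G = - A1 -> Y *m G = - A2 ->
    Z *m G = - A3 -> X + Y + Z = 0 -> A1 + A2 + A3 = 0.
  move=> XG YG ZG XYZ; apply: oppr_inj.
  by rewrite !opprD -XG -YG -ZG -!mulmxDl XYZ mul0mx oppr0.
have E := etrans (esym bianchi) (sum0 _ _ _ _ _ _ _ (B w' u' v') (B u' v' w')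
  (B v' w' u') (curvature_bianchi2 gU u' v' w' Ux)).
have := congr1 (fun M : 'M[R]_n => (z' *m M *m t^T) 0 0) E.
rewrite mulmx0 mul0mx [RHS]mxE; apply: etrans; apply: esym.
exact: cotton_form.
Qed.

End WeylFlatMetric.

Lemma tractor_injections (R : realType) (n : nat) :
  exists (N : nat) (i1 : 'rV[R]_N) (i2 : 'M[R]_(n, N)) (i3 : 'rV[R]_N),
  [/\ [/\ i1 *m i1^T = 1%:M, i1 *m i2^T = 0 & i1 *m i3^T = 0],
      [/\ i2 *m i1^T = 0, i2 *m i2^T = 1%:M & i2 *m i3^T = 0] &
      [/\ i3 *m i1^T = 0, i3 *m i2^T = 0 & i3 *m i3^T = 1%:M]].
Proof.
exists (1 + (n + 1))%N, (row_mx 1%:M (row_mx 0 0)).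
exists (row_mx 0 (row_mx 1%:M 0)), (row_mx 0 (row_mx 0 1%:M)).
do 2!split; rewrite !tr_row_mx !mul_row_col ?trmx0 ?trmx1;
  by rewrite ?(mul0mx, mulmx0, mulmx1, addr0, add0r).
Qed.

(** Bootstrapping: if [Y] is C^k, so is its derivative [Y *m A v], and [Y] is C^(k+1). *)
Lemma smooth_of_parallel (R : realType) (n N : nat) (W : set 'rV[R]_n)
    (A : 'rV[R]_n -> 'rV[R]_n -> 'M[R]_N) (Y : 'rV[R]_n -> 'rV[R]_N) :
  open W -> (forall v, smooth W (A v)) ->
  (forall x, W x -> differentiable Y x /\ forall v, 'D_v Y x = Y x *m A v x) ->
  smooth W Y.
Proof.
move=> oW CA DY; elim=> [|k IH] /=.
  by move=> x Wx; apply: differentiable_continuous; have [] := DY x Wx.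
split=> [x Wx|v]; first by have [] := DY x Wx.
apply: (Ck_ext (h := fun x => Y x *m A v x)) => //.
  by move=> x Wx; have [_ ->] := DY x Wx.
exact: Ck_mulmx oW IH (CA v k).
Qed.

Section WeylSchouten.
Variables (R : realType) (n : nat) (U : set 'rV[R]_n).
Variable g : 'rV[R]_n -> 'M[R]_n.
Hypotheses (gU : metric_on U g) (n4 : (3 < n)%N).
Hypothesis weyl0 : forall x, U x -> forall v w z u,
  alg_weyl (g x) (riem g x) v w z u = 0.
Implicit Types (x u v z t : 'rV[R]_n).
Local Notation Gam := (connection_mx g).
Local Notation C := (schouten_field g).

Let U_open := metric_open gU.

Section TractorConnection.
Variables (N : nat) (i1 : 'rV[R]_N) (i2 : 'M[R]_(n, N)) (i3 : 'rV[R]_N).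
Hypotheses (i11 : i1 *m i1^T = 1%:M) (i12 : i1 *m i2^T = 0) (i13 : i1 *m i3^T = 0).
Hypotheses (i21 : i2 *m i1^T = 0) (i22 : i2 *m i2^T = 1%:M) (i23 : i2 *m i3^T = 0).
Hypotheses (i31 : i3 *m i1^T = 0) (i32 : i3 *m i2^T = 0) (i33 : i3 *m i3^T = 1%:M).

Definition tractor_connection v x : 'M[R]_N :=
  tractor_mx i1 i2 i3 (g x) (invmx (g x)) (C x) (Gam v x) v.
Local Notation A := tractor_connection.

Lemma tractor_connection_smooth v : smooth U (A v).
Proof.
move=> k; have K p q (B : 'M[R]_(p, q)) : Ck k U (fun _ => B) by exact: Ck_cst.
have Cg := metric_smooth gU k.
have Cgi : Ck k U (fun x => invmx (g x)).
  by apply: Ck_invmx => //; exact: metric_unit gU.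
have CC : Ck k U C by exact: schouten_smooth gU k.
have CG := connection_smooth gU v k.
have CGT := Ck_trmx U_open CG.
apply: (CkD U_open (h := fun x => - (i1^T *m v *m C x *m i2) + i2^T *m v^T *m i1
  + i2^T *m (Gam v x)^T *m i2 - i2^T *m invmx (g x) *m C x *m v^T *m i3)
  (h' := fun x => i3^T *m v *m g x *m i2)); last first.
  by do 2!(apply: Ck_mulmx => //).
apply: CkB => //; last by do 4!(apply: Ck_mulmx => //).
apply: (CkD U_open (h := fun x => - (i1^T *m v *m C x *m i2) + i2^T *m v^T *m i1)
  (h' := fun x => i2^T *m (Gam v x)^T *m i2)); last first.
  by do 2!(apply: Ck_mulmx => //).
apply: (CkD U_open (h := fun x => - (i1^T *m v *m C x *m i2))
  (h' := fun x => i2^T *m v^T *m i1)); last exact: K.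
by apply: CkN => //; do 2!(apply: Ck_mulmx => //).
Qed.

Lemma tractor_connection_linear x : U x -> linear (A^~ x).
Proof.
move=> Ux c u v; rewrite /A (connection_linear gU Ux c u v).
move: (Gam u x) (Gam v x) (C x) (g x) (invmx (g x)) => P Q D G Gi.
rewrite /tractor_mx !trmxD !trmxZ; mx_ring.
Qed.

Lemma is_derive_tractor_connection x u v : U x -> is_derive x u (A v)
  (tractor_mx_derive i1 i2 i3 (Gam u x *m g x + g x *m (Gam u x)^T)
    (- invmx (g x) *m Gam u x - (Gam u x)^T *m invmx (g x))
    (schouten_covariant g u x + Gam u x *m C x + C x *m (Gam u x)^T)
    (invmx (g x)) (C x) ('D_u (Gam v) x) v).
Proof.
move=> Ux; have dg := is_derive_metric gU u Ux.
have dgi := is_derive_metric_inv gU u Ux.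
have dC := is_derive_schouten gU u Ux.
have dK := is_derive_trmx (is_derive_connection gU u v Ux).
have K p q (B : 'M[R]_(p, q)) := is_derive_cst B x u.
have M p q r s (P : 'M[R]_(p, q)) (Q : 'M[R]_(r, s)) F dF : is_derive x u F dF ->
    is_derive x u (fun y => P *m F y *m Q) (P *m dF *m Q).
  move=> dF'; have := is_derive_mulmx (is_derive_mulmx (K _ _ P) dF') (K _ _ Q).
  by rewrite mul0mx add0r mulmx0 addr0.
have d1 := is_deriveN (M _ _ _ _ (i1^T *m v) i2 _ _ dC).
have d3 := M _ _ _ _ i2^T i2 _ _ dK.
have d4 := M _ _ _ _ i2^T (v^T *m i3) _ _ (is_derive_mulmx dgi dC).
have d5 := M _ _ _ _ (i3^T *m v) i2 _ _ dg.
have := is_deriveD (is_deriveB (is_deriveD (is_deriveD d1 (K _ _ (i2^T *m v^T *m i1)))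
  d3) d4) d5.
move=> H; have E : A v = (fun y => - (i1^T *m v *m C y *m i2) + i2^T *m v^T *m i1
    + i2^T *m (Gam v y)^T *m i2 - i2^T *m (invmx (g y) *m C y) *m (v^T *m i3)
    + i3^T *m v *m g y *m i2).
  by apply/funext => y; rewrite /A /tractor_mx !mulmxA.
rewrite E; apply: is_derive_eq H _.
move: (schouten_covariant g u x) ('D_u (Gam v) x) (Gam u x) => T D K'.
move: (C x) (invmx (g x)) (g x) => S Gi G.
rewrite /tractor_mx_derive addr0 (mulmxDr i2^T) mulmxDl !mulmxA.
by move: (- Gi *m K' - K'^T *m Gi) (_ + _ + S *m _) (_ + G *m _) => P Q P'.
Qed.

Lemma tractor_connection_flat x u v : U x ->
  'D_u (A v) x - 'D_v (A u) x + A u x *m A v x - A v x *m A u x = 0.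
Proof.
move=> Ux; have [_ ->] := is_derive_tractor_connection u v Ux.
have [_ ->] := is_derive_tractor_connection v u Ux.
have gu := metric_unit gU Ux; have gs := metric_sym gU Ux.
exact (tractor_flat i11 i12 i13 i21 i22 i23 i31 i32 i33 gs
  (metric_inv_sym gs) (schouten_field_sym gU Ux) (mulmxV gu) (mulVmx gu)
  (connection_sym gU u v Ux) (schouten_codazzi gU n4 weyl0 v u Ux)
  (schouten_covariant_sym gU u Ux) (schouten_covariant_sym gU v Ux)
  (curvature_schouten gU weyl0 u v Ux)).
Qed.

End TractorConnection.

(* The components of a parallel section of [tractor_connection]. *)
Lemma parallel_tractor x0 : U x0 ->
  exists (W : set 'rV[R]_n) (w mu : 'rV[R]_n -> R) (om : 'rV[R]_n -> 'rV[R]_n),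
  [/\ open W, W x0 & W `<=` U] /\
  [/\ smooth W w, smooth W mu & smooth W om] /\
  [/\ w x0 = 1, mu x0 = 0 & om x0 = 0] /\
  forall x v, W x -> [/\ 'D_v w x = (om x *m v^T) 0 0,
    'D_v mu x = - (om x *m invmx (g x) *m C x *m v^T) 0 0 &
    'D_v om x = - w x *: (v *m C x) + om x *m (Gam v x)^T + mu x *: (v *m g x)].
Proof.
move=> Ux0.
have [N [i1 [i2 [i3 [[i11 i12 i13] [i21 i22 i23] [i31 i32 i33]]]]]] :=
  tractor_injections R n.
pose A := tractor_connection i1 i2 i3.
have [Y [W [oW Wx0 WU Y0 DY]]] := @parallel_section R n N U A U_open
  (@tractor_connection_linear _ i1 i2 i3)
  (fun v => @tractor_connection_smooth _ i1 i2 i3 v 2)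
  (fun x u v => @tractor_connection_flat _ i1 i2 i3 i11 i12 i13 i21 i22 i23
     i31 i32 i33 x u v) x0 i1 Ux0.
have CY : smooth W Y.
  apply: smooth_of_parallel oW _ DY => v k.
  exact: Ck_sub WU (@tractor_connection_smooth _ i1 i2 i3 v k).
have CM p (i : 'M[R]_(p, N)) : smooth W (fun x => Y x *m i^T).
  by move=> k; apply: Ck_mulmx oW (CY k) _; exact: Ck_cst.
have DM p (i : 'M[R]_(p, N)) x v : W x -> 
    is_derive x v (fun x => Y x *m i^T) (Y x *m A v x *m i^T).
  move=> Wx; have d := is_derive_smooth v CY Wx.
  have := is_derive_mulmx d (is_derive_cst i^T x v).
  by have [_ ->] := DY x Wx; rewrite mulmx0 addr0.
exists W, (fun x => (Y x *m i1^T) 0 0), (fun x => (Y x *m i3^T) 0 0).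
exists (fun x => Y x *m i2^T); split=> //; split; first split.
- by move=> k; apply: Ck_coord oW _; exact: CM.
- by move=> k; apply: Ck_coord oW _; exact: CM.
- exact: CM.
rewrite Y0 i11 i12 i13 !mxE; split=> // x v Wx.
have Ai1 : A v x *m i1^T = i2^T *m v^T.
  rewrite /A /tractor_connection /tractor_mx !(mulmxDl, mulNmx) -!(mulmxA _ _ i1^T).
  by rewrite i11 i21 i31 !mulmx0 mulmx1 oppr0 add0r !addr0.
have Ai2 : A v x *m i2^T = - (i1^T *m v *m C x) + i2^T *m (Gam v x)^T
    + i3^T *m v *m g x.
  rewrite /A /tractor_connection /tractor_mx !(mulmxDl, mulNmx) -!(mulmxA _ _ i2^T).
  by rewrite i12 i22 i32 !mulmx0 !mulmx1 oppr0 !addr0.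
have Ai3 : A v x *m i3^T = - (i2^T *m invmx (g x) *m C x *m v^T).
  rewrite /A /tractor_connection /tractor_mx !(mulmxDl, mulNmx) -!(mulmxA _ _ i3^T).
  by rewrite i13 i23 i33 !mulmx0 !mulmx1 oppr0 !add0r addr0.
have [_ d1] := proj2 (is_derive_mx _ _ _ _) (DM _ i1 x v Wx) 0 0.
have [_ d2] := DM _ i2 x v Wx.
have [_ d3] := proj2 (is_derive_mx _ _ _ _) (DM _ i3 x v Wx) 0 0.
split.
- by rewrite d1 -mulmxA Ai1 mulmxA.
- by rewrite d3 -mulmxA Ai3 mulmxN !mulmxA [LHS]mxE.
rewrite d2 -mulmxA Ai2 !mulmxDr mulmxN !mulmxA.
rewrite [Y x *m i1^T]mx11_scalar [Y x *m i3^T]mx11_scalar.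
by rewrite -!(mulmxA _%:M) !mul_scalar_mx scaleNr !mxE !eqxx !mulr1n.
Qed.

End WeylSchouten.

(** * A flat conformal metric from a parallel tractor *)

Section FlatConformalMetric.
Variables (R : realType) (n : nat).
Implicit Types (G Gi C K : 'M[R]_n) (o u v : 'rV[R]_n).

(** The derivative of 2 w mu - |om|^2 along a parallel triple: the tractor metric is parallel. *)
Lemma tractor_norm_algebra G Gi C K o v (w m : R) :
  Gi^T = Gi -> C^T = C -> G *m Gi = 1%:M ->
  let o' := - w *: (v *m C) + o *m K^T + m *: (v *m G) in
  2 * ((o *m v^T) 0 0 * m + w * - (o *m Gi *m C *m v^T) 0 0)
  - ((o' *m Gi + o *m (- Gi *m K - K^T *m Gi)) *m o^T + o *m Gi *m o'^T) 0 0 = 0.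
Proof.
move=> Gis Cs GGi o'.
have sGi (a b : 'rV[R]_n) : (a *m Gi *m b^T) 0 0 = (b *m Gi *m a^T) 0 0 by exact: inner_sym.
have -> : ((o' *m Gi + o *m (- Gi *m K - K^T *m Gi)) *m o^T + o *m Gi *m o'^T) 0 0 =
  2 * (o' *m Gi *m o^T) 0 0 - 2 * (o *m K^T *m Gi *m o^T) 0 0.
  have := sGi o o'; have : (o *m Gi *m K *m o^T) 0 0 = (o *m K^T *m Gi *m o^T) 0 0.
    rewrite (sGi (o *m K^T) o) trmx_mul trmxK.
    by rewrite !mulmxA.
  rewrite mulmxDr !(mulmxN, mulNmx) !mulmxDl !(mulmxN, mulNmx) !mulmxA.
  move: (o *m Gi *m K *m o^T) (o *m K^T *m Gi *m o^T) (o *m Gi *m o'^T).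
  move: (o' *m Gi *m o^T) => A B D E; rewrite !mxE => BD EA.
  by rewrite BD EA; ring.
have -> : (o' *m Gi *m o^T) 0 0 = - w * (o *m Gi *m C *m v^T) 0 0
   + (o *m K^T *m Gi *m o^T) 0 0 + m * (o *m v^T) 0 0.
  rewrite (row_col_sym o v).
  have -> : (o *m Gi *m C *m v^T) 0 0 = (v *m C *m Gi *m o^T) 0 0.
    by rewrite (sGi (v *m C) o) trmx_mul Cs !mulmxA.
  rewrite /o' !mulmxDl -!scalemxAl -(mulmxA v G Gi) GGi mulmx1.
  by move: (v *m C *m Gi *m o^T) (o *m K^T *m Gi *m o^T) => A B; rewrite !mxE.
by ring.
Qed.

(** Here a = - om / w is half the logarithmic differential of w^-2. In its conformal Hessian the
    terms in om cancel identically, and those in [u *m G] cancel because of the null relation. *)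
Lemma tractor_hessian G Gi C K o u (w m : R) :
  w != 0 -> 2 * w * m = (o *m Gi *m o^T) 0 0 ->
  conformal_hessian G Gi (- w^-1 *: o)
    (w^-1 ^+ 2 * (o *m u^T) 0 0 *: o
     + - w^-1 *: (- w *: (u *m C) + o *m K^T + m *: (u *m G))) K u = u *m C.
Proof.
move=> w0 q0; rewrite /conformal_hessian.
rewrite trmxZ -!scalemxAl -!scalemxAr.
have E (c d : R) (A : 'M[R]_1) : (c *: (d *: A)) 0 0 = c * d * A 0 0.
  by rewrite !mxE mulrA.
have E' (c : R) (A : 'M[R]_1) : (c *: A) 0 0 = c * A 0 0 by rewrite mxE.
rewrite E E' -q0 (row_col_sym u o).
move: ((o *m u^T) 0 0) (u *m C) (o *m K^T) (u *m G) => s A B D.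
apply/matrixP => i j; rewrite !mxE; field.
exact: w0.
Qed.

Lemma kn_mx_schouten G Gi C u v : G^T = G -> C^T = C -> G *m Gi = 1%:M ->
  kn_mx G Gi (u *m C) (v *m C) u v = kn_form G C u v *m Gi.
Proof.
move=> Gs Cs GGi; rewrite /kn_mx /kn_form !trmx_mul Cs.
have K (X : 'M[R]_n) : X *m G *m Gi = X by rewrite -mulmxA GGi mulmx1.
repeat progress expand_mx; rewrite !K; mx_ring.
Qed.

End FlatConformalMetric.

Section WeylSchoutenTheorem.
Variables (R : realType) (n : nat) (U : set 'rV[R]_n).
Variable g : 'rV[R]_n -> 'M[R]_n.
Hypotheses (gU : metric_on U g) (n4 : (3 < n)%N).
Hypothesis weyl0 : forall x, U x -> forall v w z u,
  alg_weyl (g x) (riem g x) v w z u = 0.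

Lemma weyl_schouten (x0 : 'rV[R]_n) : U x0 -> exists W (phi : 'rV[R]_n -> R),
  [/\ open W, W x0 & W `<=` U] /\
  [/\ smooth W phi, forall x, W x -> 0 < phi x &
   forall x, W x -> forall u v z w, riem (conformal_metric g phi) x u v z w = 0].
Proof.
move=> Ux0.
have [W0 [w [mu [om [[oW0 W0x0 W0U] [[Cw Cmu Com] [[w0 mu0 om0] D]]]]]]] :=
  parallel_tractor gU n4 weyl0 Ux0.
have dR (f : 'rV[R]_n -> R) x v : smooth W0 f -> W0 x -> is_derive x v f ('D_v f x).
  by move=> /(_ 1%N)[df _] /df/diff_derivable/derivableP; apply.
have dw x v : W0 x -> is_derive x v w ((om x *m v^T) 0 0).
  by move=> Wx; have [<- _ _] := D x v Wx; exact: dR.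
have dmu x v : W0 x -> is_derive x v mu
    (- (om x *m invmx (g x) *m schouten_field g x *m v^T) 0 0).
  by move=> Wx; have [_ <- _] := D x v Wx; exact: dR.
have dom x v : W0 x -> is_derive x v om (- w x *: (v *m schouten_field g x)
    + om x *m (connection_mx g v x)^T + mu x *: (v *m g x)).
  by move=> Wx; have [_ _ <-] := D x v Wx; exact: is_derive_smooth Com Wx.
(* The square norm of the tractor, up to sign; its vanishing makes [tractor_hessian] applicable. *)
pose q x := 2 * (w x * mu x) - (om x *m invmx (g x) *m (om x)^T) 0 0.
have dq x v : W0 x -> is_derive x v q 0.
  move=> Wx; have Ux := W0U x Wx.
  have d1 := is_deriveZ 2 (is_deriveM (dw x v Wx) (dmu x v Wx)).
  have d2 := is_derive_mulmx (is_derive_mulmx (dom x v Wx)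
    (is_derive_metric_inv gU v Ux)) (is_derive_trmx (dom x v Wx)).
  have d3 := is_deriveB d1 (proj2 (is_derive_mx _ _ _ _) d2 0 0).
  apply: is_derive_eq d3 _.
  have := tractor_norm_algebra (connection_mx g v x) (om x) v (w x) (mu x)
    (metric_inv_sym (metric_sym gU Ux)) (schouten_field_sym gU Ux)
    (mulmxV (metric_unit gU Ux)).
  move=> /=.
  move=> H; rewrite -[RHS]H; congr (_ - _); congr (2 * _).
  by rewrite addrC [mu x *: _]mulrC.
have Cgi : smooth U (fun x => invmx (g x)).
  move=> k; apply: Ck_invmx (metric_open gU) _ (metric_smooth gU k).
  exact: metric_unit gU.
have dfq x : W0 x -> differentiable q x.
  suff /(_ 1%N)[+ _] : smooth W0 q by apply.
  move=> k; apply: CkB => //.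
    by apply: (@CkZ _ _ _ _ _ 2) => //; apply: CkM.
  apply: Ck_coord => //; apply: Ck_mulmx => //; last exact: Ck_trmx.
  by apply: Ck_mulmx => //; apply: Ck_sub (Cgi k).
(* Since [w x0 = 1], positivity holds nearby. A ball is chosen because segments from [x0] stay in
   it, so the zero derivative of [q] forces [q] to keep its value 0 at [x0]. *)
have [r r0 rW] : exists2 r : R, 0 < r & forall x, ball x0 r x -> W0 x /\ 0 < w x.
  have cw : {for x0, continuous w} by exact: Cw 0%N x0 W0x0.
  have n2 : \forall x \near x0, 0 < w x.
    by apply: (cvgr_gt _ cw); rewrite w0.
  have n3 : \forall x \near x0, W0 x /\ 0 < w x.
    by apply: filterS2 n2 (open_nbhs_nbhs (conj oW0 W0x0)).
  by have /nbhs_ballP[r r0 H] := n3; exists r.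
pose W := ball x0 r.
have oW : open W by exact: ball_open.
have WW0 : W `<=` W0 by move=> x /rW[].
have wn0 x : W x -> w x != 0 by move=> /rW[_ wx]; rewrite gt_eqF.
have q0 x : W x -> 2 * w x * mu x = (om x *m invmx (g x) *m (om x)^T) 0 0.
  move=> Wx; apply/eqP; rewrite -subr_eq0; apply/eqP; rewrite -mulrA -/(q x).
  have line (a : R) : 0 <= a <= 1 -> W0 (x0 + a *: (x - x0)).
    move=> /andP[a0 a1]; apply: WW0; move: Wx; rewrite /W -ball_normE /=.
    rewrite opprD addrA subrr add0r normrN normrZ (ger0_norm a0) distrC.
    by apply: le_lt_trans; rewrite -[leRHS]mul1r ler_wpM2r.
  have [a a01] := mean_value_line (ler01 : 0 <= (1 : R)) (fun a H => dfq _ (line a H)).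
  have [_ ->] := dq _ (x - x0) (line a a01).
  rewrite scale1r mulr0 (addrC x0) subrK => /eqP; rewrite subr_eq0 => /eqP ->.
  by rewrite /q om0 mu0 mul0mx mul0mx mulr0 mulr0 mxE subrr.
have Cw' k : Ck k W w by exact: Ck_sub WW0 (Cw k).
have Ci : smooth W (fun x => (w x)^-1) by move=> k; exact: Ck_inv.
pose phi x := (w x)^-1 * (w x)^-1.
pose a x := - (w x)^-1 *: om x.
have Cphi : smooth W phi by move=> k; exact: CkM.
have phi0 x : W x -> 0 < phi x.
  by move=> /rW[_ wx]; rewrite /phi mulr_gt0 // invr_gt0.
have Ca : smooth W a.
  move=> k; apply: Ck_scalemx => //; first by apply: CkN.
  exact: Ck_sub WW0 (Com k).
have di x v : W x -> is_derive x v (fun y => (w y)^-1)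
    (- (w x)^-1 ^+ 2 * (om x *m v^T) 0 0).
  move=> Wx; have [dwx <-] := dw x v (WW0 x Wx).
  split; first exact: derivableV (wn0 x Wx) dwx.
  by rewrite (deriveV (wn0 x Wx) dwx) exprVn.
have dphi x v : W x -> 'D_v phi x = 2 * phi x * (v *m (a x)^T) 0 0.
  move=> Wx; have [_ ->] := is_deriveM (di x v Wx) (di x v Wx).
  rewrite /phi /a trmxZ -scalemxAr [in RHS]mxE (row_col_sym v).
  rewrite /GRing.scale /=; ring.
have gW : metric_on W g by apply: metric_on_sub gU oW _ => x /WW0/W0U.
exists W, phi; split; first by split=> // [|x /WW0/W0U //]; exact: ballxx.
split=> // x Wx u v z t; have Ux := W0U x (WW0 x Wx).
have gs := metric_sym gU Ux; have GGi := mulmxV (metric_unit gU Ux).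
have GiG := mulVmx (metric_unit gU Ux).
rewrite (riemE (conformal_metric_on gW Cphi phi0)) //.
suff -> : curvature_mx (conformal_metric g phi) u v x = 0.
  by rewrite mul0mx /inner mulmx0 mul0mx mxE oppr0.
(* The conformal change thus adds the product of the Schouten tensor with the metric, precisely what
   cancels the curvature of a metric with W = 0. *)
have hess b : conformal_hessian (g x) (invmx (g x)) (a x) ('D_b a x)
    (connection_mx g b x) b = b *m schouten_field g x.
  rewrite -(tractor_hessian (g x) (schouten_field g x) (connection_mx g b x) b
    (wn0 x Wx) (q0 x Wx)).
  have [_ ->] := is_derive_scalemx (is_deriveN (di x b Wx)) (dom x b (WW0 x Wx)).
  by rewrite mulNr opprK.
rewrite (etrans (conformal_curvature gW Cphi phi0 Ca dphi u v Wx)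
  (congr2 (fun r s => curvature_mx g u v x + kn_mx (g x) (invmx (g x)) r s u v)
    (hess u) (hess v))).
rewrite (kn_mx_schouten u v gs (schouten_field_sym gU Ux) GGi).
have := curvature_schouten gU weyl0 u v Ux.
move: (curvature_mx g u v x) (kn_form _ _ _ _) GGi => A B GGi E.
have -> : B = - (A *m g x) by rewrite E opprK.
by rewrite mulNmx -mulmxA GGi mulmx1 subrr.
Qed.

End WeylSchoutenTheorem.

(** * Conformal behaviour of the curvature and of the Weyl tensor *)

Section ConformalWeyl.
Variables (R : realType) (n : nat) (U : set 'rV[R]_n).
Variables (g : 'rV[R]_n -> 'M[R]_n) (phi : 'rV[R]_n -> R).
Hypotheses (gU : metric_on U g) (phi_smooth : smooth U phi).
Hypothesis (phi_gt0 : forall x, U x -> 0 < phi x).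
Implicit Types (x u v w z : 'rV[R]_n).

Let U_open := metric_open gU.

(* Half the logarithmic differential of [phi]. *)
Definition conformal_differential x : 'rV[R]_n :=
  \row_j ((2 * phi x)^-1 * 'D_(delta_mx 0 j) phi x).
Local Notation a := conformal_differential.

Let phi_neq0 x : U x -> 2 * phi x != 0.
Proof. by move=> /phi_gt0 p; rewrite mulf_neq0 ?pnatr_eq0 // gt_eqF. Qed.

Lemma conformal_differential_smooth : smooth U a.
Proof.
move=> k; apply: Ck_mx => // i j; rewrite (ord1 i).
rewrite (_ : (fun _ => _) = fun x => (2 * phi x)^-1 * 'D_(delta_mx 0 j) phi x);
  last by apply/funext => x; rewrite mxE.
have [_ D] := phi_smooth k.+1.
apply: CkM => //; last exact: D.
by apply: Ck_inv => //; apply: (@CkZ _ _ _ _ _ 2).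
Qed.

Lemma conformal_differentialE x v : U x ->
  'D_v phi x = 2 * phi x * (v *m (a x)^T) 0 0.
Proof.
move=> Ux; have [D _] := phi_smooth 1%N; rewrite (derive_row v (D x Ux)) mxE.
rewrite mulr_sumr; apply: eq_bigr => j _; rewrite !mxE.
by rewrite /GRing.scale /= mulrCA mulVKf // phi_neq0.
Qed.

(** [Q] is the matrix of the conformal Hessian, symmetric because the logarithmic differential is
    closed and the connection torsion-free. *)
Lemma riem_conformal x : U x -> exists2 Q : 'M[R]_n, Q^T = Q &
  forall u v z w, riem (conformal_metric g phi) x u v z w =
    phi x * (riem g x u v z w
             - kulkarni_nomizu (inner Q) (inner (g x)) u v z w).
Proof.
move=> Ux; have gs := metric_sym gU Ux; have gu := metric_unit gU Ux.
have Ca := conformal_differential_smooth; have Da := conformal_differentialE.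
pose H u := conformal_hessian (g x) (invmx (g x)) (a x) ('D_u a x)
  (connection_mx g u x) u.
have Hlin : linear H.
  move=> c u v; rewrite /H; have [dC _] := Ca 1%N.
  rewrite (derive_linear (dC x Ux) c u v) (connection_linear gU Ux c u v).
  move: ('D_u a x) ('D_v a x) (connection_mx g u x) (connection_mx g v x).
  move: (a x) (g x) (invmx (g x)) => b G Gi p q P Q; rewrite /conformal_hessian.
  rewrite trmxD trmxZ; set s := 2^-1 * _.
  have -> : ((c *: u + v) *m b^T) 0 0 = c * (u *m b^T) 0 0 + (v *m b^T) 0 0.
    by rewrite mulmxDl -scalemxAl mxE mxE.
  move: ((u *m b^T) 0 0) ((v *m b^T) 0 0) => s1 s2.
  mx_ring.
have [Q HQ] : exists Q : 'M[R]_n, forall u, H u = u *m Q.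
  exists (\matrix_i H (delta_mx 0 i)) => u.
  rewrite (linear_row_scale u Hlin) mulmx_sum_row.
  by apply: eq_bigr => i _; rewrite rowK.
have Qs : Q^T = Q.
  apply: inner_inj => u v.
  have S b c : inner Q b c = (c *m ('D_b a x)^T) 0 0
     - (a x *m (c *m connection_mx g b x)^T) 0 0
     - (b *m (a x)^T) 0 0 * (c *m (a x)^T) 0 0
     + 2^-1 * (a x *m invmx (g x) *m (a x)^T) 0 0 * inner (g x) b c.
    rewrite /inner -HQ /H /conformal_hessian (row_col_sym c ('D_b a x)).
    rewrite (row_col_sym c (a x)).
    move: ('D_b a x) (connection_mx g b x) (a x) => p P q.
    rewrite trmx_mul !(mulmxDl, mulNmx) -!scalemxAl !mulmxA.
    move: (p *m c^T) (q *m P^T *m c^T) (q *m c^T) (b *m g x *m c^T) => m1 m2 m3 m4.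
    by rewrite !mxE.
  rewrite (_ : inner Q^T u v = inner Q v u); last first.
    rewrite /inner -[v *m Q *m u^T]trmxK [RHS]mxE.
    by rewrite !trmx_mul trmxK mulmxA.
  rewrite (S u v) (S v u).
  have := conformal_closed gU phi_smooth phi_gt0 Ca Da u v Ux.
  have := connection_sym gU u v Ux.
  move: ('D_u a x) ('D_v a x) (connection_mx g u x) (connection_mx g v x).
  by move=> p q P P' -> ->; rewrite (inner_sym u v gs) (mulrC ((v *m (a x)^T) 0 0)).
exists Q => // u v z w.
rewrite (riemE (conformal_metric_on gU phi_smooth phi_gt0)) // (riemE gU) //.
have E : curvature_mx (conformal_metric g phi) u v x = curvature_mx g u v x +
    kn_mx (g x) (invmx (g x)) (H u) (H v) u v.
  exact: (conformal_curvature gU phi_smooth phi_gt0 Ca Da u v Ux).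
rewrite E (HQ u) (HQ v).
rewrite (kn_mx_schouten u v gs Qs (mulmxV gu)).
rewrite -(inner_kn_form _ _ _ _ gs Qs) /conformal_metric.
move: (curvature_mx g u v x) (kn_form _ _ _ _) => A B.
have -> : (A + B *m invmx (g x)) *m (phi x *: g x) = phi x *: (A *m g x + B).
  by rewrite -scalemxAr mulmxDl -mulmxA mulVmx // mulmx1.
rewrite /inner -scalemxAr -scalemxAl mulmxDr mulmxDl.
move: (z *m B *m w^T) (z *m (A *m g x) *m w^T) => b c; rewrite !mxE.
by rewrite mulrDr opprD mulrBr mulrN.
Qed.

Lemma weyl_conformally_flat x v w z u : (2 < n)%N -> U x ->
  (forall v w z u, riem (conformal_metric g phi) x v w z u = 0) ->
  alg_weyl (g x) (riem g x) v w z u = 0.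
Proof.
move=> n2 Ux flat; have [Q Qs E] := riem_conformal Ux.
apply: (alg_weyl_flat (metric_sym gU Ux) (metric_unit gU Ux) n2 _ _ _ _ Qs).
move=> a b c d; apply/eqP; rewrite -subr_eq0; have /eqP := E a b c d.
by rewrite flat eq_sym mulf_eq0 gt_eqF ?phi_gt0.
Qed.

End ConformalWeyl.

(** * Warped products *)

Section ReflectiveAlgebra.
Variables (R : realType) (n : nat).
Local Notation V := 'rV[R]_n.
Variables (G E : 'M[R]_n) (e : V) (Rm : V -> V -> V -> V -> R) (k : 'I_n).
Hypotheses (G_sym : G^T = G) (G_unit : G \in unitmx).
Hypotheses (EGE : E *m G *m E^T = diag_mx e) (e1 : forall i, e 0 i = 1 \/ e 0 i = -1).
Hypothesis cR : curvature_tensor Rm.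
Hypothesis reflective : forall i j l, i != k -> j != k -> l != k ->
  Rm (row k E) (row i E) (row j E) (row l E) = 0.

(* [row k E] is orthogonal to the other basis vectors for the Ricci tensor as
   well, so that the Kulkarni-Nomizu term vanishes too. *)
Lemma reflective_weyl i j l : i != k -> j != k -> l != k ->
  alg_weyl G Rm (row k E) (row i E) (row j E) (row l E) = 0.
Proof.
move=> ik jk lk; rewrite /alg_weyl reflective // /kulkarni_nomizu.
have I p : p != k -> inner G (row k E) (row p E) = 0.
  by move=> pk; rewrite (basis_inner EGE) eq_sym (negbTE pk).
have S p : p != k -> alg_schouten G Rm (row k E) (row p E) = 0.
  move=> pk; rewrite /alg_schouten (I p pk) mulr0 subr0.
  rewrite (ricci_basis EGE e1 cR) big1 ?mulr0 // => a _.
  have [->|ak] := eqVneq a k; first by rewrite (curv_diag12 cR) mulr0.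
  by rewrite reflective // mulr0.
by rewrite !I ?S // !(mul0r, mulr0, subr0, addr0).
Qed.

End ReflectiveAlgebra.

Section WarpedMetric.
Variables (R : realType) (m n : nat) (U1 : set 'rV[R]_m) (U2 : set 'rV[R]_n).
Variables (g1 : 'rV[R]_m -> 'M[R]_m) (g2 : 'rV[R]_n -> 'M[R]_n).
Variable f : 'rV[R]_m -> R.
Hypotheses (gU1 : metric_on U1 g1) (gU2 : metric_on U2 g2).
Hypotheses (f_smooth : smooth U1 f) (f_gt0 : forall y, U1 y -> 0 < f y).
Hypothesis mn4 : (m + n = 4)%N.

Let U := rV_setX U1 U2.
Let oU1 := metric_open gU1.
Let oU2 := metric_open gU2.
Let oU : open U.
Proof. exact: rV_setX_open. Qed.

Definition warped_metric x : 'M[R]_(m + n) :=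
  block_mx (g1 (lsubmx x)) 0 0 (f (lsubmx x) ^+ 2 *: g2 (rsubmx x)).

Let h1 := conformal_metric g1 (fun y => (f y)^-1 ^+ 2).

Let h1U : metric_on U1 h1.
Proof.
have fi k : Ck k U1 (fun y => (f y)^-1).
  by apply: Ck_inv => // y Uy; rewrite gt_eqF // f_gt0.
apply: conformal_metric_on => // [k|y Uy]; first by apply: CkM.
by rewrite exprn_gt0 // invr_gt0 f_gt0.
Qed.

Let product := product_metric h1 g2.
Let factor (x : 'rV[R]_(m + n)) := f (lsubmx x) ^+ 2.

Let factor_smooth : smooth U factor.
Proof.
move=> k; have Cf : Ck k U (f \o lsubmx) := Ck_prodl U2 oU1 (f_smooth k).
by apply: CkM => //; exact: Cf.
Qed.

Let factor_gt0 x : U x -> 0 < factor x.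
Proof. by move=> [Ux _]; rewrite exprn_gt0 // f_gt0. Qed.

Let warpedE x : U x -> conformal_metric product factor x = warped_metric x.
Proof.
move=> [Ux _]; rewrite /conformal_metric /product /product_metric /warped_metric.
rewrite scale_block_mx !scaler0 /h1 /conformal_metric scalerA /factor.
by rewrite exprVn mulfV ?scale1r // expf_neq0 // gt_eqF // f_gt0.
Qed.

Lemma warped_metric_on : metric_on U warped_metric.
Proof.
apply: (metric_on_ext (g := conformal_metric product factor)) => //.
by apply: conformal_metric_on => //; exact: product_metric_on.
Qed.

Let n2 : (2 < m + n)%N. Proof. by rewrite mn4. Qed.

(** The product curvature is scaled and paired with the warped metric itself, so that one
    orthonormal basis serves both sides. Both tensors are compared with the Weyl tensor of the
    product, the second comparison being the case [Q = 0]. *)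
Let weyl_product x : U x -> forall v w z u,
  alg_weyl (warped_metric x) (riem warped_metric x) v w z u =
  alg_weyl (warped_metric x) (fun v w z u => factor x * riem product x v w z u)
    v w z u.
Proof.
move=> Ux v w z u.
have pU : metric_on U product by exact: product_metric_on.
have cU := conformal_metric_on pU factor_smooth factor_gt0.
have ps := metric_sym pU Ux; have pu := metric_unit pU Ux.
have f0 : factor x != 0 by rewrite gt_eqF // factor_gt0.
rewrite -(warpedE Ux).
have [Q Qs E] := riem_conformal pU factor_smooth factor_gt0 Ux.
transitivity (factor x * alg_weyl (product x) (riem product x) v w z u).
  apply: (alg_weyl_conformal ps pu n2 v w z u f0 Qs) => a b c d.
  rewrite -E; apply: esym; exact: (riem_ext cU warpedE).
apply: esym; apply: (alg_weyl_conformal ps pu n2 v w z u f0 (trmx0 _ _ _)).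
move=> a b c d; rewrite /kulkarni_nomizu /inner !mulmx0 !mul0mx !mxE.
by rewrite !mul0r !subr0 addr0 subr0.
Qed.

Variable x : 'rV[R]_(m + n).
Hypothesis Ux : U x.
Local Notation G := (warped_metric x).
Hypothesis osserman : forall s, s = 1 \/ s = -1 -> forall v w,
  inner G v v = s -> inner G w w = s ->
  \tr (jacobi_mx G (alg_weyl G (riem warped_metric x)) v *m
       jacobi_mx G (alg_weyl G (riem warped_metric x)) v) =
  \tr (jacobi_mx G (alg_weyl G (riem warped_metric x)) w *m
       jacobi_mx G (alg_weyl G (riem warped_metric x)) w).

Lemma warped_weyl_reflective (E1 : 'M[R]_m) (E2 : 'M[R]_n) e k :
  let E := block_mx E1 0 0 E2 in
  E *m G *m E^T = diag_mx e -> (forall i, e 0 i = 1 \/ e 0 i = -1) ->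
  (forall i j l, i != k -> j != k -> l != k ->
    riem product x (row k E) (row i E) (row j E) (row l E) = 0) ->
  forall v w z u, alg_weyl G (riem warped_metric x) v w z u = 0.
Proof.
move=> E EGE e1 refl.
have gs := metric_sym warped_metric_on Ux; have gu := metric_unit warped_metric_on Ux.
have cR := riem_curvature_tensor warped_metric_on Ux.
have cP : curvature_tensor (fun v w z u => factor x * riem product x v w z u).
  have [A B C D] := riem_curvature_tensor (product_metric_on h1U gU2) Ux.
  split=> [v z w c u u'|u v z w|u v z w|u v w z].
  - by rewrite A mulrDr mulrCA.
  - by rewrite B mulrN.
  - by rewrite C mulrN.
  - by rewrite -!mulrDr D mulr0.
apply: (weyl_osserman_reflective (k := k) mn4 gs gu EGE e1) => //.
- exact: alg_weyl_curvature.
- by move=> v w; apply: alg_weyl_traceless.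
move=> i j l ik jk lk; rewrite weyl_product //.
apply: (reflective_weyl EGE e1 cP) => // {ik jk lk}i {}j {}l ik jk lk.
by rewrite refl // mulr0.
Qed.

Lemma warped_weyl_eq0 : (0 < m)%N -> (0 < n)%N ->
  forall v w z u, alg_weyl G (riem warped_metric x) v w z u = 0.
Proof.
move=> m0 n0; have [Ux1 Ux2] := Ux.
have [E1 [d1 [EG1 D1]]] := orthonormal_basis (metric_sym gU1 Ux1) (metric_unit gU1 Ux1).
have f2 : f (lsubmx x) ^+ 2 \is a GRing.unit.
  by rewrite unitfE expf_neq0 // gt_eqF // f_gt0.
(* The basis of the fibre is taken orthonormal for the rescaled metric, which makes the
   block-diagonal basis orthonormal for the warped one. *)
have gs2 : (f (lsubmx x) ^+ 2 *: g2 (rsubmx x))^T = f (lsubmx x) ^+ 2 *: g2 (rsubmx x).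
  by rewrite linearZ /= (metric_sym gU2 Ux2).
have [E2 [d2 [EG2 D2]]] := orthonormal_basis gs2
  (etrans (unitmxZ _ f2) (metric_unit gU2 Ux2)).
pose E := block_mx E1 0 0 E2.
have EGE : E *m G *m E^T = diag_mx (row_mx d1 d2).
  rewrite /E /warped_metric tr_block_mx !trmx0 !mulmx_block.
  rewrite !(mulmx0, mul0mx, addr0, add0r) EG1 EG2.
  by rewrite diag_mx_row.
have De i : row_mx d1 d2 0 i = 1 \/ row_mx d1 d2 0 i = -1.
  by case: (split_ordP i) => j ->; rewrite ?row_mxEl ?row_mxEr.
have cP := riem_curvature_tensor (product_metric_on h1U gU2) Ux.
have cR1 := riem_curvature_tensor h1U Ux1.
have cR2 := riem_curvature_tensor gU2 Ux2.
have El i : row (lshift n i) E = row_mx (row i E1) 0.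
  by rewrite /E /block_mx rowKu row_row_mx row0.
have Er i : row (rshift m i) E = row_mx 0 (row i E2).
  by rewrite /E /block_mx rowKd row_row_mx row0.
(* In a factor of dimension at most 2 only one basis index can differ from [k], so two such
   arguments coincide or one is zero, and antisymmetry applies. *)
have small p (C : 'rV[R]_p -> 'rV[R]_p -> 'rV[R]_p -> 'rV[R]_p -> R)
    (F : 'M[R]_p) (k : 'I_p) : (p <= 2)%N -> curvature_tensor C ->
    forall a b (y z : 'rV[R]_p),
      (y = 0 \/ exists2 i, i != k & y = row i F) ->
      (z = 0 \/ exists2 i, i != k & z = row i F) -> C a b y z = 0.
  move=> p2 cC a b y z [->|[i ik ->]].
    by rewrite (linear_at0 (curv_linear3 cC a b z)).
  move=> [->|[j jk ->]]; first by rewrite (linear_at0 (curv_linear4 cC a b _)).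
  have -> : j = i.
    by apply/val_inj; move: ik jk; rewrite -!val_eqE /=; move: (ltn_ord i) (ltn_ord j) (ltn_ord k); lia.
  exact: curv_diag34.
have [m2|m2] := leqP m 2.
  pose k := lshift n (Ordinal m0).
  apply: (warped_weyl_reflective (k := k) EGE De) => i j l _ jk lk.
  rewrite (product_riem h1U gU2 _ _ _ _ Ux) El row_mxKr.
  rewrite (linear_at0 (curv_linear1 cR2 _ _ _)) addr0 row_mxKl.
  have side p : p != k -> lsubmx (row p E) = 0 \/
      exists2 i, i != Ordinal m0 & lsubmx (row p E) = row i E1.
    case: (split_ordP p) => q ->; rewrite ?Er ?El row_mxKl; last by left.
    by move=> qk; right; exists q => //; apply: contraNneq qk => ->.
  exact: (small _ _ E1 (Ordinal m0) m2 cR1 _ _ _ _ (side j jk) (side l lk)).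
have n2' : (n <= 2)%N by move: mn4 m2; lia.
pose k := rshift m (Ordinal n0).
apply: (warped_weyl_reflective (k := k) EGE De) => i j l _ jk lk.
rewrite (product_riem h1U gU2 _ _ _ _ Ux) Er row_mxKl.
rewrite (linear_at0 (curv_linear1 cR1 _ _ _)) add0r row_mxKr.
have side p : p != k -> rsubmx (row p E) = 0 \/
    exists2 i, i != Ordinal n0 & rsubmx (row p E) = row i E2.
  case: (split_ordP p) => q ->; rewrite ?Er ?El row_mxKr; first by left.
  by move=> qk; right; exists q => //; apply: contraNneq qk => ->.
exact: (small _ _ E2 (Ordinal n0) n2' cR2 _ _ _ _ (side j jk) (side l lk)).
Qed.

End WarpedMetric.

(** * From coordinate statements to the manifold *)

Section ManifoldCharts.
Variables (R : realType) (n : nat) (M : charted_space R n).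
Hypothesis HM : is_manifold M.
Implicit Types (g h : gram_field M) (i j : chart M) (p q : M) (U : set M).

Lemma local_metric_mapK g i p : chart_dom i p ->
  local_metric g i (chart_map i p) = g i p.
Proof. by move=> dp; rewrite /local_metric /= (chart_mapK HM). Qed.

Lemma local_metric_on U g i : open U -> pseudo_metric_on U g ->
  metric_on (chart_map i @` (U `&` chart_dom i)) (local_metric g i).
Proof.
move=> oU Hg; split=> [||x [p [Up dp] <-]|x [p [Up dp] <-]].
- exact: image_dom_open.
- exact: gram_smooth.
- by rewrite local_metric_mapK // (gram_sym Hg).
- by rewrite local_metric_mapK // (gram_nondegenerate Hg).
Qed.

Lemma pseudo_metric_sub U g : pseudo_metric g -> pseudo_metric_on U g.
Proof.
move=> Hg; split=> [i p _|i p _|i k|i j p _].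
- exact: (gram_sym Hg).
- exact: (gram_nondegenerate Hg).
- by apply: Ck_sub (gram_smooth Hg i k) => x [p [_ dp] <-]; exists p.
- exact: (gram_transition Hg).
Qed.

Lemma flat_local_weyl g i p : (2 < n)%N -> pseudo_metric g ->
  locally_conformally_flat g -> chart_dom i p -> forall v w z u,
  alg_weyl (local_metric g i (chart_map i p))
    (riem (local_metric g i) (chart_map i p)) v w z u = 0.
Proof.
move=> n2 Hg flat dp v w z u.
have [U [oU Up [h [Hh hflat [phi [phis phip hE]]]]]] := flat p.
have gD := local_metric_on i oU (pseudo_metric_sub U Hg).
have hD := local_metric_on i oU Hh.
have Dx : (chart_map i @` (U `&` chart_dom i)) (chart_map i p) by exists p.
apply: (weyl_conformally_flat gD (phis i)) => // [x [q [Uq dq] <-]|a b c d].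
  by rewrite /= (chart_mapK HM) //; exact: phip.
rewrite -(hflat i p Up dp a b c d); apply: esym; apply: (riem_ext hD) => //.
move=> x [q [Uq dq] <-]; rewrite local_metric_mapK // hE // /conformal_metric /=.
by rewrite local_metric_mapK // (chart_mapK HM).
Qed.

Lemma weyl0_conformally_osserman g :
  (forall i p, chart_dom i p -> forall v w z u,
     weyl (local_metric g i) (chart_map i p) v w z u = 0) ->
  conformally_osserman g.
Proof.
move=> W0 i p dp e _ v w _ _ l; congr (eigen_mult _ l).
rewrite /conformal_jacobi /jacobi_weyl /weyl_op; congr lin1_mx.
by apply/funext => y; congr (sharp _ _); apply/funext => z; rewrite !W0.
Qed.

Section FlatChart.
Variables (g : gram_field M) (i0 : chart M) (W : set 'rV[R]_n) (phi : 'rV[R]_n -> R).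
Hypothesis Hg : pseudo_metric g.
Hypothesis W_open : open W.
Hypothesis W_sub : W `<=` chart_map i0 @` chart_dom i0.
Hypothesis phi_smooth : smooth W phi.
Hypothesis phi_gt0 : forall x, W x -> 0 < phi x.
Hypothesis phi_flat : forall x, W x -> forall u v z w,
  riem (conformal_metric (local_metric g i0) phi) x u v z w = 0.

Let U : set M := chart_dom i0 `&` chart_map i0 @^-1` W.
Let factor q := phi (chart_map i0 q).
Let h i q := factor q *: g i q.
Let D i := chart_map i @` (U `&` chart_dom i).

Lemma flat_chart_open : open U.
Proof.
rewrite openE => q [dq Wq]; apply: filterI.
  by apply: open_nbhs_nbhs; split=> //; exact: chart_dom_open.
by apply: (chart_continuous HM dq); exact: open_nbhs_nbhs.
Qed.

Let D_open i : open (D i).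
Proof. exact: image_dom_open HM flat_chart_open. Qed.

Let T_smooth i : smooth (D i) (transition i i0).
Proof.
move=> k; apply: Ck_sub (transition_smooth HM i i0 k) => x [q [[dq _] dq'] <-].
by exists q.
Qed.

Let TW i x : D i x -> W (transition i i0 x).
Proof. by move=> [q [[dq Wq] dq'] <-]; rewrite /transition (chart_mapK HM). Qed.

Let factor_smooth : smooth_on U factor.
Proof.
move=> i k; have C : Ck k (D i) (phi \o transition i i0).
  exact (Ck_comp (@D_open i) W_open (@TW i) (T_smooth i k) (phi_smooth k)).
exact: C.
Qed.

Let h_metric : pseudo_metric_on U h.
Proof.
split=> [i q [dq Wq] dq'|i q [dq Wq] dq'|i k|i j q [dq Wq] di dj].
- by rewrite /h linearZ /= (gram_sym Hg).
- rewrite /h unitmxZ ?(gram_nondegenerate Hg) // unitfE gt_eqF //.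
  exact: phi_gt0.
- apply: (Ck_scalemx (@D_open i) (factor_smooth i k)).
  by apply: Ck_sub (gram_smooth Hg i k) => x [p [_ dp] <-]; exists p.
- move=> J; rewrite /h -scalemxAr -scalemxAl; congr (_ *: _).
  exact: (gram_transition Hg).
Qed.

(** Flatness is known in the chart [i0] only, whereas [flat_on] quantifies over all charts; the
    transition map to [i0] and its Jacobian carry it over by naturality of the curvature. *)
Let h_flat : flat_on U h.
Proof.
move=> i q Uq dq u v z w; have [d0 Wq] := Uq.
have gW : metric_on W (local_metric g i0).
  have Hg' := local_metric_on i0 openT Hg; apply: metric_on_sub Hg' W_open _.
  by move=> x /W_sub[p dp <-]; exists p.
have dT x : D i x -> differentiable (transition i i0) x.
  by move=> Dx; have [+ _] := T_smooth i 1%N; apply.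
have Dq : D i (chart_map i q) by exists q.
have JT x a : D i x -> 'D_a (transition i i0) x = a *m 'J (transition i i0) x.
  by move=> Dx; exact: deriveEjacobian (dT x Dx).
have J_smooth : smooth (D i) (fun x => 'J (transition i i0) x).
  move=> k; apply: Ck_mx (@D_open i) _ => a b.
  have [_ DT] := T_smooth i k.+1.
  have := Ck_coord 0 b (@D_open i) (DT (delta_mx 0 a)).
  apply: Ck_ext (@D_open i) _ => x Dx.
  by rewrite (JT _ _ Dx) -rowE mxE.
have hD := local_metric_on i flat_chart_open h_metric.
have cW := conformal_metric_on gW phi_smooth phi_gt0.
rewrite (riem_change hD cW (T_smooth i) J_smooth (@TW i)) //; last first.
  move=> x [p [[dp Wp] dp'] <-]; rewrite local_metric_mapK //.
  rewrite /conformal_metric /transition (chart_mapK HM) // local_metric_mapK //.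
  exact: (gram_transition h_metric).
exact: phi_flat (TW Dq) _ _ _ _.
Qed.

Lemma flat_chart_conformal : exists h',
  [/\ pseudo_metric_on U h', flat_on U h' & conformal_on U g h'].
Proof.
exists h; split; [exact: h_metric|exact: h_flat|]; exists factor; split=> // q [_ Wq]; exact: phi_gt0.
Qed.

End FlatChart.

Lemma weyl0_locally_conformally_flat g : (3 < n)%N -> pseudo_metric g ->
  (forall i p, chart_dom i p -> forall v w z u,
     weyl (local_metric g i) (chart_map i p) v w z u = 0) ->
  locally_conformally_flat g.
Proof.
move=> n4 Hg W0 p; have [i dp] := chart_dom_cover HM p.
have gD := local_metric_on i openT Hg; rewrite setTI in gD.
have Dp : (chart_map i @` chart_dom i) (chart_map i p) by exists p.
have W0' x : (chart_map i @` chart_dom i) x -> forall v w z u,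
    alg_weyl (local_metric g i x) (riem (local_metric g i) x) v w z u = 0.
  by move=> [q dq <-]; exact: W0.
have [W [phi [[oW Wp WD] [phis phi0 flat]]]] := weyl_schouten gD n4 W0' Dp.
exists (chart_dom i `&` chart_map i @^-1` W); split=> //.
  exact: flat_chart_open.
exact: flat_chart_conformal Hg oW WD phis phi0 flat.
Qed.

End ManifoldCharts.

Lemma warped_osserman_weyl (R : realType) (m n : nat)
    (B : charted_space R m) (F : charted_space R n)
    (gB : gram_field B) (gF : gram_field F) (f : B -> R) i p :
  (0 < m)%N -> (0 < n)%N -> (m + n = 4)%N ->
  is_manifold B -> is_manifold F ->
  pseudo_metric gB -> pseudo_metric gF ->
  smooth_on setT f -> (forall p : B, 0 < f p) ->
  conformally_osserman (warped_product gB gF f) -> chart_dom i p ->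
  forall v w z u,
  weyl (local_metric (warped_product gB gF f) i) (chart_map i p) v w z u = 0.
Proof.
move=> m0 n0 mn HB HF HgB HgF fs fp oss dp v w z u.
have gB1 := local_metric_on HB i.1 openT HgB; rewrite setTI in gB1.
have gF1 := local_metric_on HF i.2 openT HgF; rewrite setTI in gF1.
have fs1 := fs i.1; rewrite setTI in fs1.
have Dx : rV_setX (chart_map i.1 @` chart_dom i.1) (chart_map i.2 @` chart_dom i.2)
    (chart_map i p).
  by rewrite -prod_coord_image; exists p.
pose g x := warped_metric (local_metric gB i.1) (local_metric gF i.2)
  (f \o chart_inv i.1) x.
have gE : local_metric (warped_product gB gF f) i = g by [].
have gp : warped_product gB gF f i p = g (chart_map i p).
  by rewrite -gE (local_metric_mapK (is_manifold_prod HB HF)).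
have jacobiE a : conformal_jacobi (warped_product gB gF f) i p a =
    jacobi_mx (g (chart_map i p)) (alg_weyl (g (chart_map i p)) (riem g (chart_map i p))) a.
  by rewrite /conformal_jacobi gE.
rewrite gE; apply: (warped_weyl_eq0 gB1 gF1 fs1 (fun y _ => fp _) mn Dx _ m0 n0).
move=> s s1 a b ga gb; apply: eigen_mult_trace_sqr => l.
by rewrite -/g -!jacobiE; apply: (oss i p dp s s1); rewrite /pseudosphere /= gp.
Qed.

Theorem theorem3p2 (R : realType) (m n : nat)
    (B : charted_space R m) (F : charted_space R n)
    (gB : gram_field B) (gF : gram_field F) (f : B -> R) :
  (0 < m)%N -> (0 < n)%N -> (m + n = 4)%N ->
  is_manifold B -> is_manifold F ->
  pseudo_metric gB -> pseudo_metric gF ->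
  smooth_on setT f -> (forall p : B, 0 < f p) ->
  conformally_osserman (warped_product gB gF f) <->
  locally_conformally_flat (warped_product gB gF f).
Proof.
move=> m0 n0 mn HB HF HgB HgF fs fp.
have HM := is_manifold_prod HB HF.
have Hg := pseudo_metric_warped HB HF HgB HgF fs fp.
split=> [oss|flat].
  apply: (weyl0_locally_conformally_flat HM _ Hg); first by rewrite mn.
  by move=> i p dp; exact: warped_osserman_weyl oss dp.
apply: weyl0_conformally_osserman => i p dp v w z u.
by apply: (flat_local_weyl HM _ Hg flat dp); rewrite mn.
Qed.
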